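(* Let $\zeta$ be a primitive aperiodic bijective substitution of constant length $q\geq2$ on the alphabet $\{0,1\}$ such that $\zeta(0)$ starts with $0$. Let $I=\chi_\zeta^+$ be the (almost everywhere constant) top Lyapunov exponent of the spectral cocycle of $\zeta$. Let $t\geq0$ be an integer, let $a_1<\dots<a_t$ be positive integers, and for $\mathbf{x}\in X_\zeta$ let $C^{\pm}_N(a_1,\dots,a_t,\omega,\mathbf{x})$ be the twisted correlation of $F=\mathds{1}_{[0]}-\mathds{1}_{[1]}$ at $\mathbf{x}$. 1. If $t$ is even, there exists $B>0$, independent of $\omega$ and $t$, such that for Lebesgue almost every $\omega\in[0,1)$ and every $\mathbf{x}\in X_\zeta$, $$C^{\pm}_N(a_1,\dots,a_t,\omega,\mathbf{x})=O_{a_t,\omega}\left(N^{I/\log(q)}\log(N)^{t+1}e^{B\sqrt{\log(N)\log\log\log(N)}}\right).$$ 2. If $t$ is odd, then for every $\epsilon>0$ and Lebesgue almost every $\omega\in[0,1)$, for every $\mathbf{x}\in X_\zeta$, $$C^{\pm}_N(a_1,\dots,a_t,\omega,\mathbf{x})=O_{a_t,\omega}\left(\log(N)^{t+2+\epsilon}\right).$$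
   Context: Substitutions. Let $\mathcal{A}$ be a finite alphabet (here $\{0,1\}$) and $\mathcal{A}^+$ the set of finite non-empty words. A substitution is a map $\zeta:\mathcal{A}\to\mathcal{A}^+$, extended to words by concatenation; it has constant length $q$ if $|\zeta(a)|=q$ for all $a$, and is then bijective if for every position $j\in\{1,\dots,q\}$ the map sending $a$ to the $j$-th letter of $\zeta(a)$ is a permutation of $\mathcal{A}$. With $|w|_a$ the number of occurrences of $a$ in $w$, the substitution matrix is $M_\zeta(a,b)=|\zeta(b)|_a$, and $\zeta$ is primitive if some power of $M_\zeta$ has only positive entries. $X_\zeta$ is the set of $(x_n)_{n\in\mathbb{Z}}\in\mathcal{A}^{\mathbb{Z}}$ all of whose finite subwords are subwords of some $\zeta^n(a)$; $T$ is the left shift; $\zeta$ is aperiodic if $X_\zeta$ contains no shift-periodic sequence. Spectral cocycle. Write $e(x)=e^{2\pi i x}$, $m=\#\mathcal{A}$ and $\zeta(a)=w_1\dots w_{k_a}$. For $\xi\in(\mathbb{R}/\mathbb{Z})^m$ let $\mathscr{C}_\zeta(\xi,1)(a,b)=\sum_{j=1}^{k_a}\delta_{w_j,b}\,e(\xi_{w_1}+\dots+\xi_{w_{j-1}})$ ($\delta$ the Kronecker delta) and $\mathscr{C}_\zeta(\xi,n)=\mathscr{C}_\zeta((M_\zeta^T)^{n-1}\xi,1)\cdots\mathscr{C}_\zeta(\xi,1)$. With $\vec1=(1,\dots,1)^T$, $\chi_\zeta^+(\omega)=\limsup_{n\to\infty}\frac1n\log\|\mathscr{C}_\zeta(\omega\vec1,n)\|$;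 for constant length substitutions it is Lebesgue-almost everywhere equal to a constant, denoted $\chi_\zeta^+$. Twisted correlations. $\mathds{1}_{[a]}(\mathbf{x})$ equals $1$ if $x_0=a$ and $0$ otherwise, so $F(\mathbf{x})=(-1)^{x_0}$, and $$C^{\pm}_N(a_1,\dots,a_t,\omega,\mathbf{x})=\sum_{k=0}^{N-1}F(T^k\mathbf{x})F(T^{k+a_1}\mathbf{x})\cdots F(T^{k+a_t}\mathbf{x})\,e(k\omega).$$ For $t=0$ it is $\sum_{k=0}^{N-1}F(T^k\mathbf{x})e(k\omega)$. $O_{a_t,\omega}(G(N))$ denotes a quantity bounded in absolute value by $C\,G(N)$ for all integers $N\geq16$, where $C>0$ depends only on $a_t$ and $\omega$ (only on $\omega$ if $t=0$), and in the odd case, where $\epsilon$ is fixed first, possibly on $\epsilon$ ($\zeta$ is fixed throughout); in particular $C$ does not depend on $\mathbf{x}$. *)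

(* Defs.v *)
From HB Require Import structures.
From mathcomp Require Export all_boot all_order all_algebra.
From mathcomp Require Export all_classical all_reals all_analysis.
From mathcomp Require Export complex.

Set Implicit Arguments.
Unset Strict Implicit.
Unset Printing Implicit Defensive.

Import Order.TTheory GRing.Theory Num.Theory.

Local Open Scope ring_scope.

Record substitution (m : nat) := Substitution {
  subst_letter :> 'I_m -> seq 'I_m;
  subst_letter_neq0 : forall a, subst_letter a != [::] }.

Section Substitutions.
Variables (m : nat) (zeta : substitution m).

Definition subst_word (w : seq 'I_m) : seq 'I_m :=
  flatten [seq zeta a | a <- w].

Definition constant_length (q : nat) : Prop := forall a, size (zeta a) = q.

(* Positions are numbered from 0. The default value of [nth] is never used,
   as this notion is only meant for substitutions of constant length [q]. *)
Definition bijective_subst (q : nat) : Prop :=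
  forall j, (j < q)%N -> bijective (fun a : 'I_m => nth a (zeta a) j).

Definition subst_mx : 'M[nat]_m := \matrix_(a, b) count_mem a (zeta b).

Definition primitive_subst : Prop :=
  exists2 k : nat, (0 < k)%N & forall a b, (0 < (subst_mx ^+ k) a b)%N.

Definition in_language (w : seq 'I_m) : Prop :=
  exists (n : nat) (a : 'I_m), infix w (iter n subst_word [:: a]).

Definition subst_shift_space : set (int -> 'I_m) :=
  [set x | forall (k : int) (n : nat),
     in_language [seq x (k + i%:Z) | i <- iota 0 n]].

End Substitutions.

Definition shift (A : Type) (x : int -> A) : int -> A := fun n => x (n + 1).

Definition aperiodic_subst (m : nat) (zeta : substitution m) : Prop :=
  forall x, subst_shift_space zeta x ->
  ~ exists2 p : nat, (0 < p)%N & iter p (@shift _) x = x.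

Section SpectralCocycle.
Variable R : realType.
Local Notation C := (complex R).

Definition modulus (z : C) : R := Normc.normc z.

Definition e2pi (x : R) : C := Complex (cos (2 * pi * x)) (sin (2 * pi * x)).

Variables (m : nat) (zeta : substitution m).

(* A point of the torus is represented by a vector of real numbers: all the
   definitions below only depend on its coordinates modulo 1. *)
Definition cocycle1 (xi : 'cV[R]_m) : 'M[C]_m :=
  \matrix_(a, b) \sum_(j < size (zeta a))
    (tnth (in_tuple (zeta a)) j == b)%:R *
      e2pi (\sum_(c <- take j (zeta a)) xi c 0).

Definition subst_mxR : 'M[R]_m := map_mx (fun k : nat => k%:R) (subst_mx zeta).

Fixpoint cocycle (n : nat) (xi : 'cV[R]_m) : 'M[C]_m :=
  if n is k.+1
  then cocycle1 (subst_mxR^T ^+ k *m xi) *m cocycle k xi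
  else 1%:M.

(* The Lyapunov exponent does not depend on the choice of a matrix norm. *)
Definition max_norm (A : 'M[C]_m) : R :=
  \big[Num.max/0]_(i < m) \big[Num.max/0]_(j < m) modulus (A i j).

(* [lne] satisfies [lne 0 = -oo], contrary to the total function [ln]. *)
Definition lyapunov (omega : R) : \bar R :=
  limn_esup (fun n : nat =>
    ((n%:R^-1 : R)%:E * lne (max_norm (cocycle n (const_mx omega)))%:E)%E).

Definition is_top_lyapunov_exponent (chi : R) : Prop :=
  {ae (@lebesgue_measure R), forall omega : R, lyapunov omega = chi%:E}.

End SpectralCocycle.

Section TwistedCorrelations.
Variable R : realType.
Local Notation C := (complex R).

Definition cyl_indic (m : nat) (a : 'I_m) (x : int -> 'I_m) : C :=
  (x 0 == a)%:R.

Definition signF (x : int -> 'I_2) : C := cyl_indic 0 x - cyl_indic 1 x.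

Definition twisted_correlation (N : nat) (a : seq nat) (omega : R)
    (x : int -> 'I_2) : C :=
  \sum_(k < N) signF (iter k (@shift _) x) *
    (\prod_(i <- a) signF (iter (k + i) (@shift _) x)) * e2pi (k%:R * omega).

End TwistedCorrelations.

(* [a] lists positive integers a_1 < ... < a_t. *)
Definition increasing_positive (a : seq nat) : bool :=
  sorted ltn a && all (ltn 0) a.

(* Main.v *)
Require Import Defs.
From mathcomp Require Import measurable_realfun.
From mathcomp Require Import ring lra zify.

(** The subshift is described by a single sequence of signs. On two letters,
  bijectivity makes [zeta 1] the complement of [zeta 0]; hence, up to a global
  sign, the windows of the points of the subshift are windows of the generalized
  Thue-Morse sequence [v], characterized by [v (q m + j) = v m * eps j] with
  [eps j] the sign of the letter of index [j] of [zeta 0] ([window_tm_seq]).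
  Let [Q = q ^ r] exceed all the shifts [a_i]. On a residue class modulo [Q], the
  product of the [t + 1] signs is, up to a fixed sign, one of [1], [v m],
  [v (m + 1)] and [v m * v (m + 1)], where the parity of the number of factors is
  that of [t + 1] ([prod_shifts]); the frequency becomes [Q omega].

  For [t] even, a single factor is left. Cutting into blocks of length [q] bounds
  the sum of [v m e(m omega)] over an interval of length [q ^ n] by a multiple of
  the sum over [k <= n] of [|P_k(omega)|], where [P_k(omega)] is the product over
  [i < k] of [P(q ^ i omega)] and [P(omega)] is the sum of the [eps j e(j omega)]
  ([modulus_exp_sum_tm]). The vector [(1, -1)] is an eigenvector of the cocycle,
  with eigenvalue [P_k], so that [|P_k|] grows at rate at most [chi] almost
  everywhere ([lyapunov_twist_prod]). The roots of [P] give
  [|P(x)| = c * prod_i |1 - rho_i e(x - tau_i)|] with [0 <= rho_i <= 1], where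
  [c >= 1] is the Mahler measure ([modulus_trig_factor]). As the mean of
  [ln |P_k|] is at least [k ln c], dominated convergence gives [ln c <= chi]
  ([mahler_measure_le]), and it remains to bound, for each root, the products of
  the [|1 - rho e(q ^ i x - tau)|], [i < n], by [exp (O(sqrt (n ln ln n)))].

  This is the upper half of a law of the iterated logarithm for a lacunary sum
  ([ae_orbit_prod_le]). The function [ln |1 - rho e(x)|] is not bounded below, but
  only an upper bound matters, and it is at most [X + O(1/M)] for a trigonometric
  polynomial [X] of degree [M ^ 2] and mean zero ([circle_dist_le_exp_logpoly]). With
  [lam = 1/M], the mean of the product of the [exp (lam X(q ^ i x))] is at most
  [(1 + O(lam ^ 2)) ^ n] ([mean01_prod_exp_logpoly]): in place of independence,
  one follows the Fourier coefficients of the partial products at the multiples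
  of [q ^ k], which remain dominated by [lam / sqrt |l|] at [q ^ k l]. Since the
  coefficients of [X] are of the order of [1/|l|], multiplying by [X] costs a
  logarithm of the degree ([conv_log_le]), while the passage from [q ^ k] to
  [q ^ (k + 1)] gains [1 / sqrt q] ([decay_mul]). The inequality of Markov, a
  chaining over dyadic blocks and the lemma of Borel and Cantelli conclude.

  For [t] odd, no factor or two consecutive ones are left. For two of them, all
  the residue classes modulo [q] but the last give geometric sums, and the last
  one gives a sum of the same kind at frequency [q omega]
  ([modulus_exp_sum_pair]). The correlation is thus bounded by the sum of
  [1 / |1 - e(Q q ^ k omega)|] over [k = O(log N)], and each term is [O(k ^ 2)]
  almost everywhere ([ae_small_denominators]). This gives [log(N) ^ 3], and
  [3 <= t + 2].

  Finally, there are finitely many sequences of shifts with a given last term,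
  so that the constants can be chosen to depend on this term only
  ([uniform_constant]). *)

Set Implicit Arguments.
Unset Strict Implicit.
Unset Printing Implicit Defensive.

Import Order.TTheory GRing.Theory Num.Theory.
Import numFieldNormedType.Exports.

Local Open Scope ring_scope.
Local Open Scope classical_set_scope.

(** * Means over the unit interval and almost everywhere statements *)

Section Mean.
Variable R : realType.
Local Notation mu := (@lebesgue_measure R).
Implicit Types (f g : R -> R).

Definition mean01 f : R := \int[mu]_(x in `[0, 1]) f x.

Lemma eq_mean01 f g : f =1 g -> mean01 f = mean01 g.
Proof. by move=> fg; congr mean01; exact: funext. Qed.

Lemma integrable01 f : continuous f -> mu.-integrable `[0, 1] (EFin \o f).
Proof.
move=> cf; apply: continuous_compact_integrable; first exact: segment_compact.
exact: continuous_subspaceT.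
Qed.

Lemma mean01D f g : continuous f -> continuous g ->
  mean01 (fun x => f x + g x) = mean01 f + mean01 g.
Proof. by move=> cf cg; rewrite /mean01 RintegralD//; exact: integrable01. Qed.

Lemma mean01Z c f : continuous f -> mean01 (fun x => c * f x) = c * mean01 f.
Proof. by move=> cf; rewrite /mean01 RintegralZl//; exact: integrable01. Qed.

Lemma mean01_cst c : mean01 (fun=> c) = c.
Proof.
rewrite /mean01 Rintegral_cst//= lebesgue_measure_itv/=.
by rewrite lte_fin ltr01 /= subr0 mulr1.
Qed.

Lemma continuous_sum I (r : seq I) (F : I -> R -> R) :
  (forall i, continuous (F i)) -> continuous (fun x => \sum_(i <- r) F i x).
Proof.
move=> cF; elim: r => [|i r IH].
  by move=> x; under eq_fun do rewrite big_nil; exact: cvg_cst.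
move=> x; under eq_fun do rewrite big_cons.
by apply: cvgD; [exact: cF | exact: IH].
Qed.

Lemma continuous_prod I (r : seq I) (F : I -> R -> R) :
  (forall i, continuous (F i)) -> continuous (fun x => \prod_(i <- r) F i x).
Proof.
move=> cF; elim: r => [|i r IH].
  by move=> x; under eq_fun do rewrite big_nil; exact: cvg_cst.
move=> x; under eq_fun do rewrite big_cons.
by apply: cvgM; [exact: cF | exact: IH].
Qed.

Lemma mean01_sum I (r : seq I) (F : I -> R -> R) :
  (forall i, continuous (F i)) ->
  mean01 (fun x => \sum_(i <- r) F i x) = \sum_(i <- r) mean01 (F i).
Proof.
move=> cF; elim: r => [|i r IH].
  rewrite big_nil -[RHS](mean01_cst 0); congr mean01.
  by apply: funext => x; rewrite big_nil.
rewrite big_cons -IH -mean01D//; last exact: continuous_sum.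
by congr mean01; apply: funext => x; rewrite big_cons.
Qed.

Lemma le_mean01 f g : continuous f -> continuous g ->
  (forall x, f x <= g x) -> mean01 f <= mean01 g.
Proof.
move=> cf cg fg; apply: le_Rintegral => //; exact: integrable01.
Qed.

Lemma continuous_cos_affine (c s : R) : continuous (fun x : R => cos (c * x + s)).
Proof.
move=> x; apply: (@continuous_comp _ _ _ (fun x : R => c * x + s) cos).
  by apply: cvgD; [apply: cvgM; [exact: cvg_cst | exact: cvg_id] | exact: cvg_cst].
exact: continuous_cos.
Qed.

Lemma cos_sinDint (x : R) (k : int) :
  cos (x + 2 * pi * k%:~R) = cos x /\ sin (x + 2 * pi * k%:~R) = sin x.
Proof.
have Hn (n : nat) (y : R) :
   cos (y + 2 * pi * n%:R) = cos y /\ sin (y + 2 * pi * n%:R) = sin y.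
  have -> : 2 * pi * n%:R = (pi *+ 2) *+ n :> R by rewrite mulr_natr (mulr_natl pi 2).
  by rewrite (periodicn (@cosD2pi R)) (periodicn (@sinD2pi R)).
case: k => n; first exact: Hn.
(* A negative shift is undone by the opposite positive one. *)
have [<- <-] := Hn n.+1 (x + 2 * pi * (Negz n)%:~R).
rewrite NegzE mulrNz -addrA mulrN addNr addr0; split=> //.
Qed.

Lemma mean01_cos (k : int) (s : R) :
  mean01 (fun x => cos (2 * pi * k%:~R * x + s)) = if k == 0 then cos s else 0.
Proof.
have [->|k0] := eqVneq.
  rewrite -[RHS]mean01_cst; congr mean01; apply: funext => x.
  by rewrite mulr0 mul0r add0r.
have pi0 : (pi : R) != 0 by rewrite gt_eqF// pi_gt0.
set c := 2 * pi * k%:~R.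
have c0 : c != 0 by rewrite !mulf_neq0// intr_eq0.
pose F (x : R) := c^-1 * sin (c * x + s).
have dF (x : R) : is_derive x (1 : R) F (cos (c * x + s)).
  have dc : is_derive x (1 : R) (fun y : R => c * y + s) c.
    by apply: is_derive_eq; rewrite /GRing.scale/= !mulr1 addr0.
  have := is_derive1_comp (f := @sin R) (g := fun y : R => c * y + s) (x := x) (is_derive_sin _) dc.
  move=> /(is_deriveZ c^-1) D; apply: is_derive_eq.
  by rewrite /GRing.scale/=; field.
rewrite /mean01 /Rintegral (@continuous_FTC2 R _ F)//.
- by rewrite /= /F mulr1 mulr0 add0r [c + s]addrC (cos_sinDint s k).2 subrr.
- by apply: continuous_subspaceT; exact: continuous_cos_affine.
- split.
  + by move=> x _; apply: ex_derive.
  + apply: cvg_at_right_filter; apply: differentiable_continuous.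
    by apply/derivable1_diffP; apply: ex_derive.
  + apply: cvg_at_left_filter; apply: differentiable_continuous.
    by apply/derivable1_diffP; apply: ex_derive.
- by move=> x _; rewrite derive1E; apply: derive_val.
Qed.

Lemma markov_mean01 f (t : R) : continuous f -> (forall x, 0 <= f x) -> 0 < t ->
  (mu (`[0%R, 1%R]%classic `&` [set x | (t <= f x)%R]) <= (mean01 f / t)%:E)%E.
Proof.
move=> cf f0 t0.
have mf := measurable_int _ (integrable01 cf).
have h := le_integral_abse mu (measurable_itv _) mf t0.
rewrite EFinM muleC lee_pdivlMl//.
have -> : [set x | (t <= f x)%R] = [set x | (t%:E <= `|(EFin \o f) x|)%E].
  by apply/seteqP; split => x /=; rewrite lee_fin ger0_norm.
apply: (le_trans h).
under eq_integral do rewrite /= ger0_norm//.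
rewrite /mean01 /Rintegral fineK//.
by apply: integrable_fin_num => //; exact: integrable01.
Qed.

Lemma measurable_ge_continuous f (t : R) : continuous f ->
  measurable (`[0%R, 1%R]%classic `&` [set x | t <= f x]).
Proof.
move=> cf.
have mf : measurable_fun (`[0, 1] : set (measurableTypeR R)) f.
  apply: subspace_continuous_measurable_fun => //; exact: continuous_subspaceT.
have := mf (measurable_itv _) `[t, +oo[%classic (measurable_itv _).
by congr measurable; apply/seteqP; split => x /=; rewrite !in_itv/= andbT.
Qed.

Lemma ae_mono (P Q : R -> Prop) : (forall x, P x -> Q x) ->
  {ae mu, forall x, P x} -> {ae mu, forall x, Q x}.
Proof. by move=> PQ; apply: negligibleS => x /= nQ Px; apply/nQ/PQ. Qed.

Lemma ae_and (P Q : R -> Prop) : {ae mu, forall x, P x} ->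
  {ae mu, forall x, Q x} -> {ae mu, forall x, P x /\ Q x}.
Proof.
move=> hP hQ; apply: negligibleS (negligibleU hP hQ) => x /= nPQ.
by have [Px|] := pselect (P x); [right => Qx; apply: nPQ | left].
Qed.

(** This is the first lemma of Borel and Cantelli: the points that lie in infinitely
  many of the sets form a set of measure zero. *)
Lemma ae_eventually_notin (B : nat -> set R) (b : nat -> R) :
  (forall j, measurable (B j)) -> (forall j, 0 <= b j) ->
  (forall j, (mu (B j) <= (b j)%:E)%E) -> cvgn (series b) ->
  {ae mu, forall x, exists j0, forall j, (j0 <= j)%N -> ~ B j x}.
Proof.
move=> mB b0 Bb cb.
have : mu (lim_sup_set B) = 0%E.
  apply: lim_sup_set_cvg0 => //.
  apply: (@le_lt_trans _ _ (\sum_(n <oo) (b n)%:E)%E).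
    by apply: lee_nneseries => [n _ _|n _]; [exact: measure_ge0|exact: Bb].
  have -> : (\sum_(n <oo) (b n)%:E)%E = (limn (series b))%:E.
    rewrite -EFin_lim//; congr (limn _); apply: funext => n /=.
    by rewrite /series/= sumEFin.
  by rewrite ltry.
move=> h; exists (lim_sup_set B); split => //.
  apply: bigcapT_measurable => n. apply: bigcup_measurable => k kn. exact: mB.
move=> x /= nx n _.
apply: contrapT => nb; apply: nx; exists n => j nj Bj; apply: nb.
by exists j.
Qed.

End Mean.

(** * Fourier weights stable under convolution with the reciprocals *)

Section Harmonic.
Variable R : realType.

Definition harmonic_sum (K : nat) : R := \sum_(l < K) l.+1%:R^-1.

Lemma harmonic_sum_ge0 K : 0 <= harmonic_sum K.
Proof. by apply: sumr_ge0 => l _; rewrite invr_ge0. Qed.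

Lemma harmonic_sum_ge1 K : (0 < K)%N -> 1 <= harmonic_sum K.
Proof.
case: K => // K _; rewrite /harmonic_sum big_ord_recl invr1 lerDl.
by apply: sumr_ge0 => l _; rewrite invr_ge0.
Qed.

Definition pos_inv (k : int) : R := if 0 < k then k%:~R^-1 else 0.

(** The positive integers among [K] consecutive ones dominate [1, ..., K] term
  by term. *)
Lemma sum_pos_inv_le K (k : int) :
  \sum_(l < K) pos_inv (k + l.+1%:Z) <= harmonic_sum K.
Proof.
elim: K k => [|K IH] k; first by rewrite /harmonic_sum !big_ord0.
have [k0|k0] := leP 0 k.
  apply: ler_sum => l _; rewrite /pos_inv; case: ifPn => // _.
  rewrite lef_pV2 ?posrE ?ltr0n ?ltr0z//; last by lia.
  by rewrite -[leLHS]/((Posz l.+1)%:~R) ler_int; lia.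
rewrite big_ord_recl {1}/pos_inv ifF ?add0r; last by rewrite /=; lia.
rewrite (eq_bigr (fun l : 'I_K => pos_inv ((k + 1) + l.+1%:Z))); last first.
  by move=> l _; congr pos_inv; rewrite lift0; lia.
apply: (le_trans (IH _)); rewrite /harmonic_sum big_ord_recr/= lerDl.
by rewrite invr_ge0.
Qed.

Definition abs_inv (k : int) : R := if k == 0 then 0 else (`|k|%:~R)^-1.

Lemma abs_invE k : abs_inv k = pos_inv k + pos_inv (- k).
Proof.
rewrite /abs_inv /pos_inv oppr_gt0; case: ltgtP => k0.
- by rewrite addr0 gtr0_norm.
- by rewrite add0r ltr0_norm.
- by rewrite addr0.
Qed.

Lemma sum_abs_inv_le K (k : int) :
  \sum_(l < K) abs_inv (k + l.+1%:Z) <= 2 * harmonic_sum K.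
Proof.
under eq_bigr do rewrite abs_invE.
rewrite big_split/= mulr_natl mulr2n lerD// ?sum_pos_inv_le//.
rewrite (reindex_inj rev_ord_inj)/=.
rewrite (eq_bigr (fun l : 'I_K => pos_inv ((- k - K%:Z - 1) + l.+1%:Z))); last first.
  by move=> l _; congr pos_inv; rewrite subnSK//; have := ltn_ord l; lia.
exact: sum_pos_inv_le.
Qed.

(** The exponent [1/2] is a compromise: the weight has to be nearly stable under
  convolution with [1/|l|], which excludes exponents above [1], and to decrease
  by a fixed factor from [k] to [q k], which excludes the exponent [0]. *)
Definition decay (k : int) : R := if k == 0 then 0 else (Num.sqrt (`|k|%:~R))^-1.

Lemma decay_ge0 k : 0 <= decay k.
Proof. by rewrite /decay; case: ifP => // _; rewrite invr_ge0 sqrtr_ge0. Qed.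

Lemma decay0 : decay 0 = 0. Proof. by rewrite /decay eqxx. Qed.

Lemma decayS (n : nat) : decay n.+1%:Z = (Num.sqrt n.+1%:R)^-1.
Proof. by []. Qed.

Lemma decayN k : decay (- k) = decay k.
Proof. by rewrite /decay oppr_eq0 normrN. Qed.

(** With [a], [c] and [d] the square roots of [|k + l|], [l] and [|k|], this is
  [d a <= (a + c) a <= 3/2 a^2 + 1/2 c^2]. *)
Lemma decay_shift (k : int) (l : nat) : k != 0 ->
  decay (k + l.+1%:Z) / l.+1%:R <=
  decay k * (3 / 2 * l.+1%:R^-1 + 2^-1 * abs_inv (k + l.+1%:Z)).
Proof.
move=> k0; rewrite {1}/decay /abs_inv; case: ifPn => [_|kl0].
  rewrite mul0r mulr0 addr0 !mulr_ge0 ?decay_ge0//; lra.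
rewrite /decay (negbTE k0).
set A : R := `|k + _|%:~R; set D : R := `|k|%:~R; set C : R := l.+1%:R.
have A0 : 0 < A by rewrite ltr0z normr_gt0.
have D0 : 0 < D by rewrite ltr0z normr_gt0.
have C0 : 0 < C by rewrite ltr0n.
have DAC : D <= A + C.
  rewrite /D /A /C -[l.+1%:R]/((Posz l.+1)%:~R) -intrD ler_int.
  by lia.
set a := Num.sqrt A; set c := Num.sqrt C; set d := Num.sqrt D.
have a0 : 0 < a by rewrite sqrtr_gt0.
have c0 : 0 < c by rewrite sqrtr_gt0.
have d0 : 0 < d by rewrite sqrtr_gt0.
have dac : d <= a + c.
  rewrite -(@ler_pXn2r _ 2)// ?nnegrE ?addr_ge0 ?sqrtr_ge0//.
  have := DAC; rewrite -[D](@sqr_sqrtr R) ?(ltW D0)// -/d.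
  rewrite -[A](@sqr_sqrtr R) ?(ltW A0)// -/a -[C](@sqr_sqrtr R) ?(ltW C0)// -/c.
  nra.
rewrite -[A](@sqr_sqrtr R) ?(ltW A0)// -/a -[C](@sqr_sqrtr R) ?(ltW C0)// -/c.
rewrite -subr_ge0.
have -> : d^-1 * (3 / 2 * (c ^+ 2)^-1 + 2^-1 * (a ^+ 2)^-1) - a^-1 / c ^+ 2 =
   (3 / 2 * a ^+ 2 + 2^-1 * c ^+ 2 - d * a) / (d * c ^+ 2 * a ^+ 2).
  by field; rewrite ?(gt_eqF a0) ?(gt_eqF c0) ?(gt_eqF d0).
apply: divr_ge0; last by rewrite !mulr_ge0// ?exprn_ge0// ltW.
have h1 : d * a <= (a + c) * a by rewrite ler_wpM2r// ltW.
by have := sqr_ge0 (a - c); lra.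
Qed.

Lemma decay_mul (q : nat) (k : int) : (2 <= q)%N -> k != 0 ->
  decay (q%:Z * k) <= 5 / 7 * decay k.
Proof.
move=> q2 k0; rewrite /decay mulf_eq0 (negbTE k0) orbF ifF; last by lia.
have D0 : 0 < `|k|%:~R :> R by rewrite ltr0z normr_gt0.
rewrite normrM intrM sqrtrM ?ler0z// invfM ler_wpM2r ?invr_ge0 ?sqrtr_ge0//.
have q2' : 2 <= (`|q%:Z|%:~R : R) by rewrite -[2]/((Posz 2)%:~R) ler_int; lia.
set y : R := _%:~R in q2' *.
(* [7/5] is a rational lower bound of [sqrt 2]. *)
have h75 : (7 / 5 : R) <= Num.sqrt y.
  rewrite -[leLHS]ger0_norm; last lra.
  rewrite -sqrtr_sqr ler_wsqrtr//; apply: le_trans q2'; lra.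
have -> : (5 / 7 : R) = (7 / 5)^-1 by field.
by rewrite lef_pV2 ?posrE//; lra.
Qed.

Definition conv_log (K : nat) (w : int -> R) (k : int) : R :=
  \sum_(l < K) (w (k + l.+1%:Z) + w (k - l.+1%:Z)) / (2 * l.+1%:R).

Lemma sum_inv_sqrt3_le K :
  \sum_(l < K) decay l.+1%:Z / l.+1%:R <= 3.
Proof.
case: K => [|K]; first by rewrite big_ord0.
(* The sum of the [l^(-3/2)] is compared with the integral of [x^(-3/2)]. *)
suff : \sum_(l < K.+1) decay l.+1%:Z / l.+1%:R <= 3 - 2 * decay K.+1%:Z.
  by have := decay_ge0 K.+1%:Z; lra.
elim: K => [|K IH].
  by rewrite big_ord_recr big_ord0 /= decayS (_ : 1%:R = 1 :> R)// sqrtr1 invr1; lra.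
rewrite big_ord_recr/=; apply: le_trans (lerD IH (lexx _)) _ => {IH}.
rewrite !decayS.
set x := Num.sqrt K.+1%:R; set y := Num.sqrt K.+2%:R.
have x0 : 0 < x by rewrite sqrtr_gt0.
have y0 : 0 < y by rewrite sqrtr_gt0.
have xx : x ^+ 2 = K.+1%:R by rewrite sqr_sqrtr.
have yy : y ^+ 2 = K.+2%:R by rewrite sqr_sqrtr.
have yx : y ^+ 2 = x ^+ 2 + 1 by rewrite yy xx natr1.
rewrite -yy -subr_ge0.
have -> : 3 - 2 * y^-1 - (3 - 2 * x^-1 + y^-1 / y ^+ 2) =
   (2 * y ^+ 2 * (y - x) - x) / (x * y ^+ 3).
  by field; rewrite ?(gt_eqF x0) ?(gt_eqF y0).
apply: divr_ge0; last by rewrite !mulr_ge0// ?exprn_ge0// ltW.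
have yx1 : (y - x) * (y + x) = 1 by rewrite -subr_sqr yx; ring.
have xy : x <= y by rewrite ler_wsqrtr// ler_nat.
have yxp : 0 < y + x by lra.
rewrite -(pmulr_lge0 _ yxp).
have -> : (2 * y ^+ 2 * (y - x) - x) * (y + x) = 2 * y ^+ 2 * ((y - x) * (y + x)) - x * (y + x) by ring.
rewrite yx1; nra.
Qed.

(** Convolution with [1/(2|l|)], [0 < |l| <= K], nearly preserves the decay
  rate [|k|^(-1/2)]: it costs only a factor of the order of [ln K]. The mass [a]
  at [0] is spread with weight [1/(2|k|)], which is below [decay k / 2]. *)
Lemma conv_log_le K (w : int -> R) (a b : R) : 0 <= a -> 0 <= b ->
  (forall k, w k <= a * (k == 0)%:R + b * decay k) ->
  forall k, conv_log K w k <= 3 * b * (k == 0)%:R +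
    (a / 2 + 5 / 2 * harmonic_sum K * b) * decay k.
Proof.
move=> a0 b0 wab k.
have H0 := harmonic_sum_ge0 K.
have [->|k0] := eqVneq k 0.
  rewrite decay0 mulr0 addr0 mulr1 /conv_log.
  apply: (@le_trans _ _ (b * \sum_(l < K) decay l.+1%:Z / l.+1%:R)); last first.
    by rewrite mulrC ler_wpM2r// sum_inv_sqrt3_le.
  rewrite mulr_sumr; apply: ler_sum => l _.
  have := wab (0 + l.+1%:Z); have := wab (0 - l.+1%:Z).
  rewrite !add0r oppr_eq0 /= !mulr0 !add0r decayN => h1 h2.
  rewrite invfM mulrA mulrA ler_wpM2r ?invr_ge0//; lra.
rewrite mulr0 add0r /conv_log.
apply: (@le_trans _ _ (\sum_(l < K) ((a / 2) * ((k + l.+1%:Z == 0)%:R + (k - l.+1%:Z == 0)%:R) / l.+1%:R) +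
   b * (\sum_(l < K) 2^-1 * (decay (k + l.+1%:Z) / l.+1%:R) + \sum_(l < K) 2^-1 * (decay (- k + l.+1%:Z) / l.+1%:R)))).
  rewrite -big_split/= mulr_sumr -big_split/=; apply: ler_sum => l _.
  have := wab (k + l.+1%:Z); have := wab (k - l.+1%:Z).
  rewrite -[decay (k - _)]decayN opprB [_ - k]addrC.
  set d1 := decay _; set d2 := decay _ => h1 h2.
  have l0 : 0 < l.+1%:R^-1 :> R by rewrite invr_gt0.
  rewrite invfM mulrA; move: l0 h1 h2; set L := _^-1; set w1 := w _; set w2 := w _.
  set x1 := _%:R; set x2 := _%:R => l0 h1 h2.
  have : 0 <= L * (a * x2 + b * d1 + (a * x1 + b * d2) - (w1 + w2)).
    apply: mulr_ge0; lra.
  lra.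
(* The two Dirac masses meet the range of [l] at most once, for [l.+1 = |k|]. *)
have E1 : \sum_(l < K) ((a / 2) * ((k + l.+1%:Z == 0)%:R + (k - l.+1%:Z == 0)%:R) / l.+1%:R)
   <= a / 2 * decay k.
  have dk : abs_inv k <= decay k.
    rewrite /abs_inv /decay (negbTE k0).
    have D1 : 1 <= `|k|%:~R :> R by rewrite -[1]/(1%:~R) ler_int; lia.
    rewrite lef_pV2 ?posrE ?sqrtr_gt0; [|lra|lra].
    rewrite -[leRHS]ger0_norm; last lra.
    rewrite -sqrtr_sqr ler_wsqrtr//; nra.
  under eq_bigr do rewrite -mulrA; rewrite -mulr_sumr; apply: ler_wpM2l; first lra.
  apply: le_trans dk; rewrite /abs_inv (negbTE k0).
  have [Hk|Hk] := leqP `|k|%N K; last first.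
    rewrite big1 ?invr_ge0 ?ler0z// => l _.
    have lK := ltn_ord l.
    have -> : (k + l.+1%:Z == 0) = false by lia.
    have -> : (k - l.+1%:Z == 0) = false by lia.
    by rewrite addr0 mul0r.
  have ka : (`|k|.-1 < K)%N by lia.
  rewrite (bigD1 (Ordinal ka))//= big1 ?addr0; last first.
    move=> l; rewrite -val_eqE/= => lk.
    have -> : (k + l.+1%:Z == 0) = false by lia.
    have -> : (k - l.+1%:Z == 0) = false by lia.
    by rewrite addr0 mul0r.
  rewrite prednK; last by lia.
  have -> : `|k|%N%:R = `|k|%:~R :> R by rewrite -[LHS]/((Posz `|k|%N)%:~R) abszE.
  rewrite -[leRHS]mul1r ler_wpM2r ?invr_ge0 ?ler0z//.
  case: (ltrP 0 k) => k1.
    have -> : (k + `|k|%N%:Z == 0) = false by lia.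
    by rewrite add0r lern1; case: eqP.
  have -> : (k - `|k|%N%:Z == 0) = false by lia.
  by rewrite addr0 lern1; case: eqP.
have E2 (j : int) : j != 0 -> \sum_(l < K) 2^-1 * (decay (j + l.+1%:Z) / l.+1%:R) <=
    5 / 4 * harmonic_sum K * decay j.
  move=> j0; apply: (@le_trans _ _ (\sum_(l < K) 2^-1 * (decay j * (3 / 2 * l.+1%:R^-1 + 2^-1 * abs_inv (j + l.+1%:Z))))).
    apply: ler_sum => l _; rewrite ler_wpM2l ?invr_ge0//.
    exact: decay_shift.
  rewrite -mulr_sumr -mulr_sumr big_split/= -!mulr_sumr -/(harmonic_sum K).
  have := sum_abs_inv_le K j; have := decay_ge0 j; nra.
have := E2 k k0; have := E2 (- k); rewrite oppr_eq0 decayN => /(_ k0) e2 e1.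
nra.
Qed.

End Harmonic.

(** * Exponential moments of lacunary sums *)

Section TrigPoly.
Variable R : realType.
Implicit Types (F : R -> R) (w : int -> R).

Let eq_le_of (x y : R) : x = y -> x <= y. Proof. by move->. Qed.

(** The truncation at order [K] of the Fourier series of [ln |1 - rho e(x - tau)|]. *)
Definition logpoly (K : nat) (rho tau x : R) : R :=
  - \sum_(l < K) rho ^+ l.+1 / l.+1%:R * cos (2 * pi * l.+1%:R * (x - tau)).

Lemma continuous_scaled (f : R -> R) (b : R) : continuous f ->
  continuous (fun x => f (b * x)).
Proof.
move=> cf x; apply: (@continuous_comp _ _ _ (fun x => b * x) f); last exact: cf.
by apply: cvgM; [exact: cvg_cst | exact: cvg_id].
Qed.

Lemma continuous_logpoly K rho tau : continuous (logpoly K rho tau).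
Proof.
move=> x; apply: cvgN; apply: continuous_sum => l {}x.
apply: cvgM; first exact: cvg_cst.
set c := 2 * pi * _; move: x.
rewrite -/(continuous (fun x => cos (c * (x - tau)))).
rewrite (_ : (fun x => _) = (fun x => cos (c * x + - (c * tau)))).
  exact: continuous_cos_affine.
by apply: funext => y; rewrite mulrBr.
Qed.

Lemma logpoly_le_harmonic K rho tau x : 0 <= rho <= 1 ->
  `|logpoly K rho tau x| <= harmonic_sum R K.
Proof.
move=> /andP[r0 r1]; rewrite normrN; apply: le_trans (ler_norm_sum _ _ _) _.
apply: ler_sum => l _; rewrite !normrM normfV (ger0_norm (exprn_ge0 _ r0)).
rewrite (ger0_norm (ler0n _ _)) -[leRHS]mul1r -[leRHS]mulr1.
rewrite ler_pM ?mulr_ge0 ?exprn_ge0 ?invr_ge0 ?cos_max// ler_wpM2r ?invr_ge0//.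
exact: exprn_ile1.
Qed.

(** The phase [s] stands for the argument of a complex Fourier coefficient at the
  frequency [b k], so that only real integrals occur. *)
Definition fourier_bound F (b : nat) w := forall (k : int) (s : R),
  `|mean01 (fun x => F x * cos (2 * pi * (b%:Z * k)%:~R * x + s))| <= w k.

Lemma continuousM_fun F (G : R -> R) : continuous F -> continuous G ->
  continuous (fun x => F x * G x).
Proof. by move=> cF cG x; apply: cvgM; [exact: cF|exact: cG]. Qed.

Lemma continuousD_fun F (G : R -> R) : continuous F -> continuous G ->
  continuous (fun x => F x + G x).
Proof. by move=> cF cG x; apply: cvgD; [exact: cF|exact: cG]. Qed.

Lemma fourier_boundD F G b w w' : continuous F -> continuous G ->
  fourier_bound F b w -> fourier_bound G b w' ->
  fourier_bound (fun x => F x + G x) b (fun k => w k + w' k).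
Proof.
move=> cF cG Fw Gw k s; under eq_mean01 do rewrite mulrDl.
rewrite mean01D; try (apply: continuousM_fun => //; exact: continuous_cos_affine).
by apply: le_trans (ler_normD _ _) _; apply: lerD.
Qed.

Lemma fourier_boundZ F b w (c : R) : continuous F -> 0 <= c ->
  fourier_bound F b w -> fourier_bound (fun x => c * F x) b (fun k => c * w k).
Proof.
move=> cF c0 Fw k s; under eq_mean01 do rewrite -mulrA.
rewrite mean01Z; last (apply: continuousM_fun => //; exact: continuous_cos_affine).
by rewrite normrM (ger0_norm c0) ler_wpM2l.
Qed.

Lemma cosM (x y : R) : cos x * cos y = 2^-1 * (cos (x + y) + cos (x - y)).
Proof. by rewrite cosD cosB; field. Qed.

Lemma fourier_bound_logpoly F b w K rho tau : 0 <= rho <= 1 -> continuous F ->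
  fourier_bound F b w ->
  fourier_bound (fun x => F x * logpoly K rho tau (b%:R * x)) b (conv_log K w).
Proof.
move=> /andP[r0 r1] cF Fw k s.
pose th (l : nat) : R := 2 * pi * l.+1%:R * tau.
pose C (j : int) (t x : R) : R := F x * cos (2 * pi * (b%:Z * j)%:~R * x + t).
have cC j t : continuous (C j t).
  by apply: continuousM_fun => //; exact: continuous_cos_affine.
have -> : (fun x => F x * logpoly K rho tau (b%:R * x) *
      cos (2 * pi * (b%:Z * k)%:~R * x + s)) =
   (fun x => \sum_(l < K) (- (rho ^+ l.+1 / (2 * l.+1%:R))) *
     (C (k + l.+1%:Z) (s - th l) x + C (k - l.+1%:Z) (s + th l) x)).
  apply: funext => x; rewrite /logpoly mulrN mulNr mulr_sumr mulr_suml -sumrN.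
  apply: eq_bigr => l _; rewrite /C -mulrDr.
  set u := 2 * pi * (b%:Z * k)%:~R * x + s.
  set v := 2 * pi * l.+1%:R * (b%:R * x - tau).
  have -> : 2 * pi * (b%:Z * (k + l.+1%:Z))%:~R * x + (s - th l) = u + v.
    by rewrite /th /u /v; ring.
  have -> : 2 * pi * (b%:Z * (k - l.+1%:Z))%:~R * x + (s + th l) = u - v.
    by rewrite /th /u /v; ring.
  rewrite -[cos (u + v) + _](@mulVKf _ 2)// -cosM.
  by field.
rewrite mean01_sum; last first.
  move=> l; apply: continuousM_fun; first by move=> x; exact: cvg_cst.
  by move=> x; apply: cvgD; exact: cC.
apply: le_trans (ler_norm_sum _ _ _) _; apply: ler_sum => l _.
rewrite mean01Z; last by move=> x; apply: cvgD; exact: cC.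
rewrite mean01D// normrM normrN mulrC.
rewrite ler_pM ?normr_ge0//.
  by apply: le_trans (ler_normD _ _) _; apply: lerD; exact: Fw.
rewrite ger0_norm ?mulr_ge0 ?exprn_ge0 ?invr_ge0 ?mulr_ge0//.
by rewrite -[leRHS]mul1r ler_wpM2r ?invr_ge0 ?mulr_ge0// exprn_ile1.
Qed.

(** A polynomial upper bound of [expR (lam * X)], for [X] the truncated logarithm
  and [lam * X] small: unlike the exponential, it acts on Fourier coefficients by
  finitely many convolutions. *)
Definition exp_logpoly (lam : R) K rho tau (x : R) : R :=
  1 + lam * logpoly K rho tau x + 2 * lam ^+ 2 * (logpoly K rho tau x) ^+ 2.

Lemma expR_le_quadratic (y : R) : `|y| <= 2^-1 -> expR y <= 1 + y + 2 * y ^+ 2.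
Proof.
rewrite ler_norml => /andP[y1 y2].
have e0 := expR_gt0 y.
have : expR y * (1 - y) <= 1.
  rewrite -[leRHS](expRxMexpNx_1 y) ler_wpM2l ?(ltW e0)//.
  by have := expR_ge1Dx (- y).
set e := expR y => h.
have h2 : 1 <= (1 + y + 2 * y ^+ 2) * (1 - y).
  have : 0 <= y ^+ 2 * (1 - 2 * y) by apply: mulr_ge0; [exact: sqr_ge0|lra].
  lra.
have y3 : 0 < 1 - y by lra.
by rewrite -(ler_pM2r y3) (le_trans h).
Qed.

Lemma continuous_exp_logpoly lam K rho tau : continuous (exp_logpoly lam K rho tau).
Proof.
have cX := continuous_logpoly (K := K) (rho := rho) (tau := tau).
move=> x; apply: cvgD.
  apply: cvgD; first exact: cvg_cst.
  by apply: cvgM; [exact: cvg_cst|exact: cX].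
apply: cvgM; first exact: cvg_cst.
under eq_fun do rewrite expr2.
by apply: cvgM; exact: cX.
Qed.

Lemma exp_logpoly_ge lam K rho tau x : 0 <= rho <= 1 -> 0 <= lam ->
  lam * harmonic_sum R K <= 2^-1 ->
  expR (lam * logpoly K rho tau x) <= exp_logpoly lam K rho tau x.
Proof.
move=> r01 l0 lH; have := @expR_le_quadratic (lam * logpoly K rho tau x).
rewrite normrM (ger0_norm l0) => /(_ _)/le_trans -> //; last first.
  by rewrite /exp_logpoly exprMn mulrA.
by apply: le_trans lH; rewrite ler_wpM2l// logpoly_le_harmonic.
Qed.

(** The shape [|b|^(-1/2)] of the weights is preserved, with a gain of [1/sqrt q]
  in the passage from frequencies multiple of [b] to multiples of [b q]; this
  gain absorbs the loss in [conv_log_le]. At the frequency [0], the terms of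
  [exp_logpoly] of the first and of the second order contribute [30 lam^2] and
  [6 lam^2]; elsewhere, the coefficient [10] of the weight becomes at most [12],
  and [12 * 5/7 < 10]. The bound [50^-1] keeps below [1/2] the coefficient
  [25 lam H] that arises from a convolution, [H] being the harmonic sum. *)
Lemma fourier_bound_step F b G q lam K rho tau : (2 <= q)%N -> (0 < K)%N ->
  0 <= rho <= 1 -> 0 <= lam <= 1 -> lam * harmonic_sum R K <= 50^-1 -> 0 <= G ->
  continuous F ->
  fourier_bound F b (fun k => G * ((k == 0)%:R + 10 * lam * decay R k)) ->
  fourier_bound (fun x => F x * exp_logpoly lam K rho tau (b%:R * x)) (b * q)
    (fun k => (1 + 36 * lam ^+ 2) * G * ((k == 0)%:R + 10 * lam * decay R k)).
Proof.
move=> q2 K0 r01 /andP[l0 l1] lH G0 cF Fw.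
pose X x := logpoly K rho tau (b%:R * x).
have cX : continuous X by exact: continuous_scaled (@continuous_logpoly _ _ _).
have cFX : continuous (fun x => F x * X x) by exact: continuousM_fun.
have b1 := fourier_bound_logpoly K tau r01 cF Fw.
have b2 := fourier_bound_logpoly K tau r01 cFX b1.
set w := (fun k => _) in Fw b1 b2.
have cZ (c : R) f : continuous f -> continuous (fun x : R => c * f x).
  by move=> cf; apply: continuousM_fun => // x; exact: cvg_cst.
have h := fourier_boundD (continuousD_fun cF (cZ lam _ cFX)) (cZ (2 * lam ^+ 2) _ (continuousM_fun cFX cX))
 (fourier_boundD cF (cZ lam _ cFX) Fw (fourier_boundZ cFX l0 b1))
 (fourier_boundZ (c := 2 * lam ^+ 2) (continuousM_fun cFX cX) _ b2).
have {}h := h ltac:(by rewrite mulr_ge0// sqr_ge0).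
move=> k s; have := h (q%:Z * k) s.
rewrite (_ : b%:Z * (q%:Z * k) = (b * q)%N%:Z * k); last by rewrite PoszM mulrA.
rewrite (_ : (fun x => _) = (fun x => F x * exp_logpoly lam K rho tau (b%:R * x) *
   cos (2 * pi * ((b * q)%N%:Z * k)%:~R * x + s))); last first.
  by apply: funext => x; congr (_ * _); rewrite /exp_logpoly -/(X x); ring.
move/le_trans; apply.
set H := harmonic_sum R K in lH *.
have H1 : 1 <= H by exact: harmonic_sum_ge1.
have w1 j : w j <= G * (j == 0)%:R + (10 * lam * G) * decay R j.
  by rewrite /w; apply: eq_le_of; ring.
have w2 := conv_log_le K G0 _ w1.
have {}w2 := w2 ltac:(by rewrite !mulr_ge0).
rewrite -/H in w2.
have Gl0 : 0 <= 10 * lam * G by rewrite !mulr_ge0.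
have HG : (5 / 2 * H * (10 * lam * G)) <= G / 2.
  have := ler_wpM2r G0 lH; lra.
have w2' j : conv_log K w j <= 30 * lam * G * (j == 0)%:R + G * decay R j.
  apply: le_trans (w2 j) _; apply: lerD; first by apply: eq_le_of; ring.
  apply: ler_wpM2r; first exact: decay_ge0.
  lra.
have lG0 : 0 <= 30 * lam * G by rewrite !mulr_ge0.
have w3 := conv_log_le K lG0 G0 w2'.
rewrite -/H in w3.
have qk : (q%:Z * k == 0) = (k == 0) by lia.
(* The new weight at [k] is read off from the three old ones at [q k]. *)
have := w1 (q%:Z * k); have := w2' (q%:Z * k); have := w3 (q%:Z * k).
rewrite qk => h3 h2 h1.
have l2 : 0 <= 2 * lam ^+ 2 by rewrite mulr_ge0// sqr_ge0.
have {}h3 := ler_wpM2l l2 h3; have {}h2 := ler_wpM2l l0 h2.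
set d := decay R (q%:Z * k) in h1 h2 h3.
apply: le_trans (lerD (lerD h1 h2) h3) _.
have [k0|k0] := eqVneq k 0.
  rewrite /d k0 mulr0 decay0 !mulr0 !addr0 !mulr1.
  apply: eq_le_of; ring.
have dd : d <= 5 / 7 * decay R k by exact: decay_mul.
have d0 : 0 <= decay R k by exact: decay_ge0.
have dq0 : 0 <= d by exact: decay_ge0.
rewrite !mulr0 !add0r.
set D := decay R k in dd d0 *.
have lHG : lam * H * G <= 50^-1 * G by rewrite ler_wpM2r.
have lG : lam * G <= H * G by rewrite ler_wpM2r//; lra.
have lG' : 0 <= lam * G by rewrite mulr_ge0.
have c1 : 10 * lam * G + lam * G + 2 * lam ^+ 2 * (30 * lam * G / 2 + 5 / 2 * H * G) <=
    12 * (lam * G).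
  have e1 : lam * (30 * lam * G / 2 + 5 / 2 * H * G) <= 35 / 2 * (lam * H * G).
    have := ler_wpM2l l0 lG; lra.
  have e2 : 2 * lam ^+ 2 * (30 * lam * G / 2 + 5 / 2 * H * G) =
     2 * lam * (lam * (30 * lam * G / 2 + 5 / 2 * H * G)) by ring.
  have := ler_wpM2l l0 e1; have := ler_wpM2l l0 lHG; lra.
have := ler_wpM2r dq0 c1; have := ler_wpM2l lG' dd.
have : 0 <= lam ^+ 2 * G * lam * D by rewrite !mulr_ge0// sqr_ge0.
have : 0 <= lam * G * D by rewrite mulr_ge0.
rewrite !mulrDl; lra.
Qed.

(** A substitute for independence: up to the constant [36], the bound is what
  independent factors of mean [1 + 2 lam^2 E(X^2)] would give. *)
Lemma mean01_prod_exp_logpoly p q n lam K rho tau : (0 < p)%N ->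
  (2 <= q)%N -> (0 < K)%N ->
  0 <= rho <= 1 -> 0 <= lam <= 1 -> lam * harmonic_sum R K <= 50^-1 ->
  mean01 (fun x => \prod_(k < n) exp_logpoly lam K rho tau ((p * q ^ k)%:R * x)) <=
    (1 + 36 * lam ^+ 2) ^+ n.
Proof.
move=> p0 q2 K0 r01 l01 lH; have /andP[l0 l1] := l01.
suff H : fourier_bound
    (fun x => \prod_(k < n) exp_logpoly lam K rho tau ((p * q ^ k)%:R * x))
    (p * q ^ n) (fun k => (1 + 36 * lam ^+ 2) ^+ n * ((k == 0)%:R + 10 * lam * decay R k)).
  have := H 0 0; rewrite decay0 eqxx (mulr0 (10 * lam)) addr0 mulr1; apply: le_trans.
  apply: le_trans (ler_norm _); apply: eq_le_of; congr mean01; apply: funext => x.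
  by rewrite mulr0 mulr0 mul0r addr0 cos0 mulr1.
have L0 : 0 <= 1 + 36 * lam ^+ 2 by rewrite addr_ge0// mulr_ge0// sqr_ge0.
elim: n => [|n IH].
  move=> k s; under eq_mean01 do rewrite big_ord0 mul1r.
  rewrite mean01_cos expr0 mul1r muln1.
  have -> : (p%:Z * k == 0) = (k == 0) by lia.
  case: eqP => _; first by rewrite (le_trans (cos_max _))// lerDl mulr_ge0 ?decay_ge0// mulr_ge0.
  by rewrite normr0 add0r !mulr_ge0 ?decay_ge0.
have cP : continuous (fun x : R =>
    \prod_(k < n) exp_logpoly lam K rho tau ((p * q ^ k)%:R * x)).
  by apply: continuous_prod => i; apply/continuous_scaled/continuous_exp_logpoly.
have := fourier_bound_step tau q2 K0 r01 l01 lH (exprn_ge0 n L0) cP IH.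
rewrite -mulnA -expnSr -exprS => h k s; have := h k s.
rewrite (_ : mean01 _ = mean01 (fun x => (\prod_(k < n.+1)
    exp_logpoly lam K rho tau ((p * q ^ k)%:R * x)) *
    cos (2 * pi * ((p * q ^ n.+1)%N%:Z * k)%:~R * x + s)))//.
by apply: eq_mean01 => x; rewrite big_ord_recr.
Qed.

End TrigPoly.

(** * Trigonometric approximation of the logarithm of the distance to the circle *)

Section CircleDistance.
Variable R : realType.
Implicit Types (rho r s c x : R).

(** [|1 - rho e(x)|] in real terms, by the law of cosines. *)
Definition circle_dist rho x : R :=
  Num.sqrt (1 - 2 * rho * cos (2 * pi * x) + rho ^+ 2).

Lemma circle_dist_ge0 rho x : 0 <= circle_dist rho x.
Proof. exact: sqrtr_ge0. Qed.

Lemma dist_sqr_ge s c : 0 <= s -> c <= 1 -> (1 - s) ^+ 2 <= 1 - 2 * s * c + s ^+ 2.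
Proof. by move=> s0 c1; have := ler_wpM2l s0 c1; lra. Qed.

Lemma circle_dist_le2 rho x : 0 <= rho <= 1 -> circle_dist rho x <= 2.
Proof.
move=> /andP[r0 r1]; rewrite /circle_dist.
have := cos_geN1 (2 * pi * x); set c := cos _ => c1.
rewrite -[leRHS]ger0_norm// -sqrtr_sqr ler_wsqrtr//.
have := ler_wpM2l r0 c1; nra.
Qed.

(** Both squares are affine in [cos (2 pi x)], so that it suffices to compare them
  where this cosine is [1] or [-1]; these are the two terms of the identity used
  in the proof. *)
Lemma circle_dist_shrink r rho x : 0 <= r <= 1 -> 0 <= rho <= 1 ->
  (1 + r) / 2 * circle_dist rho x <= circle_dist (r * rho) x.
Proof.
move=> /andP[r0 r1] /andP[rh0 rh1].
have := cos_geN1 (2 * pi * x); have := cos_le1 (2 * pi * x).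
rewrite /circle_dist; set c := cos _ => c1 cN1.
rewrite -[(1 + r) / 2]ger0_norm; last lra.
rewrite -sqrtr_sqr -sqrtrM ?sqr_ge0// ler_wsqrtr// -subr_ge0.
set A := (1 + r) / 2.
have -> : 1 - 2 * (r * rho) * c + (r * rho) ^+ 2 - A ^+ 2 * (1 - 2 * rho * c + rho ^+ 2)
  = (1 + c) / 2 * ((1 - r * rho - A * (1 - rho)) * (1 - r * rho + A * (1 - rho))) +
    (1 - c) / 2 * ((1 + r * rho - A * (1 + rho)) * (1 + r * rho + A * (1 + rho))).
  by field.
have p1 : 0 <= (1 - r) * rho by rewrite mulr_ge0//; lra.
have p2 : 0 <= (1 - r) * (1 - rho) by rewrite mulr_ge0//; lra.
have p3 : 0 <= r * (1 - rho) by rewrite mulr_ge0//; lra.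
have p4 : 0 <= r * rho by rewrite mulr_ge0//; lra.
by rewrite /A; apply: addr_ge0; (apply: mulr_ge0; first lra);
  (apply: mulr_ge0; lra).
Qed.

Lemma circle_dist_shrink_le r rho x : 0 <= r <= 1 -> 0 <= rho <= 1 ->
  circle_dist (r * rho) x <= circle_dist rho x + (1 - r).
Proof.
move=> /andP[r0 r1] /andP[rh0 rh1].
have := cos_geN1 (2 * pi * x); have := cos_le1 (2 * pi * x).
rewrite /circle_dist; set c := cos _ => c1 cN1.
set Q := 1 - 2 * rho * c + rho ^+ 2.
have Q0 : 0 <= Q by apply: le_trans (dist_sqr_ge rh0 c1); exact: sqr_ge0.
have S0 := sqrtr_ge0 Q; have SS := sqr_sqrtr Q0; set S := Num.sqrt Q in S0 SS *.
have rhc : rho * (c - rho) <= S.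
  apply: (@le_trans _ _ `|c - rho|).
    apply: le_trans (ler_norm _) _; rewrite normrM ger0_norm//.
    by rewrite -[leRHS]mul1r ler_wpM2r.
  rewrite -sqrtr_sqr ler_wsqrtr// /Q -subr_ge0.
  have -> : 1 - 2 * rho * c + rho ^+ 2 - (c - rho) ^+ 2 = (1 - c) * (1 + c) by ring.
  by apply: mulr_ge0; lra.
rewrite -[leRHS]ger0_norm; last by lra.
rewrite -sqrtr_sqr ler_wsqrtr// sqrrD SS /Q -subr_ge0.
have -> : 1 - 2 * rho * c + rho ^+ 2 + (S * (1 - r)) *+ 2 + (1 - r) ^+ 2 -
   (1 - 2 * (r * rho) * c + (r * rho) ^+ 2) =
   (1 - r) * (2 * (S - rho * (c - rho)) + (1 - r) * (1 - rho ^+ 2)) by ring.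
apply: mulr_ge0; first lra.
apply: addr_ge0; first lra.
by apply: mulr_ge0; [lra|nra].
Qed.

(** The real part of the sum of the geometric progression of ratio [s exp(i phi)]
  and first term [exp(i phi)]. *)
Lemma sum_cos_geometric (phi s : R) K :
  (1 - 2 * s * cos phi + s ^+ 2) * (\sum_(l < K) s ^+ l * cos (l.+1%:R * phi)) =
  cos phi - s - s ^+ K * cos (K.+1%:R * phi) + s ^+ K.+1 * cos (K%:R * phi).
Proof.
elim: K => [|K IH].
  by rewrite big_ord0 mul0r cos0 (_ : 1%:R = 1 :> R)// !mul1r; ring.
rewrite big_ord_recr/= mulrDr IH.
have -> : cos (K.+2%:R * phi) = 2 * cos phi * cos (K.+1%:R * phi) - cos (K%:R * phi).
  have -> : K.+2%:R * phi = K.+1%:R * phi + phi by rewrite -[K.+2%:R]natr1; ring.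
  have -> : K%:R * phi = K.+1%:R * phi - phi by rewrite -[K.+1%:R]natr1; ring.
  by rewrite cosD cosB; ring.
by rewrite !exprS; ring.
Qed.

(** Both terms vanish at [s = 0], and the derivative of their sum in [s] is the
  tail of a geometric series, so that the mean value theorem applies. *)
Lemma ln_dist_approx (phi s r : R) K : 0 <= s <= r -> r < 1 ->
  `|2^-1 * ln (1 - 2 * s * cos phi + s ^+ 2) +
    \sum_(l < K) s ^+ l.+1 / l.+1%:R * cos (l.+1%:R * phi)| <=
  2 * r ^+ K / (1 - r) ^+ 2.
Proof.
move=> /andP[s0 sr] r1; set c := cos phi.
have c1 : c <= 1 by exact: cos_le1.
pose Q (u : R) := 1 - 2 * u * c + u ^+ 2.
pose P (u : R) := \sum_(l < K) u ^+ l.+1 / l.+1%:R * cos (l.+1%:R * phi).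
pose G (u : R) := 2^-1 * ln (Q u) + P u.
pose dG (u : R) := (u - c) / Q u + \sum_(l < K) u ^+ l * cos (l.+1%:R * phi).
have Qge (u : R) : 0 <= u -> u < 1 -> (1 - u) ^+ 2 <= Q u /\ 0 < Q u.
  move=> u0 u1; have h := dist_sqr_ge u0 c1; split => //.
  by apply: lt_le_trans h; rewrite exprn_gt0//; lra.
have dP (u : R) : is_derive u (1 : R) P (\sum_(l < K) u ^+ l * cos (l.+1%:R * phi)).
  have -> : P = \sum_(l < K) (fun u : R => u ^+ l.+1 / l.+1%:R * cos (l.+1%:R * phi)).
    by apply: funext => v; rewrite /P fct_sumE.
  apply: is_derive_sum => l.
  have -> : (fun u : R => u ^+ l.+1 / l.+1%:R * cos (l.+1%:R * phi)) =
     (l.+1%:R^-1 * cos (l.+1%:R * phi)) *: (fun u : R => u ^+ l.+1).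
    by apply: funext => v; rewrite scalrfctE /GRing.scale/= [RHS]mulrC mulrA.
  have dX : is_derive u (1 : R) (@GRing.exp R ^~ l.+1) (l.+1%:R *: u ^+ l *: 1).
    by split; [exact: exprn_derivable | rewrite exp_derive].
  apply: is_derive_eq (is_deriveZ _ dX) _; rewrite /GRing.scale/=.
  by field.
have dQ (u : R) : is_derive u (1 : R) Q (2 * (u - c)).
  rewrite /Q; apply: is_derive_eq; rewrite /GRing.scale/=; ring.
have dGe (u : R) : 0 <= u -> u < 1 -> is_derive u (1 : R) G (dG u).
  move=> u0 u1; have [_ Qu] := Qge _ u0 u1.
  have h1 := is_derive1_comp (f := @ln R) (g := Q) (x := u) (is_derive1_ln Qu) (dQ u).
  have h2 := is_deriveD (is_deriveZ 2^-1 h1) (dP u).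
  apply: is_derive_eq h2 _; rewrite /dG /GRing.scale/=; congr (_ + _).
  by field; rewrite gt_eqF.
have bdG (u : R) : 0 <= u <= r -> `|dG u| <= 2 * r ^+ K / (1 - r) ^+ 2.
  move=> /andP[u0 ur]; have u1 : u < 1 by lra.
  have [Qu Qu0] := Qge _ u0 u1.
  have -> : dG u = (u ^+ K.+1 * cos (K%:R * phi) - u ^+ K * cos (K.+1%:R * phi)) / Q u.
    apply: (mulIf (lt0r_neq0 Qu0)); rewrite divfK ?gt_eqF// /dG mulrDl divfK ?gt_eqF//.
    by rewrite [X in _ + X]mulrC sum_cos_geometric -/c; ring.
  rewrite normrM normfV (gtr0_norm Qu0).
  have uK : u ^+ K <= r ^+ K by rewrite lerXn2r// nnegrE//; lra.
  have uK0 : 0 <= u ^+ K by exact: exprn_ge0.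
  apply: ler_pM; rewrite ?normr_ge0 ?invr_ge0 ?(ltW Qu0)//.
    apply: le_trans (ler_normB _ _) _; rewrite !normrM !(ger0_norm (exprn_ge0 _ u0)).
    rewrite exprS.
    have h1 := cos_max (K%:R * phi); have h2 := cos_max (K.+1%:R * phi).
    have := ler_wpM2l uK0 h1; have := ler_wpM2l uK0 h2.
    have : 0 <= u ^+ K * `|cos (K%:R * phi)| by rewrite mulr_ge0.
    move=> a1 a2 a3.
    have := ler_wpM2r a1 (ltW u1); lra.
  rewrite lef_pV2 ?posrE// ?exprn_gt0//; last lra.
  apply: le_trans Qu; rewrite lerXn2r// ?nnegrE; lra.
rewrite -/(Q s) -/(P s) -/(G s).
have G0 : G 0 = 0.
  rewrite /G /Q /P mulr0 mul0r subr0 expr0n /= addr0 ln1 mulr0 add0r.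
  by rewrite big1// => l _; rewrite exprS !mul0r.
have [u usr Gu] : exists2 u, u \in `[0, s]%R & G s - G 0 = dG u * (s - 0).
  apply: MVT_segment => //.
    move=> u; rewrite in_itv/= => /andP[u0 us]; apply: dGe; lra.
  apply: derivable_within_continuous => u; rewrite in_itv/= => /andP[u0 us].
  by have [] := dGe u u0 ltac:(lra).
move: Gu; rewrite G0 !subr0 => ->.
move: usr; rewrite in_itv/= => /andP[u0 us].
rewrite normrM (ger0_norm s0) -[leRHS]mulr1.
apply: ler_pM; rewrite ?normr_ge0//; [apply: bdG|]; lra.
Qed.

Lemma circle_dist_approx K rho tau r x : 0 <= rho <= r -> r < 1 ->
  expR (logpoly K rho tau x - 2 * r ^+ K / (1 - r) ^+ 2) <=
    circle_dist rho (x - tau) <=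
  expR (logpoly K rho tau x + 2 * r ^+ K / (1 - r) ^+ 2).
Proof.
move=> rr r1; have := ln_dist_approx (2 * pi * (x - tau)) K rr r1.
set E := 2 * r ^+ K / _; have /andP[rh0 rhr] := rr.
set Q := 1 - 2 * _ * _ + _.
have Q0 : 0 < Q.
  apply: lt_le_trans (dist_sqr_ge rh0 (cos_le1 _)).
  by rewrite exprn_gt0//; lra.
have -> : circle_dist rho (x - tau) = expR (2^-1 * ln Q).
  rewrite /circle_dist -/Q -[Num.sqrt Q]lnK ?posrE ?sqrtr_gt0//.
  congr expR; rewrite -[in RHS](sqr_sqrtr (ltW Q0)) lnXn ?sqrtr_gt0//.
  by field.
have -> : \sum_(l < K) rho ^+ l.+1 / l.+1%:R * cos (l.+1%:R * (2 * pi * (x - tau))) =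
   - logpoly K rho tau x.
  rewrite /logpoly opprK; apply: eq_bigr => l _; congr (_ * cos _); ring.
by rewrite ler_norml !ler_expR; lra.
Qed.

(** An upper bound valid up to the circle [rho = 1], where the logarithm has a
  singularity: moving the root to the radius [(1 - 1/M) rho] decreases the distance
  by a factor at least [1 - 1/(2M)] only, and inside the disc the order [M^2] is
  enough for an error [O(1/M)]. The constant is [55 = 1 + 54], from these two
  steps. *)
Lemma circle_dist_le_exp_logpoly (M : nat) rho tau x : (1 < M)%N -> 0 <= rho <= 1 ->
  circle_dist rho (x - tau) <=
  expR (logpoly (M ^ 2) ((1 - M%:R^-1) * rho) tau x + 55 / M%:R).
Proof.
move=> M1 r01; set r := 1 - M%:R^-1.
have M0 : 0 < M%:R :> R by rewrite ltr0n; lia.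
have Mi0 : 0 < M%:R^-1 :> R by rewrite invr_gt0.
have Mi1 : M%:R^-1 <= 1 :> R by rewrite invf_le1// ler1n; lia.
have r0 : 0 <= r by rewrite /r; lra.
have r1 : r < 1 by rewrite /r; lra.
have /andP[rh0 rh1] := r01.
have r01' : 0 <= r <= 1 by lra.
have h1 := circle_dist_shrink (x - tau) r01' r01.
have rr : 0 <= r * rho <= r by rewrite mulr_ge0//= -[leRHS]mulr1 ler_wpM2l.
have /andP[_ h2] := circle_dist_approx (M ^ 2) tau x rr r1.
have h3 : 1 <= (1 + r) / 2 * expR (M%:R^-1).
  have h := expR_ge1Dx (M%:R^-1 : R).
  apply: (@le_trans _ _ ((1 + r) / 2 * (1 + M%:R^-1))).
    rewrite /r; move: Mi0 Mi1; set m := M%:R^-1 => m0 m1.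
    have : 0 <= m * (1 - m) by rewrite mulr_ge0//; lra.
    lra.
  apply: ler_wpM2l => //; lra.
have h4 : 2 * r ^+ (M ^ 2) / (1 - r) ^+ 2 <= 54 / M%:R.
  have -> : 1 - r = M%:R^-1 by rewrite /r; ring.
  have rM : r ^+ (M ^ 2) <= (expR (M%:R))^-1.
    have -> : (expR (M%:R))^-1 = expR (- M%:R^-1 : R) ^+ (M ^ 2).
      rewrite -expRN -expRM_natl natrX; congr expR.
      by field; rewrite gt_eqF.
    by rewrite lerXn2r// ?nnegrE ?expR_ge0// -[r]/(1 + - M%:R^-1) expR_ge1Dx.
  (* The cube makes the truncation error [2 M^2 (3/M)^3 = 54/M]. *)
  have eM : (M%:R / 3) ^+ 3 <= expR (M%:R) :> R.
    have -> : M%:R = 3%:R * (M%:R / 3) :> R by field.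
    rewrite expRM_natl [X in X / 3]mulrC mulfK//.
    rewrite lerXn2r// ?nnegrE ?expR_ge0//; try by rewrite divr_ge0.
    by apply: le_trans (expR_ge1Dx _); rewrite lerDr.
  have M30 : 0 < (M%:R / 3) ^+ 3 :> R by rewrite exprn_gt0// divr_gt0.
  have {}rM : r ^+ (M ^ 2) <= ((M%:R / 3) ^+ 3)^-1.
    by apply: le_trans rM _; rewrite lef_pV2 ?posrE ?expR_gt0.
  apply: (@le_trans _ _ (2 * ((M%:R / 3) ^+ 3)^-1 / (M%:R^-1) ^+ 2)).
    by rewrite ler_wpM2r ?invr_ge0 ?sqr_ge0// ler_wpM2l.
  by rewrite le_eqVlt; apply/orP; left; apply/eqP; field; rewrite gt_eqF.
set E := 2 * _ / _ in h2 h4.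
have d0 := circle_dist_ge0 rho (x - tau).
apply: (@le_trans _ _ (circle_dist (r * rho) (x - tau) * expR (M%:R^-1))).
  rewrite -[leLHS]mulr1; apply: le_trans (ler_wpM2l d0 h3) _.
  by rewrite mulrA ler_wpM2r ?expR_ge0// mulrC.
apply: le_trans (ler_wpM2r (expR_ge0 _) h2) _.
rewrite -expRD ler_expR; lra.
Qed.

End CircleDistance.

(** * The upper law of the iterated logarithm *)

Section LogarithmBounds.
Variable R : realType.

Lemma expR1_le4 : expR 1 <= 4 :> R.
Proof.
have := @expR_le_quadratic R 2^-1; rewrite ger0_norm// => /(_ (lexx _)) h.
have -> : expR 1 = expR 2^-1 ^+ 2 :> R by rewrite -expRM_natl mulfV.
by have := expR_ge0 (2^-1 : R); move: h; set e := expR _ => h e0; nra.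
Qed.

Lemma ln2_ge_half : 2^-1 <= ln 2 :> R.
Proof.
rewrite -ler_expR lnK ?posrE//.
have := @expR_le_quadratic R 2^-1; rewrite ger0_norm// => /(_ (lexx _)); lra.
Qed.

Lemma ln_ge1 (N : nat) : (16 <= N)%N -> 1 <= ln N%:R :> R.
Proof.
move=> N16; rewrite -ler_expR lnK ?posrE ?ltr0n; last by lia.
apply: le_trans expR1_le4 _; rewrite ler_nat; lia.
Qed.

End LogarithmBounds.

Section LawOfIteratedLogarithm.
Variable R : realType.
Local Notation mu := (@lebesgue_measure R).

Lemma harmonic_sum_le_ln K : (0 < K)%N -> harmonic_sum R K <= 1 + ln K%:R.
Proof.
case: K => // K _; elim: K => [|K IH].
  by rewrite /harmonic_sum big_ord_recr big_ord0 /= (_ : 1%:R = 1 :> R)// invr1 ln1 add0r addr0.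
rewrite /harmonic_sum big_ord_recr/= -/(harmonic_sum _ _).
have K1 : 0 < K.+1%:R :> R by [].
have K2 : 0 < K.+2%:R :> R by [].
have : ln (K.+1%:R / K.+2%:R) <= - K.+2%:R^-1 :> R.
  have -> : K.+1%:R / K.+2%:R = 1 + - K.+2%:R^-1 :> R.
    by rewrite -[X in X / _](addrK 1) natr1 mulrBl mulfV ?gt_eqF// mul1r.
  apply: le_ln1Dx; rewrite ltrN2 invf_lt1// ltr1n//.
rewrite ln_div// => h.
apply: le_trans (lerD IH (lexx _)) _; move: h.
by set a := ln _; set b := ln _; set c := _^-1; lra.
Qed.

(** With [s = sqrt M], the sum is at most [1 + 4 ln s <= 5 s], and [5/s <= 1/50]
  for [s >= 250]. *)
Lemma harmonic_sum_sqr_le (M : nat) : 250 ^+ 2 <= M%:R :> R ->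
  M%:R^-1 * harmonic_sum R (M ^ 2) <= 50^-1.
Proof.
move=> M250.
have M0 : 0 < M%:R :> R by apply: lt_le_trans M250; rewrite exprn_gt0.
have M0n : (0 < M)%N by rewrite -(ltr0n R).
have := @harmonic_sum_le_ln (M ^ 2) ltac:(by rewrite expn_gt0 M0n).
rewrite natrX lnXn//.
set s := Num.sqrt (M%:R : R).
have ss : s ^+ 2 = M%:R by rewrite sqr_sqrtr// ltW.
have s250 : 250 <= s.
  rewrite /s -[leLHS]ger0_norm// -sqrtr_sqr ler_wsqrtr//.
have s0 : 0 < s by lra.
rewrite -ss lnXn//.
have : ln (1 + (s - 1)) <= s - 1 by apply: le_ln1Dx; lra.
rewrite addrC subrK => h1 h2.
have {}h2 : harmonic_sum R (M ^ 2) <= 5 * s by lra.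
apply: (@le_trans _ _ ((s ^+ 2)^-1 * (5 * s))).
  by rewrite ler_wpM2l// invr_ge0 exprn_ge0// ltW.
have -> : (s ^+ 2)^-1 * (5 * s) = 5 / s by field; rewrite gt_eqF.
rewrite ler_pdivrMr//; lra.
Qed.

Section FixedRoot.
Variables (q : nat) (rho tau : R).
Hypothesis q2 : (2 <= q)%N.
Hypothesis rho01 : 0 <= rho <= 1.

Definition orbit_prod (b n : nat) (x : R) : R :=
  \prod_(k < n) circle_dist rho ((b * q ^ k)%:R * x - tau).

(** The bound of Chernoff, with [lam = 1/M] and [91 = 36 + 55]: the constant [36]
  comes from the exponential moment, and [55] from the approximation of the
  distance. *)
Lemma orbit_prod_tail_rational (M : nat) (b n : nat) (t : R) :
  (0 < b)%N -> 250 ^+ 2 <= M%:R :> R ->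
  exists B : set R, [/\ measurable B,
   (mu B <= (expR (91 * n%:R / M%:R ^+ 2 - t / M%:R))%:E)%E &
   forall x, 0 <= x <= 1 -> ~ B x -> orbit_prod b n x <= expR t].
Proof.
move=> b0 M250.
have M0 : 0 < M%:R :> R by apply: lt_le_trans M250; rewrite exprn_gt0.
have M1 : (1 < M)%N.
  by rewrite -(ltr1n R); apply: lt_le_trans M250; rewrite expr2; lra.
have lH := harmonic_sum_sqr_le M250.
have Mi0 : 0 < M%:R^-1 :> R by rewrite invr_gt0.
have Mi1 : M%:R^-1 <= 1 :> R by rewrite invf_le1// ler1n; lia.
set r := 1 - M%:R^-1 : R.
have rr01 : 0 <= r * rho <= 1.
  have /andP[h0 h1] := rho01; rewrite mulr_ge0 ?mulr_ile1//= /r; lra.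
have l01 : 0 <= (M%:R^-1 : R) <= 1 by apply/andP; split => //; exact: ltW.
have K0 : (0 < M ^ 2)%N by rewrite expn_gt0; lia.
pose f := exp_logpoly M%:R^-1 (M ^ 2) (r * rho) tau.
pose F x := \prod_(k < n) f ((b * q ^ k)%:R * x).
have cF : continuous F.
  by apply: continuous_prod => i; apply/continuous_scaled/continuous_exp_logpoly.
have lH2 : M%:R^-1 * harmonic_sum R (M ^ 2) <= 2^-1 by apply: le_trans lH _; lra.
have f_ge x : expR (M%:R^-1 * logpoly (M ^ 2) (r * rho) tau x) <= f x.
  by apply: exp_logpoly_ge => //; exact: ltW.
have f0 x : 0 < f x by apply: lt_le_trans (f_ge x); exact: expR_gt0.
have F0 x : 0 <= F x by apply: prodr_ge0 => i _; exact: ltW.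
pose s := expR (t / M%:R - 55 * n%:R / M%:R ^+ 2).
have s0 : 0 < s by exact: expR_gt0.
exists (`[0, 1] `&` [set x | s <= F x]); split.
- exact: measurable_ge_continuous.
- apply: le_trans (markov_mean01 cF F0 s0) _; rewrite lee_fin.
  have hF := mean01_prod_exp_logpoly n tau b0 q2 K0 rr01 l01 lH.
  apply: (@le_trans _ _ (expR (36 * n%:R / M%:R ^+ 2) / s)).
    rewrite ler_wpM2r ?invr_ge0 ?(ltW s0)//; apply: le_trans hF _.
    have -> : 36 * n%:R / M%:R ^+ 2 = n%:R * (36 * M%:R^-1 ^+ 2) :> R by rewrite exprVn; ring.
    have e1 : 0 <= 1 + 36 * M%:R^-1 ^+ 2 :> R by rewrite addr_ge0// mulr_ge0// sqr_ge0.
    rewrite expRM_natl; apply: lerXn2r; rewrite ?nnegrE ?expR_ge0//.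
    exact: expR_ge1Dx.
  rewrite /s -expRN -expRD ler_expR; lra.
- move=> x x01 nB.
  have Fs : F x < s.
    by rewrite ltNge; apply/negP => h; apply: nB; split; rewrite //= in_itv.
  pose S := \sum_(k < n) logpoly (M ^ 2) (r * rho) tau ((b * q ^ k)%:R * x).
  have SF : expR (M%:R^-1 * S) <= F x.
    rewrite mulr_sumr expR_sum; apply: ler_prod => i _.
    by rewrite expR_ge0 f_ge.
  have {Fs}SF : M%:R^-1 * S <= t / M%:R - 55 * n%:R / M%:R ^+ 2.
    by rewrite -ler_expR; apply: le_trans SF (ltW Fs).
  apply: (@le_trans _ _ (expR (S + 55 * n%:R / M%:R))).
    have -> : S + 55 * n%:R / M%:R = \sum_(k < n) (logpoly (M ^ 2) (r * rho) tau ((b * q ^ k)%:R * x) + 55 / M%:R).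
      by rewrite big_split/= sumr_const card_ord -mulr_natr; congr (_ + _); ring.
    rewrite expR_sum; apply: ler_prod => i _.
    by rewrite circle_dist_ge0 circle_dist_le_exp_logpoly.
  rewrite ler_expR; move: SF; rewrite -(ler_pM2l M0) mulrA mulfV ?gt_eqF// mul1r.
  have -> : M%:R * (t / M%:R - 55 * n%:R / M%:R ^+ 2) = t - 55 * n%:R / M%:R.
    by field; rewrite gt_eqF.
  lra.
Qed.

(** The threshold on [M] in [harmonic_sum_sqr_le], which also serves as the constant
  of the tail estimate. *)
Definition tail_const : R := 250 ^+ 2.

(** The Gaussian tail: [M] is of the order of [sqrt (n / y)], which balances the
  two terms of the exponent in [orbit_prod_tail_rational]. When this value is too
  small for that estimate, the trivial bound [2 ^ n] is already good enough. *)
Lemma orbit_prod_tail (b n : nat) (y : R) : (0 < b)%N -> (0 < n)%N -> 0 < y ->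
  exists B : set R, [/\ measurable B, (mu B <= (expR (- 2 * y))%:E)%E &
   forall x, 0 <= x <= 1 -> ~ B x ->
     orbit_prod b n x <= expR (tail_const * Num.sqrt (n%:R * y))].
Proof.
move=> b0 n0 y0; set T := tail_const.
have T250 : 250 <= T by rewrite /T /tail_const expr2; lra.
have n0' : 0 < n%:R :> R by rewrite ltr0n.
set sn := Num.sqrt (n%:R : R); set sy := Num.sqrt y.
have sn0 : 0 < sn by rewrite sqrtr_gt0.
have sy0 : 0 < sy by rewrite sqrtr_gt0.
have snn : sn ^+ 2 = n%:R by rewrite sqr_sqrtr// ltW.
have syy : sy ^+ 2 = y by rewrite sqr_sqrtr// ltW.
have -> : Num.sqrt (n%:R * y) = sn * sy by rewrite sqrtrM// ltW.
have [h|h] := leP (T * sy) sn; last first.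
  exists set0; split => //; first by rewrite measure0 lee_fin expR_ge0.
  move=> x x01 _; apply: (@le_trans _ _ (expR n%:R)).
    rewrite -[n%:R]mulr1 expRM_natl /orbit_prod.
    rewrite -[X in _ ^+ X]card_ord -prodr_const; apply: ler_prod => i _.
    rewrite circle_dist_ge0/=; apply: le_trans (circle_dist_le2 _ rho01) _.
    by apply: le_trans (expR_ge1Dx _); lra.
  rewrite ler_expR -snn expr2 mulrCA ler_wpM2l ?(ltW sn0)//.
  exact: ltW.
pose M := (Num.truncn (sn / sy)).+1.
have M_gt : sn / sy < M%:R by exact: truncnS_gt.
have rat0 : 0 <= sn / sy by rewrite divr_ge0// ltW.
have M_le : M%:R <= sn / sy + 1 by rewrite /M -natr1 lerD2r truncn_le.
have rat : T <= sn / sy by rewrite ler_pdivlMr.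
have M250 : 250 ^+ 2 <= M%:R :> R by apply: le_trans (ltW M_gt).
have M0 : 0 < M%:R :> R by lra.
have [B [mB muB hB]] := orbit_prod_tail_rational n (T * (sn * sy)) b0 M250.
exists B; split => //; apply: le_trans muB _; rewrite lee_fin ler_expR.
have M2 : M%:R * sy <= 2 * sn.
  rewrite -ler_pdivlMr//; apply: le_trans M_le _; rewrite -mulrA; lra.
have M3 : sn <= M%:R * sy by rewrite -ler_pdivrMr// ltW.
have e1 : 91 * n%:R / M%:R ^+ 2 <= 91 * y.
  rewrite ler_pdivrMr ?exprn_gt0// -mulrA ler_wpM2l// -snn -syy -exprMn mulrC.
  by rewrite lerXn2r// nnegrE ?mulr_ge0// ltW.
have e2 : 93 * y <= T * (sn * sy) / M%:R.
  rewrite ler_pdivlMr// -syy.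
  have -> : 93 * sy ^+ 2 * M%:R = (93 * sy) * (M%:R * sy) by ring.
  have s1 : 0 <= sn * sy by rewrite mulr_ge0// ltW.
  apply: (@le_trans _ _ ((93 * sy) * (2 * sn))).
    by rewrite ler_wpM2l// mulr_ge0// ltW.
  have := ler_wpM2r s1 T250; lra.
lra.
Qed.

Lemma orbit_prodD b n n' x :
  orbit_prod b (n + n') x = orbit_prod b n x * orbit_prod (b * q ^ n) n' x.
Proof.
rewrite /orbit_prod big_split_ord/=; congr (_ * _); apply: eq_bigr => i _.
by rewrite expnD mulnA.
Qed.

Lemma orbit_prod_ge0 b n x : 0 <= orbit_prod b n x.
Proof. by apply: prodr_ge0 => i _; exact: circle_dist_ge0. Qed.

(** At stage [j], the logarithm of the size allowed for the products over the
  [2 ^ (j - i)] dyadic blocks of length [2 ^ i]. The term [(j - i)] pays for the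
  number of these blocks, and [ln (j + 4)] makes the stages summable; the shift by
  [4] ensures that the logarithm is at least [1]. *)
Definition level_bound (j i : nat) : R :=
  tail_const * Num.sqrt ((2 ^ i)%:R * (ln (j + 4)%:R + (j - i)%:R)).

Lemma level_bound_ge0 j i : 0 <= level_bound j i.
Proof. by rewrite mulr_ge0 ?sqrtr_ge0// /tail_const exprn_ge0. Qed.

(** The binary expansion of [n] cuts the product into dyadic blocks, with at most
  one block of each length. *)
Lemma orbit_prod_chaining (j p : nat) x :
  (forall i a, (i < j)%N -> (a < 2 ^ (j - i))%N ->
    orbit_prod (p * q ^ (a * 2 ^ i)) (2 ^ i) x <= expR (level_bound j i)) ->
  forall i a n, (i <= j)%N -> (a < 2 ^ (j - i))%N -> (n < 2 ^ i)%N ->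
    orbit_prod (p * q ^ (a * 2 ^ i)) n x <= expR (\sum_(l < i) level_bound j l).
Proof.
move=> block; elim=> [|i IH] a n ij aj.
  rewrite expn0 ltnS leqn0 => /eqP ->.
  by rewrite /orbit_prod !big_ord0 expR0.
move=> ni; have a2 : (a * 2 ^ i.+1 = (2 * a) * 2 ^ i)%N by rewrite expnS; lia.
have ji : (2 ^ (j - i) = 2 * 2 ^ (j - i.+1))%N by rewrite -expnS subnSK.
rewrite a2 big_ord_recr/= expRD.
have [nl|nl] := ltnP n (2 ^ i).
  apply: le_trans (IH (2 * a)%N n (ltnW ij) _ nl) _; first by rewrite ji; lia.
  by rewrite ler_peMr ?expR_ge0// -expR0 ler_expR level_bound_ge0.
rewrite -(subnKC nl) orbit_prodD [X in _ <= X]mulrC ler_pM ?orbit_prod_ge0//.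
  by apply: block => //; rewrite ji; lia.
rewrite -mulnA -expnD -[X in (_ + X)%N]mul1n -mulnDl.
by apply: IH; rewrite ?(ltnW ij)// ?ji; [lia|rewrite expnS in ni; lia].
Qed.

Lemma sum_geometric_le (r : R) n : 0 <= r < 1 ->
  \sum_(l < n) r ^+ l.+1 <= r / (1 - r).
Proof.
move=> /andP[r0 r1]; suff -> : \sum_(l < n) r ^+ l.+1 = r / (1 - r) - r ^+ n.+1 / (1 - r).
  by rewrite lerBlDr lerDl divr_ge0 ?exprn_ge0//; lra.
have r1' : 1 - r != 0 by rewrite subr_eq0 eq_sym lt_eqF.
elim: n => [|n IH]; first by rewrite big_ord0 expr1 subrr.
by rewrite big_ord_recr/= IH !exprS; field.
Qed.

(** The level [j - d] contributes at most [3/2 * (7/8)^d] times the bound for the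
  whole stage, because [2^(-d) (L + d) <= 2 L (3/4)^d]; the sum of these factors is
  below [21/2 <= 11]. *)
Lemma sum_level_bound j : \sum_(l < j) level_bound j l <=
  11 * tail_const * Num.sqrt ((2 ^ j)%:R * ln (j + 4)%:R).
Proof.
set L := ln _; set S := Num.sqrt _.
have T0 : 0 <= tail_const by rewrite /tail_const exprn_ge0.
have L1 : 1 <= L.
  rewrite -ler_expR lnK ?posrE ?ltr0n ?addn4//.
  by apply: le_trans (expR1_le4 R) _; rewrite ler_nat.
have S0 : 0 <= S by exact: sqrtr_ge0.
apply: (@le_trans _ _ (\sum_(l < j) (tail_const * S * (3 / 2)) * (7 / 8) ^+ l.+1)); last first.
  rewrite -mulr_sumr; have := @sum_geometric_le (7 / 8) j ltac:(lra).
  have h : 0 <= tail_const * S by rewrite mulr_ge0.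
  have -> : 1 - 7 / 8 = 8^-1 :> R by field.
  move=> /(ler_wpM2l h); rewrite invrK; set X := \sum_(_ < _) _ => hX.
  by rewrite -[tail_const * S * _ * _]mulrA [3 / 2 * X]mulrC mulrA; lra.
rewrite (reindex_inj rev_ord_inj)/=; apply: ler_sum => l _.
rewrite /level_bound; move: tail_const T0 => T T0.
rewrite -[leRHS]mulrA -[leRHS]mulrA ler_wpM2l//.
have -> : (j - (j - l.+1) = l.+1)%N by rewrite subKn.
set d := l.+1; have dj : (d <= j)%N by exact: ltn_ord.
rewrite -[X in _ <= _ * X]ger0_norm; last by rewrite mulr_ge0 ?exprn_ge0//; lra.
rewrite -sqrtr_sqr -sqrtrM; last by rewrite mulr_ge0//; lra.
rewrite ler_wsqrtr//.
have -> : (2 ^ j)%:R = (2 ^ (j - d))%:R * 2 ^+ d :> R.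
  by rewrite -natrX -natrM -expnD subnK.
have d1 : 1 + d%:R <= 2 * (3 / 2) ^+ d :> R.
  elim: (d) => [|e IH]; first by rewrite expr0; lra.
  have : 1 <= (3 / 2) ^+ e :> R by rewrite exprn_ege1//; lra.
  by rewrite exprS -[e.+1%:R]natr1; lra.
have p0 : 0 <= (2 ^ (j - d))%:R :> R by [].
rewrite -/L -[leRHS]mulrA -[leRHS]mulrA ler_wpM2l//.
have h1 : L + d%:R <= L * (2 * (3 / 2) ^+ d).
  have L0 : 0 <= L by lra.
  have := ler_wpM2l L0 d1; have : d%:R <= L * d%:R by rewrite ler_peMl.
  lra.
apply: le_trans h1 _.
(* [3/4 = 48/64 <= (7/8)^2]. *)
have h2 : (3 / 2) ^+ d <= 2 ^+ d * ((7 / 8) ^+ d) ^+ 2 :> R.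
  by rewrite -exprM mulnC exprM -exprMn; apply: lerXn2r; rewrite ?nnegrE; lra.
have L0 : 0 <= L by lra.
rewrite [leRHS]mulrCA ler_wpM2l//.
have p2 : 0 <= (3 / 2) ^+ d :> R by rewrite exprn_ge0//; lra.
rewrite [X in _ <= _ * X]exprMn; lra.
Qed.

Lemma measurable_bigU I (r : seq I) (F : I -> set R) :
  (forall i, measurable (F i)) -> measurable (\big[setU/set0]_(i <- r) F i).
Proof.
move=> mF; elim: r => [|i r IH]; first by rewrite big_nil.
by rewrite big_cons; exact: measurableU.
Qed.

Lemma mu_bigU_le I (r : seq I) (F : I -> set R) (b : I -> R) :
  (forall i, measurable (F i)) -> (forall i, (mu (F i) <= (b i)%:E)%E) ->
  (mu (\big[setU/set0]_(i <- r) F i) <= (\sum_(i <- r) b i)%:E)%E.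
Proof.
move=> mF Fb; elim: r => [|i r IH]; first by rewrite !big_nil measure0.
rewrite !big_cons EFinD.
apply: (@le_trans _ _ (mu (F i) + mu (\big[setU/set0]_(i <- r) F i))%E).
  apply: measureU2; first exact: mF.
  exact: (measurable_bigU r mF).
exact: leeD.
Qed.

(** The union bound over the dyadic blocks: with [d = j - i], the level [i]
  contributes [2^d exp (-2 d) <= 2^(-d)] times [(j + 4)^(-2)]. *)
Lemma orbit_prod_stage (p j : nat) : (0 < p)%N ->
  exists B : set R, [/\ measurable B, (mu B <= (((j + 4)%:R ^+ 2)^-1)%:E)%E &
    forall x, 0 <= x <= 1 -> ~ B x -> forall n, (n < 2 ^ j)%N ->
      orbit_prod p n x <= expR (11 * tail_const * Num.sqrt ((2 ^ j)%:R * ln (j + 4)%:R))].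
Proof.
move=> p0; set L := ln _.
have L0 : 0 < L by rewrite ln_gt0// ltr1n addn4.
pose y (i : nat) := L + (j - i)%:R.
have y0 i : 0 < y i by rewrite ltr_pwDl.
have q0 : (0 < q)%N by lia.
have pq (ia : nat * nat) : (0 < p * q ^ (ia.2 * 2 ^ ia.1))%N by rewrite muln_gt0 p0 expn_gt0 q0.
have [f hf] := choice (fun ia : nat * nat =>
  orbit_prod_tail (pq ia) (ltac:(by rewrite expn_gt0) : (0 < 2 ^ ia.1)%N) (y0 ia.1)).
pose Bi (i : nat) := \big[setU/set0]_(a < 2 ^ (j - i)) f (i, a : nat).
have mBi i : measurable (Bi i).
  by apply: measurable_bigU => a; have [] := hf (i, a : nat).
exists (\big[setU/set0]_(i < j) Bi i); split.
- by apply: measurable_bigU => i.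
- apply: le_trans (mu_bigU_le (b := fun i : 'I_j => (2 ^ (j - i))%:R * expR (- 2 * y i)) _ _ _) _.
  + by move=> i.
  + move=> i; have -> : (2 ^ (j - i))%:R * expR (- 2 * y i) = \sum_(a < 2 ^ (j - i)) expR (- 2 * y i).
      by rewrite sumr_const card_ord mulr_natl.
    by apply: mu_bigU_le => a; have [] := hf (i : nat, a : nat).
  rewrite lee_fin (reindex_inj rev_ord_inj)/=.
  have e2L : expR (- 2 * L) = ((j + 4)%:R ^+ 2)^-1.
    by rewrite mulNr expRN expRM_natl lnK ?posrE// ltr0n addn4.
  apply: (@le_trans _ _ (\sum_(l < j) ((j + 4)%:R ^+ 2)^-1 * 2^-1 ^+ l.+1)).
    apply: ler_sum => l _; rewrite /y subKn// mulrDr expRD e2L mulrCA.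
    rewrite ler_wpM2l ?invr_ge0 ?sqr_ge0// mulrC expRM_natr natrX -exprMn.
    have e4 : expR (- 2) * 2 <= 2^-1 :> R.
      have e1 : 2 <= expR 1 :> R by apply: le_trans (expR_ge1Dx _); lra.
      have -> : - 2 = - (2%:R * 1) :> R by rewrite mulr1.
      rewrite mulrC expRN ler_pdivrMr ?expR_gt0// expRM_natl.
      by have := ler_pM (ler0n R 2) (ler0n R 2) e1 e1; rewrite -expr2; lra.
    by rewrite lerXn2r// nnegrE ?mulr_ge0 ?expR_ge0 ?invr_ge0.
  rewrite -mulr_sumr -[leRHS]mulr1 ler_wpM2l ?invr_ge0 ?sqr_ge0//.
  apply: le_trans (@sum_geometric_le 2^-1 j _) _; first lra.
  by have -> : 1 - 2^-1 = 2^-1 :> R; [field | rewrite divff].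
- move=> x x01 nB n nj.
  have block i a : (i < j)%N -> (a < 2 ^ (j - i))%N ->
    orbit_prod (p * q ^ (a * 2 ^ i)) (2 ^ i) x <= expR (level_bound j i).
    move=> ij aj; have [_ _] := hf (i, a); apply => // fx; apply: nB.
    rewrite -bigcup_mkord; exists i => //=.
    by rewrite /Bi -(bigcup_mkord (2 ^ (j - i)) (fun a => f (i, a))); exists a.
  have := orbit_prod_chaining block (leqnn j) (_ : (0 < 2 ^ (j - j))%N) nj.
  rewrite subnn mul0n expn0 muln1 => /(_ isT)/le_trans; apply.
  by rewrite ler_expR sum_level_bound.
Qed.

Lemma cvg_series_inv_sqr : cvgn (series (fun j : nat => ((j + 4)%:R ^+ 2)^-1 : R)).
Proof.
apply: nondecreasing_is_cvgn.
  apply: nondecreasing_series => n _ _; by rewrite invr_ge0 sqr_ge0.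
exists 1 => _ [n _ <-].
suff : series (fun j : nat => ((j + 4)%:R ^+ 2)^-1 : R) n <= 1 - (n + 3)%:R^-1.
  by move/le_trans; apply; rewrite lerBlDr lerDl invr_ge0.
elim: n => [|n IH].
  by rewrite /series/= big_geq// subr_ge0 invf_le1// ler1n.
rewrite seriesSr; apply: le_trans (lerD IH (lexx _)) _.
have -> : (n.+1 + 3)%:R = (n + 3)%:R + 1 :> R by rewrite natr1.
have -> : (n + 4)%:R = (n + 3)%:R + 1 :> R by rewrite natr1 addn4 addn3.
have : 0 < (n + 3)%:R :> R by rewrite ltr0n addn3.
set x := (n + 3)%:R => x0; rewrite -subr_ge0.
have -> : 1 - (x + 1)^-1 - (1 - x^-1 + ((x + 1) ^+ 2)^-1) = (x * (x + 1) ^+ 2)^-1.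
  by field; rewrite ?gt_eqF//; lra.
by rewrite invr_ge0 mulr_ge0 ?sqr_ge0// ltW.
Qed.

(** At stage [j], which concerns [n < 2^j], the exponent is of the order of
  [sqrt (2^j ln j)], that is [sqrt (n ln ln n)] for [n] close to [2^j]. *)
Lemma ae_orbit_prod_le (p : nat) : (0 < p)%N ->
  {ae mu, forall x, 0 <= x <= 1 -> exists j0, forall j, (j0 <= j)%N ->
    forall n, (n < 2 ^ j)%N ->
    orbit_prod p n x <= expR (11 * tail_const * Num.sqrt ((2 ^ j)%:R * ln (j + 4)%:R))}.
Proof.
move=> p0; have [B hB] := choice (fun j => orbit_prod_stage j p0).
have := @ae_eventually_notin R B (fun j => ((j + 4)%:R ^+ 2)^-1).
move=> /(_ _ _ _ cvg_series_inv_sqr) h.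
have {}h := h ltac:(by move=> j; have [] := hB j)
  ltac:(by move=> j; rewrite invr_ge0 sqr_ge0) ltac:(by move=> j; have [] := hB j).
apply: ae_mono h => x [j0 xB] x01; exists j0 => j jj0 n nj.
by have [_ _] := hB j; apply => //; exact: xB.
Qed.

End FixedRoot.
End LawOfIteratedLogarithm.

(** * Factorization of a trigonometric polynomial on the unit circle *)

Section ComplexExponential.
Variable R : realType.
Local Notation C := (complex R).
Implicit Types (x y : R) (z w : C).

Lemma modulusM z w : modulus (z * w) = modulus z * modulus w.
Proof. exact: Normc.normcM. Qed.

Lemma modulus_ge0 z : 0 <= modulus z.
Proof. by case: z => a b; exact: sqrtr_ge0. Qed.

Lemma ler_modulusD z w : modulus (z + w) <= modulus z + modulus w.
Proof. exact: le_normcD. Qed.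

Lemma modulus0 : modulus (0 : C) = 0. Proof. exact: Normc.normc0. Qed.

Lemma modulus1 : modulus (1 : C) = 1. Proof. exact: Normc.normc1. Qed.

Lemma modulusN z : modulus (- z) = modulus z.
Proof. exact: normcN. Qed.

Lemma ler_modulus_sum I (r : seq I) (P : pred I) (F : I -> C) :
  modulus (\sum_(i <- r | P i) F i) <= \sum_(i <- r | P i) modulus (F i).
Proof.
elim/big_ind2: _ => [|z a w b za wb|i _]; rewrite ?modulus0//.
by apply: le_trans (ler_modulusD _ _) _; apply: lerD.
Qed.

Lemma modulus_prod I (r : seq I) (F : I -> C) :
  modulus (\prod_(i <- r) F i) = \prod_(i <- r) modulus (F i).
Proof. exact: (big_morph _ modulusM modulus1). Qed.

Lemma modulus_e2pi x : modulus (e2pi x) = 1.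
Proof. by rewrite /modulus /e2pi /= cos2Dsin2 sqrtr1. Qed.

Lemma e2piD x y : e2pi (x + y) = e2pi x * e2pi y.
Proof.
rewrite /e2pi mulrDr cosD sinD; apply/eqP; rewrite eq_complex /=.
by rewrite eqxx /= addrC eqxx.
Qed.

Lemma e2pi0 : e2pi 0 = 1 :> C.
Proof. by rewrite /e2pi mulr0 cos0 sin0. Qed.

Lemma e2pi_natM (n : nat) x : e2pi (n%:R * x) = e2pi x ^+ n.
Proof.
elim: n => [|n IH]; first by rewrite mul0r e2pi0.
by rewrite -natr1 mulrDl mul1r e2piD IH exprSr.
Qed.

Lemma cos_sin_exists (a b : R) : a ^+ 2 + b ^+ 2 = 1 ->
  exists t, a = cos t /\ b = sin t.
Proof.
move=> ab; have a1 : -1 <= a <= 1.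
  by rewrite -ler_norml -(@ler_pXn2r _ 2)// ?nnegrE// real_normK ?num_real// expr1n -ab lerDl sqr_ge0.
have b2 : 1 - a ^+ 2 = b ^+ 2 by rewrite -ab; ring.
have aK : cos (acos a) = a by apply: acosK; rewrite in_itv.
have [b0|b0] := leP 0 b.
  by exists (acos a); rewrite aK sin_acos// b2 sqrtr_sqr ger0_norm.
exists (- acos a); rewrite cosN sinN aK sin_acos// b2 sqrtr_sqr ltr0_norm//.
by rewrite opprK.
Qed.

(** A root [z] inside the unit disc is taken in polar coordinates. Outside, it is
  replaced by its reflection [1 / conj z], which multiplies the distances to the
  points of the circle by the constant [1 / |z|]. *)
Lemma modulus_e2pi_sub (z : C) : exists (c rho tau : R),
  [/\ 1 <= c, 0 <= rho <= 1 &
   forall x, modulus (e2pi x - z) = c * circle_dist rho (x - tau)].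
Proof.
case: z => a b; set m := Num.sqrt (a ^+ 2 + b ^+ 2).
have s0 : 0 <= a ^+ 2 + b ^+ 2 by rewrite addr_ge0 ?sqr_ge0.
have mm : m ^+ 2 = a ^+ 2 + b ^+ 2 by rewrite sqr_sqrtr.
have m0 : 0 <= m by exact: sqrtr_ge0.
have [t [at_ bt]] : exists t, a = m * cos t /\ b = m * sin t.
  have [m00|m00] := eqVneq m 0.
    exists 0; rewrite m00 !mul0r; move: mm; rewrite m00 expr0n /= => /esym/eqP.
    by rewrite paddr_eq0 ?sqr_ge0// !sqrf_eq0 => /andP[/eqP -> /eqP ->].
  have [|t [h1 h2]] := @cos_sin_exists (a / m) (b / m).
    by rewrite !expr_div_n -mulrDl -mm divff// expf_neq0.
  by exists t; rewrite -h1 -h2; split; rewrite mulrC divfK.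
have key x : modulus (e2pi x - Complex a b) =
    Num.sqrt (1 - 2 * m * cos (2 * pi * (x - t / (2 * pi))) + m ^+ 2).
  rewrite /modulus /e2pi /=; congr Num.sqrt.
  have -> : 2 * pi * (x - t / (2 * pi)) = 2 * pi * x - t.
    by rewrite mulrBr [_ * (t / _)]mulrC divfK// mulf_neq0// lt0r_neq0// pi_gt0.
  rewrite cosB; have := cos2Dsin2 (2 * pi * x).
  set c := cos (_ * _); set s := sin (_ * _) => cs.
  have -> : (c - a) ^+ 2 + (s - b) ^+ 2 = (c ^+ 2 + s ^+ 2) - 2 * (c * a + s * b) + (a ^+ 2 + b ^+ 2) by ring.
  by rewrite cs -mm {1}at_ {1}bt; ring.
have [m1|m1] := leP m 1.
  exists 1, m, (t / (2 * pi)); split => [//||x]; first by rewrite m0.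
  by rewrite mul1r key.
exists m, m^-1, (t / (2 * pi)); split => [||x]; first exact: ltW.
  by rewrite invr_ge0 m0 invf_le1 ?ltW//; lra.
rewrite key /circle_dist -[X in _ = X * _](ger0_norm m0) -sqrtr_sqr -sqrtrM ?sqr_ge0//.
by congr Num.sqrt; field; rewrite gt_eqF//; lra.
Qed.

(** The roots of the polynomial [\sum_j eps j X^j] give the factorization of its
  modulus on the unit circle; the constant [c] is its Mahler measure. *)
Lemma modulus_trig_factor (q : nat) (eps : nat -> C) : (0 < q)%N ->
  modulus (eps q.-1) = 1 ->
  exists (c : R) (s : seq (R * R)),
  [/\ 1 <= c, all (fun rt => 0 <= rt.1 <= 1) s &
   forall x, modulus (\sum_(j < q) eps j * e2pi (j%:R * x)) =
     c * \prod_(rt <- s) circle_dist rt.1 (x - rt.2)].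
Proof.
move=> q0 e1; pose p := \poly_(j < q) eps j.
have eq0 : eps q.-1 != 0.
  by apply/eqP => h; move: e1; rewrite h modulus0 => /eqP; rewrite eq_sym oner_eq0.
have lp : lead_coef p = eps q.-1 by rewrite lead_coef_poly.
have [r hr] := closed_field_poly_normal p.
have hp x : modulus (\sum_(j < q) eps j * e2pi (j%:R * x)) =
    \prod_(z <- r) modulus (e2pi x - z).
  have -> : \sum_(j < q) eps j * e2pi (j%:R * x) = p.[e2pi x].
    by rewrite horner_poly; apply: eq_bigr => j _; rewrite e2pi_natM.
  rewrite hr hornerZ modulusM lp e1 mul1r horner_prod modulus_prod.
  by apply: eq_bigr => z _; rewrite hornerXsubC.
have {}hr : exists (c : R) (s : seq (R * R)),
  [/\ 1 <= c, all (fun rt => 0 <= rt.1 <= 1) s &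
   forall x, \prod_(z <- r) modulus (e2pi x - z) =
     c * \prod_(rt <- s) circle_dist rt.1 (x - rt.2)].
  elim: (r) => [|z r' [c [s [c1 s1 hs]]]].
    by exists 1, [::]; split => // x; rewrite !big_nil mul1r.
  have [c' [rho [tau [c'1 rho1 hz]]]] := modulus_e2pi_sub z.
  exists (c' * c), ((rho, tau) :: s); split.
  - by rewrite mulr_ege1.
  - by rewrite /= rho1.
  - by move=> x; rewrite !big_cons hz hs /=; ring.
have [c [s [c1 s1 hs]]] := hr.
by exists c, s; split => // x; rewrite hp hs.
Qed.

End ComplexExponential.

(** * Exponential sums of the generalized Thue-Morse sequence *)

Section GeneralizedThueMorse.
Variable R : realType.
Local Notation C := (complex R).
Variables (q : nat) (eps : nat -> C).
Hypothesis q2 : (2 <= q)%N.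
Hypothesis eps_pm : forall j, eps j = 1 \/ eps j = -1.
Hypothesis eps0 : eps 0 = 1.

Fixpoint digit_prod (fuel n : nat) : C :=
  if fuel is k.+1 then digit_prod k (n %/ q) * eps (n %% q) else 1.

(** The generalized Thue-Morse sequence: the product of the signs [eps] over
  the base-[q] digits, of which there are at most [n]. *)
Definition tm_seq (n : nat) : C := digit_prod n n.

Lemma digit_prod0 k : digit_prod k 0 = 1.
Proof. by elim: k => //= k IH; rewrite div0n mod0n IH eps0 mulr1. Qed.

Lemma digit_prod_stable k n : (n <= k)%N -> digit_prod k n = tm_seq n.
Proof.
rewrite /tm_seq; move: n; have [m] := ubnP k; elim: m k => // m IH [|k] km n nk.
  by move: nk; rewrite leqn0 => /eqP ->.
case: n nk => [|n] nk; first by rewrite digit_prod0.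
have d1 : (n.+1 %/ q <= n)%N by rewrite -ltnS ltn_Pdiv.
by rewrite /= (IH k)// ?(IH n) ?(leq_trans d1)//; lia.
Qed.

Lemma tm_seq0 : tm_seq 0 = 1. Proof. by []. Qed.

Lemma tm_seqM m j : (j < q)%N -> tm_seq (q * m + j) = tm_seq m * eps j.
Proof.
move=> jq; have q0 : (0 < q)%N by lia.
rewrite -(@digit_prod_stable (q * m + j).+1)//= mulnC divnMDl// divn_small// addn0.
rewrite modnMDl modn_small// digit_prod_stable//.
by apply: leq_trans (leq_addr _ _); rewrite leq_pmulr.
Qed.

Lemma digit_prod_pm k n : digit_prod k n = 1 \/ digit_prod k n = -1.
Proof.
elim: k n => [|k IH] n /=; first by left.
case: (IH (n %/ q)%N) => ->; case: (eps_pm (n %% q)%N) => ->;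
  rewrite ?mulN1r ?mul1r ?opprK; by [left|right].
Qed.

Lemma tm_seq_pm n : tm_seq n = 1 \/ tm_seq n = -1.
Proof. exact: digit_prod_pm. Qed.

Lemma modulus_pm (z : C) : z = 1 \/ z = -1 -> modulus z = 1.
Proof. by case=> ->; rewrite ?modulusN modulus1. Qed.

Lemma modulus_tm_seq n : modulus (tm_seq n) = 1.
Proof. exact/modulus_pm/tm_seq_pm. Qed.

Lemma tm_seqMX r m j : (j < q ^ r)%N ->
  tm_seq (q ^ r * m + j) = tm_seq m * tm_seq j.
Proof.
elim: r m j => [|r IH] m j; first by rewrite expn0 ltnS leqn0 => /eqP ->; rewrite mul1n addn0 tm_seq0 mulr1.
move=> jr; have q0 : (0 < q)%N by lia.
rewrite {2}(divn_eq j q) {1}(divn_eq j q) expnS addnA -mulnA [(j %/ q * q)%N]mulnC -mulnDr.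
rewrite !tm_seqM ?ltn_mod// IH ?mulrA//.
by rewrite ltn_divLR// mulnC -expnS.
Qed.

Definition exp_sum (f : nat -> C) (s e : nat) (x : R) : C :=
  \sum_(s <= k < e) f k * e2pi (k%:R * x).

Lemma modulus_exp_sum_le f s e x : (forall k, modulus (f k) <= 1) ->
  modulus (exp_sum f s e x) <= (e - s)%:R.
Proof.
move=> f1; apply: le_trans (ler_modulus_sum _ _ _) _.
apply: (@le_trans _ _ (\sum_(s <= k < e) 1)).
  by apply: ler_sum => k _; rewrite modulusM modulus_e2pi mulr1.
by rewrite sumr_const_nat.
Qed.

Lemma exp_sum_cat f s m e x : (s <= m)%N -> (m <= e)%N ->
  exp_sum f s e x = exp_sum f s m x + exp_sum f m e x.
Proof. by move=> sm me; rewrite /exp_sum -big_cat_nat. Qed.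

Definition twist_poly (x : R) : C := \sum_(j < q) eps j * e2pi (j%:R * x).

Definition twist_prod (n : nat) (x : R) : C := \prod_(k < n) twist_poly ((q ^ k)%:R * x).

Lemma twist_prodS n x :
  twist_prod n.+1 x = twist_poly x * twist_prod n (q%:R * x).
Proof.
rewrite /twist_prod big_ord_recl expn0 mul1r; congr (_ * _).
by apply: eq_bigr => i _; rewrite lift0 expnS mulnC natrM mulrA.
Qed.

(** Renormalization: over full blocks of length [q], the sum factors through the
  same sum at the frequency [q x]. *)
Lemma exp_sum_block s e x : (s <= e)%N ->
  exp_sum tm_seq (q * s) (q * e) x = twist_poly x * exp_sum tm_seq s e (q%:R * x).
Proof.
elim: e => [|e IH].
  by rewrite leqn0 => /eqP ->; rewrite muln0 /exp_sum !big_geq// mulr0.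
rewrite leq_eqVlt => /orP[/eqP <-|]; first by rewrite /exp_sum !big_geq// mulr0.
rewrite ltnS => se.
have se1 : (q * s <= q * e)%N by rewrite leq_mul2l se orbT.
have ee1 : (q * e <= q * e.+1)%N by rewrite leq_mul2l leqnSn orbT.
rewrite (exp_sum_cat _ _ se1 ee1).
rewrite IH//.
rewrite (exp_sum_cat _ _ se (leqnSn e)) mulrDr; congr (_ + _).
rewrite /exp_sum big_nat1 mulnS -{1}[(q * e)%N]add0n big_addn addnK.
rewrite big_mkord /twist_poly mulr_suml; apply: eq_bigr => j _.
have -> : (j + q * e)%:R * x = j%:R * x + e%:R * (q%:R * x).
  by rewrite natrD natrM; ring.
by rewrite addnC tm_seqM// e2piD; ring.
Qed.

(** Renormalization leaves fewer than [q] terms on each side of the full blocks;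
  at depth [k], they are multiplied by [twist_prod k x]. *)
Lemma modulus_exp_sum_tm n s e x : (e - s <= q ^ n)%N ->
  modulus (exp_sum tm_seq s e x) <=
  2 * q%:R * \sum_(k < n.+1) modulus (twist_prod k x).
Proof.
have tm1 k : modulus (tm_seq k) <= 1 by rewrite modulus_tm_seq.
have triv s' e' y m : (e' - s' <= 2 * q)%N ->
    modulus (exp_sum tm_seq s' e' y) <= 2 * q%:R * \sum_(k < m.+1) modulus (twist_prod k y).
  move=> es; apply: le_trans (modulus_exp_sum_le _ _ _ tm1) _.
  rewrite big_ord_recl {1}/twist_prod big_ord0 modulus1 mulrDr mulr1.
  apply: (@le_trans _ _ (2 * q%:R)); first by rewrite -natrM ler_nat.
  by rewrite lerDl mulr_ge0 ?mulr_ge0 ?sumr_ge0// => k _; exact: modulus_ge0.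
elim: n s e x => [|n IH] s e x es; first by apply: triv; rewrite expn0 in es; lia.
have q0 : (0 < q)%N by lia.
have [small|large] := leqP (e - s) (2 * q); first exact: triv.
pose s' := ((s + q.-1) %/ q)%N; pose e' := (e %/ q)%N.
have s1 : (s <= q * s' < s + q)%N.
  have := divn_eq (s + q.-1) q; have := ltn_pmod (s + q.-1) q0; rewrite -/s' => h1 h2.
  by rewrite mulnC; apply/andP; split; lia.
have e1 : (e < q * e' + q)%N && (q * e' <= e)%N.
  have := divn_eq e q; have := ltn_pmod e q0; rewrite -/e' => h1 h2.
  by rewrite mulnC; apply/andP; split; lia.
have /andP[s1a s1b] := s1; have /andP[e1a e1b] := e1.
have se' : (q * s' <= q * e')%N by lia.
have se : (s' <= e')%N by move: se'; rewrite leq_mul2l; lia.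
rewrite (@exp_sum_cat _ s (q * s')%N e)//; last lia.
rewrite (@exp_sum_cat _ (q * s')%N (q * e')%N e)// exp_sum_block//.
have len : (e' - s' <= q ^ n)%N.
  have : (q * (e' - s') <= q * q ^ n)%N by rewrite mulnBr -expnS; lia.
  by rewrite leq_mul2l; lia.
rewrite big_ord_recl {1}/twist_prod big_ord0 modulus1 mulrDr mulr1.
have b1 : modulus (exp_sum tm_seq s (q * s') x) <= q%:R.
  by apply: le_trans (modulus_exp_sum_le _ _ _ tm1) _; rewrite ler_nat; lia.
have b2 : modulus (exp_sum tm_seq (q * e') e x) <= q%:R.
  by apply: le_trans (modulus_exp_sum_le _ _ _ tm1) _; rewrite ler_nat; lia.
have b3 : modulus (twist_poly x * exp_sum tm_seq s' e' (q%:R * x)) <=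
    2 * q%:R * \sum_(k < n.+1) modulus (twist_prod (lift ord0 k) x).
  rewrite modulusM; apply: le_trans (ler_wpM2l (modulus_ge0 _) (IH _ _ (q%:R * x) len)) _.
  rewrite mulrCA ler_wpM2l ?mulr_ge0// mulr_sumr ler_sum// => k _.
  by rewrite lift0 twist_prodS modulusM.
apply: le_trans (ler_modulusD _ _) _.
have := ler_modulusD (twist_poly x * exp_sum tm_seq s' e' (q%:R * x)) (exp_sum tm_seq (q * e') e x).
lra.
Qed.

Lemma modulus_geometric_sum s e x : e2pi x != 1 ->
  modulus (exp_sum (fun=> 1) s e x) <= 2 / modulus (1 - e2pi x).
Proof.
move=> x1; have d0 : 1 - e2pi x != 0 by rewrite subr_eq0 eq_sym.
have m0 : 0 < modulus (1 - e2pi x).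
  rewrite lt_neqAle modulus_ge0 andbT eq_sym; apply: contra d0 => /eqP h.
  by apply/eqP; exact: Normc.eq0_normc.
rewrite ler_pdivlMr// -modulusM.
have [es|se] := leqP e s; first by rewrite /exp_sum big_geq// mul0r modulus0.
have -> : exp_sum (fun=> 1) s e x * (1 - e2pi x) = e2pi (s%:R * x) - e2pi (e%:R * x).
  have -> : e2pi (s%:R * x) - e2pi (e%:R * x) =
      - e2pi (e%:R * x) - (- e2pi (s%:R * x)) by rewrite opprK addrC.
  rewrite -(telescope_sumr (fun k => - e2pi (k%:R * x)) (ltnW se)).
  rewrite /exp_sum mulr_suml; apply: eq_bigr => k _.
  by rewrite -[k.+1%:R]natr1 [in RHS]mulrDl [1 * x]mul1r e2piD; ring.
apply: le_trans (ler_modulusD _ _) _; rewrite modulusN !modulus_e2pi; lra.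
Qed.

(** For [j < Q], the smallest [m] with [s <= Q * m + j]. *)
Definition residue_lo (Q j s : nat) : nat := ((s + Q.-1 - j) %/ Q)%N.

Lemma sum_residues (Q : nat) (F : nat -> C) (s e : nat) : (0 < Q)%N -> (s <= e)%N ->
  \sum_(s <= k < e) F k =
  \sum_(j < Q) \sum_(residue_lo Q j s <= m < residue_lo Q j e) F (Q * m + j)%N.
Proof.
move=> Q0; elim: e => [|e IH].
  rewrite leqn0 => /eqP ->; rewrite big_geq// big1// => j _.
  by rewrite big_geq.
rewrite leq_eqVlt => /orP[/eqP <-|].
  by rewrite big_geq// big1// => j _; rewrite big_geq.
rewrite ltnS => se; rewrite big_nat_recr//= IH//.
have eQ : (e %% Q < Q)%N by rewrite ltn_mod.
rewrite (bigD1 (Ordinal eQ))//= [RHS](bigD1 (Ordinal eQ))//=.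
have step j : (j < Q)%N -> residue_lo Q j e.+1 = (residue_lo Q j e + (j == e %% Q))%N.
  move=> jQ; rewrite /residue_lo.
  have E := divn_eq e Q; set d := (e %/ Q)%N in E; set r := (e %% Q)%N in E eQ *.
  rewrite E; case: ltngtP => jr.
  - have -> : ((d * Q + r).+1 + Q.-1 - j = d.+1 * Q + (r - j))%N by rewrite mulSn; lia.
    have -> : (d * Q + r + Q.-1 - j = d.+1 * Q + (r - j.+1))%N by rewrite mulSn; lia.
    by rewrite !divnMDl// !divn_small ?addn0//; lia.
  - have -> : ((d * Q + r).+1 + Q.-1 - j = d * Q + (Q + r - j))%N by lia.
    have -> : (d * Q + r + Q.-1 - j = d * Q + (Q + r - j.+1))%N by lia.
    by rewrite !divnMDl// !divn_small ?addn0//; lia.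
  - have -> : ((d * Q + r).+1 + Q.-1 - j = d.+1 * Q + 0)%N by rewrite mulSn; lia.
    have -> : (d * Q + r + Q.-1 - j = d * Q + Q.-1)%N by lia.
    by rewrite !divnMDl// div0n [(Q.-1 %/ Q)%N]divn_small; lia.
have lo_e : residue_lo Q (e %% Q) e = (e %/ Q)%N.
  rewrite /residue_lo {1}(divn_eq e Q).
  have -> : (e %/ Q * Q + e %% Q + Q.-1 - e %% Q = e %/ Q * Q + Q.-1)%N by lia.
  by rewrite divnMDl// [(Q.-1 %/ Q)%N]divn_small; lia.
rewrite step// eqxx addn1 big_nat_recr/=; last first.
  by rewrite /residue_lo leq_div2r//; lia.
rewrite lo_e mulnC -divn_eq -!addrA; congr (_ + _); rewrite addrC; congr (_ + _).
apply: eq_bigr => j je; rewrite step// (_ : (j == e %% Q :> nat)%N = false) ?addn0//.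
by apply/negbTE; move: je; rewrite -val_eqE.
Qed.

Lemma residue_len Q j s e : (0 < Q)%N -> (j < Q)%N -> (s <= e)%N ->
  (residue_lo Q j e - residue_lo Q j s <= (e - s) %/ Q + 1)%N.
Proof.
move=> Q0 jQ se; rewrite /residue_lo.
have -> : (e + Q.-1 - j = (s + Q.-1 - j) + (e - s))%N by lia.
by rewrite leq_subLR divnD// -addnA !leq_add2l leq_b1.
Qed.

Definition pair_seq (k : nat) : C := tm_seq k * tm_seq k.+1.

Lemma modulus_pair_seq k : modulus (pair_seq k) <= 1.
Proof. by rewrite modulusM !modulus_tm_seq mulr1. Qed.

Lemma modulus_residue_class f g (Q j s e : nat) (k : C) x : modulus k = 1 ->
  (forall m, f (Q * m + j)%N = k * g m) ->
  modulus (\sum_(s <= m < e) f (Q * m + j)%N * e2pi ((Q * m + j)%:R * x)) =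
  modulus (exp_sum g s e (Q%:R * x)).
Proof.
move=> k1 fg.
have -> : \sum_(s <= m < e) f (Q * m + j)%N * e2pi ((Q * m + j)%:R * x) =
    k * e2pi (j%:R * x) * exp_sum g s e (Q%:R * x).
  rewrite /exp_sum mulr_sumr; apply: eq_bigr => m _.
  have -> : (Q * m + j)%:R * x = j%:R * x + m%:R * (Q%:R * x).
    by rewrite natrD natrM; ring.
  by rewrite fg e2piD; ring.
by rewrite !modulusM k1 modulus_e2pi !mul1r.
Qed.

(** The indices [q m + j] and [q m + j + 1] lie in the same block of length [q]
  unless [j = q - 1]; the signs [v m] then cancel out, and a geometric sum is left.
  For [j = q - 1] the product is again [v m * v (m + 1)] up to sign, since
  [eps 0 = 1]. The slack [2] in the length makes the induction go through, as the
  residue classes are longer than [(e - s) / q] by at most one. *)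
Lemma modulus_exp_sum_pair n s e x : (e - s <= q ^ n + 2)%N ->
  (forall k, e2pi ((q ^ k)%:R * x) != 1) ->
  modulus (exp_sum pair_seq s e x) <=
  3 + \sum_(k < n) 2 * q%:R / modulus (1 - e2pi ((q ^ k.+1)%:R * x)).
Proof.
have q0 : (0 < q)%N by lia.
elim: n s e x => [|n IH] s e x es nx.
  rewrite big_ord0 addr0; apply: le_trans (modulus_exp_sum_le _ _ _ modulus_pair_seq) _.
  by rewrite ler_nat; rewrite expn0 in es.
have [ltes|se] := ltnP e s.
  rewrite /exp_sum big_geq ?modulus0 ?(ltnW ltes)// addr_ge0// sumr_ge0// => k _.
  by rewrite divr_ge0 ?modulus_ge0 ?mulr_ge0.
have qx : e2pi (q%:R * x) != 1 by have := nx 1%N; rewrite expn1.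
rewrite /exp_sum (sum_residues _ q0 se).
apply: le_trans (ler_modulus_sum _ _ _) _.
have D0 : 0 <= 2 / modulus (1 - e2pi (q%:R * x)) by rewrite divr_ge0 ?modulus_ge0.
have last_ord (G : nat -> R) p : (0 < p)%N -> \sum_(i < p) G i = \sum_(i < p.-1) G i + G p.-1.
  by case: p => // p _; rewrite big_ord_recr.
rewrite (last_ord (fun i => modulus (\sum_(residue_lo q i s <= m < residue_lo q i e)
  pair_seq (q * m + i)%N * e2pi ((q * m + i)%:R * x))) q q0) big_ord_recl expn1.
have last_class : modulus (\sum_(residue_lo q q.-1 s <= m < residue_lo q q.-1 e)
     pair_seq (q * m + q.-1)%N * e2pi ((q * m + q.-1)%:R * x)) <=
   3 + \sum_(k < n) 2 * q%:R / modulus (1 - e2pi ((q ^ (lift ord0 k).+1)%:R * x)).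
  rewrite (@modulus_residue_class pair_seq pair_seq q q.-1 _ _ (eps q.-1)).
  - have len : (residue_lo q q.-1 e - residue_lo q q.-1 s <= q ^ n + 2)%N.
      apply: leq_trans (residue_len q0 _ se) _; first lia.
      have : ((e - s) %/ q <= (q ^ n.+1 + 2) %/ q)%N by exact: leq_div2r.
      rewrite expnS mulnC divnMDl//; have := leq_div2l 2 (ltn0Sn 1) q2.
      by rewrite divnn; set a := (_ %/ q)%N; set b := (2 %/ q)%N => /=; lia.
    apply: le_trans (IH _ _ _ len _) _ => [k|].
      by rewrite mulrA -natrM -expnSr.
    rewrite lerD2l ler_sum// => k _.
    rewrite (_ : (q ^ (lift ord0 k).+1)%:R * x = (q ^ k.+1)%:R * (q%:R * x)) ?lexx//.
    by rewrite lift0 expnSr natrM mulrA.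
  - exact/modulus_pm.
  - move=> m; rewrite /pair_seq tm_seqM; last lia.
    have -> : (q * m + q.-1).+1 = (q * m.+1 + 0)%N by rewrite mulnS; lia.
    by rewrite tm_seqM// eps0; ring.
have other_class (j : nat) : (j < q.-1)%N ->
   modulus (\sum_(residue_lo q j s <= m < residue_lo q j e)
     pair_seq (q * m + j)%N * e2pi ((q * m + j)%:R * x)) <=
   2 / modulus (1 - e2pi (q%:R * x)).
  move=> jq; rewrite (@modulus_residue_class pair_seq (fun=> 1) q j _ _ (eps j * eps j.+1)).
  - exact: modulus_geometric_sum.
  - by rewrite modulusM !(modulus_pm (eps_pm _)) mulr1.
  - move=> m; rewrite /pair_seq -addnS !tm_seqM; try lia.
    by case: (tm_seq_pm m) => ->; ring.
have others : \sum_(i < q.-1) modulus (\sum_(residue_lo q i s <= m < residue_lo q i e)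
     pair_seq (q * m + i)%N * e2pi ((q * m + i)%:R * x)) <=
   2 * q%:R / modulus (1 - e2pi (q%:R * x)).
  apply: (@le_trans _ _ (\sum_(i < q.-1) 2 / modulus (1 - e2pi (q%:R * x)))).
    by apply: ler_sum => i _; apply: other_class.
  rewrite sumr_const card_ord [leRHS]mulrAC [leRHS]mulr_natr.
  by apply: ler_wpMn2l => //; lia.
rewrite addrCA; exact: lerD.
Qed.

Definition local_sign (b0 b1 : bool) (m : nat) : C :=
  (if b0 then tm_seq m else 1) * (if b1 then tm_seq m.+1 else 1).

(** A shift smaller than the length [q ^ r] of the blocks leads into the same block
  or into the next one. Each factor contributes either [tm_seq m] or [tm_seq m.+1],
  up to sign, and equal factors cancel in pairs. *)
Lemma prod_shifts (r j : nat) (A : seq nat) : (j < q ^ r)%N ->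
  all (fun a => a < q ^ r)%N A ->
  exists (k : C) (b0 b1 : bool), [/\ modulus k = 1, b0 (+) b1 = odd (size A) &
   forall m, \prod_(a <- A) tm_seq (q ^ r * m + j + a) = k * local_sign b0 b1 m].
Proof.
rewrite /local_sign => jr; elim: A => [_|a A IH /= /andP[ar /IH [k [b0 [b1 [k1 b01 hA]]]]]].
  by exists 1, false, false; split; rewrite ?modulus1// => m; rewrite big_nil !mulr1.
have sq n : tm_seq n * tm_seq n = 1 by case: (tm_seq_pm n) => ->; ring.
have [ja|ja] := ltnP (j + a) (q ^ r).
  exists (k * tm_seq (j + a)), (~~ b0), b1; split.
  - by rewrite modulusM k1 modulus_tm_seq mulr1.
  - by rewrite addNb b01.
  move=> m; rewrite big_cons hA -addnA tm_seqMX//.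
  case: b0 {b01 hA} => /=; last by ring.
  set D := if b1 then _ else _.
  transitivity (k * tm_seq (j + a) * D * (tm_seq m * tm_seq m)); first by ring.
  by rewrite sq; ring.
exists (k * tm_seq (j + a - q ^ r)), b0, (~~ b1); split.
- by rewrite modulusM k1 modulus_tm_seq mulr1.
- by rewrite addbN b01.
move=> m; rewrite big_cons hA.
have -> : (q ^ r * m + j + a = q ^ r * m.+1 + (j + a - q ^ r))%N by rewrite mulnS; lia.
rewrite tm_seqMX; last lia.
case: b1 {b01 hA} => /=; last by ring.
set D := if b0 then _ else _; set v := tm_seq m.+1; set u := tm_seq (_ - _).
transitivity (k * u * D * (v * v)); first by ring.
by rewrite sq; ring.
Qed.

Lemma exp_sum_shift f s e x :
  modulus (exp_sum (fun m => f m.+1) s e x) = modulus (exp_sum f s.+1 e.+1 x).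
Proof.
rewrite /exp_sum big_add1/=.
have -> : \sum_(s <= k < e) f k.+1 * e2pi (k.+1%:R * x) =
    e2pi x * \sum_(s <= k < e) f k.+1 * e2pi (k%:R * x).
  rewrite mulr_sumr; apply: eq_bigr => k _.
  by rewrite -[k.+1%:R]natr1 mulrDl mul1r e2piD; ring.
by rewrite modulusM modulus_e2pi mul1r.
Qed.

Lemma modulus_correlation_le (r : nat) (A : seq nat) (s e : nat) x (B : R) :
  all (fun a => a < q ^ r)%N A -> (s <= e)%N ->
  (forall b0 b1 s' e', b0 (+) b1 = odd (size A) ->
     (e' - s' <= (e - s) %/ q ^ r + 1)%N ->
     modulus (exp_sum (local_sign b0 b1) s' e' ((q ^ r)%:R * x)) <= B) ->
  modulus (exp_sum (fun k => \prod_(a <- A) tm_seq (k + a)) s e x) <= (q ^ r)%:R * B.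
Proof.
move=> Ar se bound; have Q0 : (0 < q ^ r)%N by rewrite expn_gt0; lia.
rewrite /exp_sum (sum_residues _ Q0 se).
apply: le_trans (ler_modulus_sum _ _ _) _.
apply: (@le_trans _ _ (\sum_(j < q ^ r) B)); last by rewrite sumr_const card_ord mulr_natl.
apply: ler_sum => j _.
have [k [b0 [b1 [k1 b01 hA]]]] := prod_shifts (ltn_ord j) Ar.
rewrite (@modulus_residue_class (fun n => \prod_(a <- A) tm_seq (n + a)) _ _ _ _ _ _ _ k1 hA).
exact: bound (residue_len Q0 (ltn_ord j) se).
Qed.

End GeneralizedThueMorse.

(** * The sign eigenvector of the spectral cocycle *)

Section SpectralCocycle.
Variables (R : realType) (q : nat) (zeta : substitution 2).
Local Notation C := (complex R).
Hypothesis q2 : (2 <= q)%N.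
Hypothesis hlen : constant_length zeta q.
Hypothesis hbij : bijective_subst zeta q.
Hypothesis hstart : ohead (zeta 0) = Some 0.

Definition letter_sign (a : 'I_2) : C := if a == 0 then 1 else -1.

Definition digit_sign (j : nat) : C := letter_sign (nth 0 (zeta 0) j).

Lemma letter_sign_pm a : letter_sign a = 1 \/ letter_sign a = -1.
Proof. by rewrite /letter_sign; case: eqP; [left|right]. Qed.

Lemma ord2_cases (a : 'I_2) : a = 0 \/ a = 1.
Proof. by case: a => [[|[|//]] ia]; [left|right]; apply: val_inj. Qed.

Lemma digit_sign_pm j : digit_sign j = 1 \/ digit_sign j = -1.
Proof. exact: letter_sign_pm. Qed.

Lemma digit_sign0 : digit_sign 0 = 1.
Proof.
rewrite /digit_sign; move: hstart; case: (subst_letter zeta 0) => //= a s [->].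
by rewrite /letter_sign eqxx.
Qed.

(** The two letters at a given position of [zeta 0] and [zeta 1] are distinct by
  bijectivity, hence opposite as there are only two letters. *)
Lemma letter_sign_subst a j : (j < q)%N ->
  letter_sign (nth 0 (zeta a) j) = letter_sign a * digit_sign j.
Proof.
move=> jq; have [->|->] := ord2_cases a.
  by rewrite {2}/letter_sign eqxx mul1r.
have /bij_inj inj := hbij jq.
have neq : nth 0 (zeta 0) j <> nth 0 (zeta 1) j.
  move=> h; have : (0 : 'I_2) = 1 by apply: inj; rewrite h; apply: set_nth_default; rewrite hlen.
  by [].
rewrite /digit_sign {2}/letter_sign /= mulN1r.
move: neq; have [->|->] := ord2_cases (nth 0 (zeta 0) j);
  have [->|->] := ord2_cases (nth 0 (zeta 1) j) => //.
by rewrite /letter_sign /= opprK.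
Qed.

Lemma sum_count_mem (T : finType) (s : seq T) : (\sum_(a : T) count_mem a s = size s)%N.
Proof.
elim: s => [|b s IH]; first by rewrite big1.
rewrite /= big_split/= IH -add1n; congr (_ + _)%N.
by rewrite (bigD1 b)//= eqxx big1// => a ab; rewrite eq_sym (negbTE ab).
Qed.

(** The substitution has constant length [q], so that the torus map of the cocycle
  is multiplication by [q] on the diagonal. *)
Lemma subst_mxR_const (k : nat) (y : R) :
  (subst_mxR R zeta)^T ^+ k *m const_mx y = const_mx ((q ^ k)%:R * y) :> 'cV_2.
Proof.
elim: k => [|k IH]; first by rewrite expr0 mul1mx expn0 mul1r.
rewrite exprS -mulmxA IH; apply/matrixP => i j; rewrite !mxE.
under eq_bigr do rewrite !mxE.
rewrite -mulr_suml -natr_sum sum_count_mem hlen expnS natrM; ring.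
Qed.

Definition sign_vec : 'cV[C]_2 := \col_a letter_sign a.

Lemma cocycle1_sign_vec (y : R) :
  cocycle1 zeta (const_mx y) *m sign_vec = twist_poly q digit_sign y *: sign_vec.
Proof.
apply/matrixP => a j0; rewrite !mxE.
under eq_bigr do rewrite !mxE mulr_suml.
rewrite exchange_big/= /twist_poly mulr_suml.
transitivity (\sum_(j < size (zeta a)) digit_sign j * e2pi (j%:R * y) * letter_sign a); last by rewrite hlen.
apply: eq_bigr => j _; have jq : (j < q)%N by rewrite -(hlen a).
have -> : \sum_(c <- take j (zeta a)) (const_mx y : 'cV_2) c 0 = j%:R * y.
  under eq_bigr do rewrite mxE.
  rewrite big_const_seq count_predT size_takel ?hlen 1?ltnW// iter_addr_0.
  by rewrite mulr_natl.
set w := tnth _ _; rewrite (bigD1 w)//= eqxx mul1r big1 ?addr0; last first.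
  by move=> b bw; rewrite eq_sym (negbTE bw) !mul0r.
have -> : w = nth 0 (zeta a) j by rewrite /w (tnth_nth 0).
by rewrite letter_sign_subst//; ring.
Qed.

Lemma cocycle_sign_vec n (y : R) :
  cocycle zeta n (const_mx y) *m sign_vec = twist_prod q digit_sign n y *: sign_vec.
Proof.
elim: n => [|n IH]; first by rewrite mul1mx /twist_prod big_ord0 scale1r.
rewrite /= -mulmxA IH -scalemxAr subst_mxR_const cocycle1_sign_vec scalerA.
by rewrite /twist_prod big_ord_recr.
Qed.

Lemma modulus_le_max_norm m (A : 'M[C]_m) i j : modulus (A i j) <= max_norm A.
Proof.
apply: le_trans (le_bigmax _ _ i).
exact: (le_bigmax _ (fun j => modulus (A i j)) j).
Qed.

Lemma twist_prod_le_max_norm n y :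
  modulus (twist_prod q digit_sign n y) <= 2 * max_norm (cocycle zeta n (const_mx y)).
Proof.
have := congr1 (fun M : 'cV[C]_2 => M 0 0) (cocycle_sign_vec n y).
rewrite !mxE /= mulr1 => <-; apply: le_trans (ler_modulus_sum _ _ _) _.
have -> : 2 * max_norm (cocycle zeta n (const_mx y)) =
   \sum_(a < 2) max_norm (cocycle zeta n (const_mx y)).
  by rewrite sumr_const card_ord mulr_natl.
apply: ler_sum => a _; rewrite mxE modulusM (modulus_pm (letter_sign_pm _)) mulr1.
exact: modulus_le_max_norm.
Qed.

(** Half of [e] absorbs the superior limit, and the other half the factor [2] in
  [twist_prod_le_max_norm]. *)
Lemma lyapunov_twist_prod (chi y e : R) : lyapunov zeta y = chi%:E -> 0 < e ->
  exists n0, forall n, (n0 <= n)%N ->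
    modulus (twist_prod q digit_sign n y) <= expR (n%:R * (chi + e)).
Proof.
move=> hl e0; move: hl; rewrite /lyapunov limn_esup_lim; set u := (fun n : nat => _).
move=> hl.
have ce : (chi%:E < (chi + e / 2)%:E)%E by rewrite lte_fin ltrDl divr_gt0.
have inf_chi : ereal_inf (range (esups u)) = chi%:E.
  by rewrite -hl; apply/esym/cvg_lim => //; exact: cvg_esups_inf.
have [_ [n1 _ <-] hn1] : exists2 z, range (esups u) z & (z < (chi + e / 2)%:E)%E.
  by apply: ereal_inf_lt; rewrite inf_chi.
have hu k : (n1 <= k)%N -> (u k < (chi + e / 2)%:E)%E.
  move=> kn; apply: le_lt_trans hn1.
  by apply: ereal_sup_ubound; exists k.
exists (maxn n1.+1 (Num.truncn (2 * ln 2 / e)).+1) => n; rewrite geq_max => /andP[nn1 ne].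
have n0 : 0 < n%:R :> R by rewrite ltr0n; lia.
have ln2 : ln 2 <= n%:R * (e / 2) :> R.
  have : 2 * ln 2 / e < n%:R :> R.
    by apply: lt_le_trans (truncnS_gt _) _; rewrite ler_nat.
  by rewrite ltr_pdivrMr//; lra.
apply: le_trans (twist_prod_le_max_norm n y) _.
have := hu n (ltnW nn1); rewrite /u; set M := max_norm _.
have [M0|M0] := leP M 0; first by move=> _; apply: (@le_trans _ _ 0); [lra | exact: expR_ge0].
rewrite /lne leNgt M0 /= -EFinM lte_fin mulrC ltr_pdivrMr// => h.
have -> : 2 * M = expR (ln 2 + ln M) by rewrite expRD !lnK ?posrE.
by rewrite ler_expR; lra.
Qed.

End SpectralCocycle.

(** * Mahler measure and Lyapunov exponent *)

Section MahlerMeasure.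
Variable R : realType.
Local Notation mu := (@lebesgue_measure R).

Lemma prod_perturb_le (I : eqType) (r : seq I) (a b : I -> R) (d : R) : 0 <= d <= 1 ->
  (forall i, i \in r -> 0 <= a i <= 2) ->
  (forall i, i \in r -> 0 <= b i <= a i + d) ->
  \prod_(i <- r) b i <= \prod_(i <- r) a i + d * 4 ^+ size r.
Proof.
move=> /andP[d0 d1]; suff H : (forall i, i \in r -> 0 <= a i <= 2) ->
  (forall i, i \in r -> 0 <= b i <= a i + d) ->
  [/\ 0 <= \prod_(i <- r) a i <= 4 ^+ size r, 0 <= \prod_(i <- r) b i &
   \prod_(i <- r) b i <= \prod_(i <- r) a i + d * 4 ^+ size r].
  by move=> ha hb; have [] := H ha hb.
elim: r => [|i r IH] ha hb.
  by rewrite !big_nil expr0 mulr1; split; rewrite ?lerDl//; lra.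
have [|j jr|/andP[A0 A4] B0 BA] := IH.
- by move=> j jr; apply: ha; rewrite inE jr orbT.
- by apply: hb; rewrite inE jr orbT.
have /andP[a0 a2] := ha i (mem_head _ _); have /andP[b0 ba] := hb i (mem_head _ _).
rewrite !big_cons /= exprS; move: A0 A4 B0 BA.
set A := \prod_(_ <- _) _; set B := \prod_(_ <- _) _; set X := _ ^+ _ => A0 A4 B0 BA.
split; first by apply/andP; split; [rewrite mulr_ge0|nra].
  by rewrite mulr_ge0.
apply: le_trans (ler_pM b0 B0 ba BA) _.
have X0 : 0 <= X by apply: le_trans A4.
have e1 : d * A <= d * X by rewrite ler_wpM2l.
have e2 : d * X * (a i + d) <= d * X * 3 by rewrite ler_wpM2l ?mulr_ge0//; lra.
lra.
Qed.

Lemma mean01_logpoly K rho tau (b : nat) : (0 < b)%N ->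
  mean01 (fun x : R => logpoly K rho tau (b%:R * x)) = 0.
Proof.
move=> b0.
rewrite (@eq_mean01 _ _ (fun x => \sum_(l < K) (- (rho ^+ l.+1 / l.+1%:R)) *
    cos (2 * pi * (b * l.+1)%N%:Z%:~R * x + - (2 * pi * l.+1%:R * tau)))); last first.
  move=> x; rewrite /logpoly -sumrN; apply: eq_bigr => l _; rewrite mulNr.
  by congr (- (_ * cos _)); rewrite -pmulrn natrM; ring.
rewrite mean01_sum; last first.
  move=> l; apply: continuousM_fun; last exact: continuous_cos_affine.
  by move=> x; exact: cvg_cst.
rewrite big1// => l _; rewrite mean01Z; last exact: continuous_cos_affine.
rewrite mean01_cos ifF ?mulr0//; by apply/negbTE; lia.
Qed.

Lemma continuous_circle_dist (rho tau b : R) :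
  continuous (fun x => circle_dist rho (b * x - tau)).
Proof.
move=> x; rewrite /circle_dist.
apply: (@continuous_comp _ _ _ (fun x => 1 - 2 * rho * cos (2 * pi * (b * x - tau)) + rho ^+ 2) Num.sqrt); last exact: sqrt_continuous.
apply: cvgD; last exact: cvg_cst.
apply: cvgB; first exact: cvg_cst.
apply: cvgM; first exact: cvg_cst.
move: x; rewrite -/(continuous (fun x => cos (2 * pi * (b * x - tau)))).
rewrite (_ : (fun x => _) = (fun x => cos (2 * pi * b * x + - (2 * pi * tau)))).
  exact: continuous_cos_affine.
by apply: funext => y; congr cos; ring.
Qed.

Variables (q : nat) (c : R) (s : seq (R * R)).
Hypothesis q0 : (0 < q)%N.
Hypothesis c1 : 1 <= c.
Hypothesis s01 : all (fun rt : R * R => 0 <= rt.1 <= 1) s.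

Definition factor_prod (n : nat) (x : R) : R :=
  \prod_(k < n) (c * \prod_(rt <- s) circle_dist rt.1 ((q ^ k)%:R * x - rt.2)).

Let L n := [seq (k, rt) | k <- iota 0 n, rt <- s].

Let factor_prodE n x : factor_prod n x =
  c ^+ n * \prod_(p <- L n) circle_dist p.2.1 ((q ^ p.1)%:R * x - p.2.2).
Proof.
rewrite /factor_prod big_split/= prodr_const card_ord; congr (_ * _).
rewrite /L big_allpairs -(big_mkord xpredT (fun k =>
  \prod_(rt <- s) circle_dist rt.1 ((q ^ k)%:R * x - rt.2))).
by rewrite /index_iota subn0.
Qed.

Let L01 n p : p \in L n -> 0 <= p.2.1 <= 1.
Proof. by case/allpairsP => -[k rt] [_ rts ->] /=; exact: (allP s01). Qed.

Lemma factor_prod_ge0 n x : 0 <= factor_prod n x.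
Proof.
apply: prodr_ge0 => k _; rewrite mulr_ge0//; first by apply: le_trans c1.
by apply: prodr_ge0 => rt _; exact: circle_dist_ge0.
Qed.

Lemma continuous_factor_prod n : continuous (factor_prod n).
Proof.
apply: continuous_prod => k; apply: continuousM_fun; first by move=> x; exact: cvg_cst.
by apply: continuous_prod => rt; exact: continuous_circle_dist.
Qed.

Lemma continuous_ln_factor_prod n (eta : R) : 0 < eta ->
  continuous (fun x => ln (factor_prod n x + eta)).
Proof.
move=> e0 x; apply: (@continuous_comp _ _ _ (fun x => factor_prod n x + eta) (@ln R)).
  by apply: cvgD; [exact: continuous_factor_prod | exact: cvg_cst].
by apply: continuous_ln; rewrite ltr_wpDl ?factor_prod_ge0.
Qed.

Lemma exists_expr_lt (r e : R) : 0 <= r < 1 -> 0 < e -> exists K : nat, r ^+ K < e.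
Proof.
move=> /andP[r0 r1] e0.
have : (r ^+ n @[n --> \oo] --> 0).
  by apply: cvg_expr; rewrite ger0_norm.
move=> /cvgrPdist_lt /(_ e e0) [K _ /(_ K (leqnn _))]; rewrite sub0r normrN => h.
by exists K; apply: le_lt_trans (ler_norm _) h.
Qed.

(** The formula of Jensen, as an inequality and without singularities: the roots
  are moved inside the disc, where the logarithm of the distance is uniformly
  close to a trigonometric polynomial of mean zero, and [eta] absorbs the effect
  of this perturbation on the product. *)
Lemma mean01_ln_factor_prod_ge n (eta : R) : 0 < eta ->
  n%:R * ln c <= mean01 (fun x => ln (factor_prod n x + eta)).
Proof.
move=> eta0; apply/ler_addgt0Pr => e e0.
set N := size (L n); have c0 : 0 < c := lt_le_trans ltr01 c1.
have cn0 : 0 < c ^+ n by exact: exprn_gt0.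
have X0 : 0 < c ^+ n * 4 ^+ N by rewrite mulr_gt0// exprn_gt0.
(* [d] is the displacement of the roots, small enough for the product to increase
   by at most [eta], according to [prod_perturb_le]. *)
pose d := Num.min 2^-1 (eta / (c ^+ n * 4 ^+ N)).
have d0 : 0 < d by rewrite lt_min invr_gt0 ltr0n/= divr_gt0.
have d2 : d <= 2^-1 by rewrite ge_min lexx.
have deta : c ^+ n * (d * 4 ^+ N) <= eta.
  rewrite mulrCA -ler_pdivlMr//; by rewrite /d ge_min lexx orbT.
pose r := 1 - d.
have r01 : 0 <= r < 1 by rewrite /r; lra.
have r1 : r < 1 by rewrite /r; lra.
have [|K hK] := @exists_expr_lt r (e * (1 - r) ^+ 2 / (2 * N.+1%:R)) r01.
  by rewrite divr_gt0 ?mulr_gt0 ?exprn_gt0//; lra.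
pose E := 2 * r ^+ K / (1 - r) ^+ 2.
have NE : N%:R * E <= e.
  have r2 : 0 < (1 - r) ^+ 2 by rewrite exprn_gt0//; lra.
  have h1 : E <= e / N.+1%:R.
    rewrite /E ler_pdivrMr// -ler_pdivlMl//; apply: le_trans (ltW hK) _.
    by rewrite le_eqVlt; apply/orP; left; apply/eqP; field; rewrite nat1r pnatr_eq0.
  apply: (@le_trans _ _ (N.+1%:R * (e / N.+1%:R))); last by rewrite mulrCA mulfV ?mulr1// pnatr_eq0.
  apply: ler_pM => //; last by rewrite ler_nat.
  by rewrite /E; apply: divr_ge0 (ltW r2); rewrite mulr_ge0// exprn_ge0//; lra.
pose X x := \sum_(p <- L n) logpoly K (r * p.2.1) p.2.2 ((q ^ p.1)%:R * x).
have cX : continuous X.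
  by apply: continuous_sum => p; apply/continuous_scaled/continuous_logpoly.
have mX : mean01 X = 0.
  rewrite mean01_sum; last by move=> p; apply/continuous_scaled/continuous_logpoly.
  by rewrite big1// => p _; apply: mean01_logpoly; rewrite expn_gt0 q0.
have pointwise x : n%:R * ln c + X x - N%:R * E <= ln (factor_prod n x + eta).
  have P0 : 0 < factor_prod n x + eta by rewrite ltr_wpDl ?factor_prod_ge0.
  rewrite -ler_expR lnK ?posrE// factor_prodE.
  have -> : n%:R * ln c + X x - N%:R * E =
     n%:R * ln c + \sum_(p <- L n) (logpoly K (r * p.2.1) p.2.2 ((q ^ p.1)%:R * x) - E).
    by rewrite sumrB -addrA; congr (_ + (_ - _)); rewrite big_const_seq count_predT iter_addr_0 mulr_natl.
  rewrite expRD expRM_natl lnK ?posrE; last lra.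
  have pert := @prod_perturb_le _ (L n)
    (fun p => circle_dist p.2.1 ((q ^ p.1)%:R * x - p.2.2))
    (fun p => circle_dist (r * p.2.1) ((q ^ p.1)%:R * x - p.2.2)) d.
  have {}pert := pert ltac:(lra).
  have {}pert := pert ltac:(by move=> p pL; rewrite circle_dist_ge0 circle_dist_le2 ?(L01 pL)).
  have {}pert : \prod_(p <- L n) circle_dist (r * p.2.1) ((q ^ p.1)%:R * x - p.2.2) <=
     \prod_(p <- L n) circle_dist p.2.1 ((q ^ p.1)%:R * x - p.2.2) + d * 4 ^+ N.
    apply: pert => p pL; rewrite circle_dist_ge0/=.
    have -> : d = 1 - r by rewrite /r; ring.
    by apply: circle_dist_shrink_le (L01 pL); lra.
  apply: (@le_trans _ _ (c ^+ n * \prod_(p <- L n) circle_dist (r * p.2.1) ((q ^ p.1)%:R * x - p.2.2))).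
    rewrite ler_wpM2l ?(ltW cn0)// expR_sum.
    rewrite big_seq [leRHS]big_seq; apply: ler_prod => p pL; rewrite expR_ge0/=.
    have /andP[p0 p1] := L01 pL; have /andP[r0 _] := r01.
    have /andP[h _] := @circle_dist_approx R K (r * p.2.1) p.2.2 r ((q ^ p.1)%:R * x) ltac:(by rewrite mulr_ge0//= -[leRHS]mulr1 ler_wpM2l) r1.
    exact: h.
  by apply: le_trans (ler_wpM2l (ltW cn0) pert) _; rewrite mulrDr lerD2l.
have cst_c (z : R) : continuous (fun _ : R => z) by move=> x; exact: cvg_cst.
have := le_mean01 (continuousD_fun (continuousD_fun (cst_c (n%:R * ln c)) cX) (cst_c (- (N%:R * E)))) (@continuous_ln_factor_prod n eta eta0) pointwise.
rewrite mean01D//; last exact: continuousD_fun.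
rewrite mean01D// !mean01_cst mX; lra.
Qed.

(** Otherwise take [chi'] between [chi] and [ln c]. The functions
  [1/n * ln (factor_prod n x + exp (n chi'))] are uniformly bounded and converge
  to [chi'] almost everywhere, while their means are at least [ln c]. The
  exponential added inside the logarithm bounds these functions below, so that
  dominated convergence applies. *)
Lemma mahler_measure_le (chi : R) :
  (forall e, 0 < e -> {ae mu, forall x, exists n0, forall n, (n0 <= n)%N ->
     factor_prod n x <= expR (n%:R * (chi + e))}) ->
  ln c <= chi.
Proof.
move=> h; rewrite leNgt; apply/negP => lc; set e := (ln c - chi) / 2.
have e0 : 0 < e by rewrite divr_gt0// subr_gt0.
have {h}he := h e e0; set chi' := chi + e in he.
have cc : chi' < ln c by rewrite /chi' /e; lra.
pose eta n := expR (n%:R * chi').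
pose g n x := n%:R^-1 * ln (factor_prod n x + eta n).
have cg n : continuous (g n).
  apply: continuousM_fun; first by move=> x; exact: cvg_cst.
  by apply: continuous_ln_factor_prod; exact: expR_gt0.
pose D := c * 2 ^+ size s.
have D1 : 1 <= D by rewrite mulr_ege1// exprn_ege1//; lra.
have D0 : 0 < D by lra.
pose W := `|chi'| + ln D + 1.
have lD0 : 0 <= ln D by exact: ln_ge0.
have fp_le n x : factor_prod n x <= expR (n%:R * ln D).
  rewrite expRM_natl lnK ?posrE// -[X in _ ^+ X]card_ord -prodr_const.
  apply: ler_prod => k _.
  have -> : D = c * \prod_(rt <- s) 2 by rewrite /D big_const_seq count_predT iter_mulr_1.
  have p0 : 0 <= \prod_(rt <- s) circle_dist rt.1 ((q ^ k)%:R * x - rt.2).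
    by apply: prodr_ge0 => rt _; exact: circle_dist_ge0.
  have c0 : 0 <= c by exact: le_trans ler01 c1.
  apply/andP; split; [exact: mulr_ge0 | apply: ler_wpM2l => //].
  rewrite big_seq [leRHS]big_seq; apply: ler_prod => rt rts.
  by rewrite circle_dist_ge0 circle_dist_le2//; exact: (allP s01).
have eta_gt0 n : 0 < eta n by exact: expR_gt0.
have g_ge n x : (0 < n)%N -> chi' <= g n x.
  move=> n0; have n0' : 0 < n%:R :> R by rewrite ltr0n.
  rewrite /g ler_pdivlMl// -ler_expR lnK ?posrE; last by rewrite ltr_wpDl ?factor_prod_ge0.
  by rewrite lerDr factor_prod_ge0.
have g_le n x (y : R) : (0 < n)%N -> chi' <= y -> factor_prod n x <= expR (n%:R * y) ->
    g n x <= y + n%:R^-1.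
  move=> n0 cy fy; have n0' : 0 < n%:R :> R by rewrite ltr0n.
  rewrite /g ler_pdivrMl// mulrDr mulfV ?gt_eqF// -ler_expR lnK ?posrE; last first.
    by rewrite ltr_wpDl ?factor_prod_ge0.
  have e2 : eta n <= expR (n%:R * y) by rewrite ler_expR ler_wpM2l.
  have e1 : 2 <= expR 1 :> R by apply: le_trans (expR_ge1Dx _).
  rewrite expRD; have := ler_wpM2l (expR_ge0 (n%:R * y)) e1; lra.
have g_bound n x : `|g n x| <= W.
  case: n => [|n].
    by rewrite /g invr0 mul0r normr0 /W; have := normr_ge0 chi'; lra.
  have h1 := g_ge n.+1 x isT.
  have h2 : g n.+1 x <= `|chi'| + ln D + n.+1%:R^-1.
    apply: g_le => //; first by have := ler_norm chi'; lra.
    by apply: le_trans (fp_le _ _) _; rewrite ler_expR ler_wpM2l// lerDr.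
  have h3 : n.+1%:R^-1 <= 1 :> R by rewrite invf_le1// ler1n.
  rewrite ler_norml /W; have := ler_norm (- chi'); rewrite normrN => h4.
  move: (g n.+1 x) (n.+1%:R^-1 : R) (ln D) `|chi'| lD0 h1 h2 h3 h4 => a b l w.
  by move: chi' {he cc eta g cg fp_le eta_gt0 g_ge g_le W} => z ? ? ? ? ?; lra.
have g_cvg : {ae mu, forall x, `[0, 1]%classic x -> (fun n => (g n x)%:E) @ \oo --> chi'%:E}.
  apply: ae_mono he => x [n0 hn0] _.
  apply: cvg_EFin; first by apply: nearW.
  apply: (@squeeze_cvgr _ _ _ _ (cst chi') (fun n => chi' + n%:R^-1)).
  - exists (maxn 1 n0) => // n /=; rewrite geq_max => /andP[n1 nn0].
    by rewrite g_ge//= g_le// hn0.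
  - exact: cvg_cst.
  - rewrite -[X in _ --> X]addr0; apply: cvgD; first exact: cvg_cst.
    rewrite -(cvg_shiftS (fun n : nat => n%:R^-1 : R)).
    exact: cvg_harmonic.
have mg n : measurable_fun (`[0, 1] : set (measurableTypeR R)) (EFin \o g n).
  exact: measurable_int (integrable01 (cg n)).
have [] := @dominated_convergence _ _ _ mu `[0, 1]%classic (measurable_itv _)
  (fun n x => (g n x)%:E) (cst chi'%:E) (cst W%:E).
- exact: mg.
- exact: measurable_cst.
- exact: g_cvg.
- have cW : continuous (cst W : R -> R) by move=> x; exact: cvg_cst.
  exact: (integrable01 cW).
- by apply: aeW => x n _; rewrite /= lee_fin g_bound.
move=> _ _; rewrite (_ : (\int[mu]_(x in _) _)%E = chi'%:E); last first.
  rewrite integral_cst//= lebesgue_measure_itv/= lte_fin ltr01 /=.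
  by rewrite oppr0 adde0 mule1.
move=> cvg_int; have : ((ln c)%:E <= chi'%:E)%E.
  rewrite -(cvg_lim _ cvg_int)//; apply: lime_ge; first by apply/cvg_ex; eexists; exact: cvg_int.
  exists 1%N => // n /= n1; have n0 : 0 < n%:R :> R by rewrite ltr0n.
  have -> : (\int[mu]_(x in `[0%R, 1%R]) (g n x)%:E)%E = (mean01 (g n))%:E.
    by rewrite /mean01 /Rintegral fineK//; apply: integrable_fin_num => //; exact: integrable01.
  rewrite lee_fin mean01Z; last exact: continuous_ln_factor_prod.
  by rewrite ler_pdivlMl// mean01_ln_factor_prod_ge.
by rewrite lee_fin leNgt cc.
Qed.

End MahlerMeasure.

(** * Small denominators *)

Section SmallDenominators.
Variable R : realType.
Local Notation C := (complex R).
Local Notation mu := (@lebesgue_measure R).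

Lemma modulus_sqr (z : C) : modulus z ^+ 2 = complex.Re z ^+ 2 + complex.Im z ^+ 2.
Proof. by case: z => a b; rewrite /modulus /= sqr_sqrtr// addr_ge0 ?sqr_ge0. Qed.

(** [K] times the Fejer kernel at [b x], as a double sum of cosines whose mean is
  read off from the diagonal. *)
Definition fejer (b K : nat) (x : R) : R :=
  \sum_(i < K) \sum_(j < K) cos (2 * pi * (b%:Z * (i%:Z - j%:Z))%:~R * x + 0).

Lemma continuous_fejer b K : continuous (fejer b K).
Proof.
by apply: continuous_sum => i; apply: continuous_sum => j; exact: continuous_cos_affine.
Qed.

Lemma fejerE b K x :
  fejer b K x = modulus (\sum_(j < K) e2pi (j%:R * (b%:R * x))) ^+ 2.
Proof.
pose th (j : nat) : R := 2 * pi * (j%:R * (b%:R * x)).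
have -> : \sum_(j < K) e2pi (j%:R * (b%:R * x)) =
   Complex (\sum_(j < K) cos (th j)) (\sum_(j < K) sin (th j)).
  elim: K => [|K IH]; first by rewrite !big_ord0.
  by rewrite !big_ord_recr/= IH.
rewrite modulus_sqr /= !expr2 !mulr_suml -big_split/= /fejer.
apply: eq_bigr => i _; rewrite !mulr_sumr -big_split/=; apply: eq_bigr => j _.
by rewrite addr0 -cosB; congr cos; rewrite /th intrM intrB -!pmulrn; ring.
Qed.

Lemma mean01_fejer b K : (0 < b)%N -> mean01 (fejer b K) = K%:R.
Proof.
move=> b0; rewrite mean01_sum; last first.
  by move=> i; apply: continuous_sum => j; exact: continuous_cos_affine.
rewrite (eq_bigr (fun=> 1)); first by rewrite sumr_const card_ord.
move=> i _; rewrite mean01_sum; last by move=> j; exact: continuous_cos_affine.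
rewrite (bigD1 i)//= mean01_cos subrr mulr0 eqxx cos0 big1 ?addr0// => j ji.
rewrite mean01_cos ifF//; move: ji; rewrite -val_eqE/= => ji; apply/negbTE.
by rewrite mulf_neq0 ?subr_eq0//; lia.
Qed.

Lemma modulus_1_sub_expn (z : C) n : modulus z = 1 ->
  modulus (1 - z ^+ n) <= n%:R * modulus (1 - z).
Proof.
move=> z1; elim: n => [|n IH]; first by rewrite expr0 subrr modulus0 mul0r.
have -> : 1 - z ^+ n.+1 = (1 - z) + z * (1 - z ^+ n) by rewrite exprS; ring.
apply: le_trans (ler_modulusD _ _) _; rewrite modulusM z1 mul1r -[n.+1%:R]natr1; lra.
Qed.

Lemma modulus_sum_near_1 (z : C) (K : nat) : modulus z = 1 ->
  modulus (1 - z) <= (2 * K%:R)^-1 -> K%:R / 2 <= modulus (\sum_(j < K) z ^+ j).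
Proof.
case: K => [|K] z1 hz; first by rewrite mul0r modulus_ge0.
have K0 : 0 < K.+1%:R :> R by [].
have : modulus (\sum_(j < K.+1) (1 - z ^+ j)) <= K.+1%:R / 2.
  apply: le_trans (ler_modulus_sum _ _ _) _.
  apply: (@le_trans _ _ (\sum_(j < K.+1) 2^-1)).
    apply: ler_sum => j _; apply: le_trans (modulus_1_sub_expn j z1) _.
    apply: (@le_trans _ _ (K.+1%:R * (2 * K.+1%:R)^-1)).
      apply: ler_pM; rewrite ?modulus_ge0// ler_nat; exact: ltnW (ltn_ord j).
    by rewrite invfM mulrCA mulfV ?gt_eqF// mulr1.
  by rewrite sumr_const card_ord -[_ *+ K.+1]mulr_natl.
rewrite sumrB sumr_const card_ord => h.
have := ler_modulusD (\sum_(j < K.+1) z ^+ j) (K.+1%:R - \sum_(j < K.+1) z ^+ j).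
rewrite addrC subrK.
have -> : modulus (K.+1%:R : C) = K.+1%:R.
  rewrite /modulus (_ : K.+1%:R = Complex (K.+1%:R) 0).
    by rewrite /= expr0n /= addr0 sqrtr_sqr ger0_norm.
  by rewrite -[Complex _ _]/((K.+1%:R)%:C%C) rmorph_nat.
lra.
Qed.

(** If [|1 - e(b q^j x)| <= 1/(2K)], then the [K] terms of the geometric sum nearly
  align and [fejer] is at least [K^2/4], while its mean is [K]. Such [x] thus form
  a set of measure at most [4/K], which is summable for [K = 4 (j + 4)^2]. *)
Lemma ae_modulus_1_sub_ge (q b : nat) : (0 < q)%N -> (0 < b)%N ->
  {ae mu, forall x, 0 <= x <= 1 -> exists j0, forall j, (j0 <= j)%N ->
     (8 * (j + 4)%:R ^+ 2)^-1 <= modulus (1 - e2pi ((b * q ^ j)%:R * x))}.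
Proof.
move=> q0 b0; pose K j := (4 * (j + 4) ^ 2)%N.
have KR j : (K j)%:R = 4 * (j + 4)%:R ^+ 2 :> R by rewrite /K natrM natrX.
have K0 j : 0 < (K j)%:R :> R by rewrite ltr0n muln_gt0 expn_gt0 addn4.
pose F j := fejer (b * q ^ j) (K j).
have cF j : continuous (F j) by exact: continuous_fejer.
have F0 j x : 0 <= F j x by rewrite /F fejerE sqr_ge0.
pose B j := `[0, 1] `&` [set x | (K j)%:R ^+ 2 / 4 <= F j x].
have := @ae_eventually_notin R B (fun j => ((j + 4)%:R ^+ 2)^-1) _ _ _ (@cvg_series_inv_sqr R).
move=> h; apply: ae_mono (h _ _ _); last first.
- move=> j; apply: le_trans (markov_mean01 (cF j) (F0 j) _) _.
    by rewrite divr_gt0// exprn_gt0.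
  rewrite lee_fin /F mean01_fejer ?muln_gt0 ?b0 ?expn_gt0 ?q0//.
  rewrite le_eqVlt; apply/orP; left; apply/eqP; rewrite KR; field.
  by rewrite -natrD pnatr_eq0 addn4.
- by move=> j; rewrite invr_ge0 sqr_ge0.
- by move=> j; exact: measurable_ge_continuous.
move=> x [j0 hj0] x01; exists j0 => j jj0; rewrite leNgt; apply/negP => hlt.
apply: (hj0 j jj0); split; first by rewrite /= in_itv.
rewrite /= /F fejerE.
have := @modulus_sum_near_1 (e2pi ((b * q ^ j)%:R * x)) (K j) (modulus_e2pi _).
move=> /(_ _) hK.
have {}hK : (K j)%:R / 2 <= modulus (\sum_(i < K j) e2pi ((b * q ^ j)%:R * x) ^+ i).
  by apply: hK; rewrite KR mulrA (_ : 2 * 4 = 8 :> R) ?ltW//; ring.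
under eq_bigr do rewrite e2pi_natM.
apply: (@le_trans _ _ (((K j)%:R / 2) ^+ 2)).
  by rewrite le_eqVlt; apply/orP; left; apply/eqP; field.
by apply: lerXn2r => //; rewrite nnegrE ?modulus_ge0// divr_ge0.
Qed.

(** No denominator vanishes: if [e(b q^j x) = 1], this persists for all larger [j]
  and contradicts [ae_modulus_1_sub_ge]. The finitely many small [j] are then
  absorbed into the constant. *)
Lemma ae_small_denominators (q b : nat) : (0 < q)%N -> (0 < b)%N ->
  {ae mu, forall x : R, 0 <= x <= 1 ->
    (forall j, e2pi ((b * q ^ j)%:R * x) != 1) /\
    exists2 D : R, 0 <= D & forall j,
      (modulus (1 - e2pi ((b * q ^ j)%:R * x)))^-1 <= D * (j + 4)%:R ^+ 2}.
Proof.
move=> q0 b0; apply: ae_mono (ae_modulus_1_sub_ge q0 b0) => x h x01.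
have {h} [j0 hj0] := h x01; pose m j := modulus (1 - e2pi ((b * q ^ j)%:R * x)).
have p0 j : 0 < 8 * (j + 4)%:R ^+ 2 :> R by rewrite mulr_gt0// exprn_gt0// ltr0n addn4.
have m0 j : 0 <= m j by exact: modulus_ge0.
split.
  move=> j; apply/eqP => ej.
  have ek k : e2pi ((b * q ^ (j + k))%:R * x) = 1.
    have -> : (b * q ^ (j + k))%:R * x = (q ^ k)%:R * ((b * q ^ j)%:R * x).
      by rewrite expnD !natrM; ring.
    by rewrite e2pi_natM ej expr1n.
  have := hj0 (j + j0)%N (leq_addl _ _); rewrite ek subrr modulus0.
  by rewrite leNgt invr_gt0 p0.
exists (8 + \sum_(j < j0) (m j)^-1).
  by rewrite addr_ge0// sumr_ge0// => j _; rewrite invr_ge0.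
move=> j; have sq1 : 1 <= (j + 4)%:R ^+ 2 :> R by rewrite exprn_ege1// ler1n addn4.
have S0 : 0 <= \sum_(j < j0) (m j)^-1 by rewrite sumr_ge0// => i _; rewrite invr_ge0.
have [jj|jj] := leqP j0 j.
  apply: (@le_trans _ _ (8 * (j + 4)%:R ^+ 2)).
    rewrite -[leRHS]invrK lef_pV2 ?posrE ?invr_gt0//; first exact: hj0.
    by apply: lt_le_trans (hj0 j jj); rewrite invr_gt0.
  by rewrite ler_wpM2r ?sqr_ge0// lerDl.
rewrite (bigD1 (Ordinal jj))//= -/(m j).
have S1 : 0 <= \sum_(i < j0 | i != Ordinal jj) (m i)^-1.
  by rewrite sumr_ge0// => i _; rewrite invr_ge0.
have mj : 0 <= (m j)^-1 by rewrite invr_ge0.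
have h1 : (m j)^-1 <= (m j)^-1 * (j + 4)%:R ^+ 2 by rewrite ler_peMr.
apply: le_trans h1 _; rewrite ler_wpM2r ?sqr_ge0//; lra.
Qed.

End SmallDenominators.

(** * Windows of the points of the subshift *)

Section Windows.
Variables (R : realType) (q : nat) (zeta : substitution 2).
Local Notation C := (complex R).
Hypothesis q2 : (2 <= q)%N.
Hypothesis hlen : constant_length zeta q.
Hypothesis hbij : bijective_subst zeta q.
Hypothesis hstart : ohead (zeta 0) = Some 0.

Local Notation sgn := (@letter_sign R).
Local Notation eps := (@digit_sign R zeta).
Local Notation v := (tm_seq q eps).

Let q0 : (0 < q)%N. Proof. by lia. Qed.

Lemma size_subst_word w : size (subst_word zeta w) = (q * size w)%N.
Proof.
elim: w => [|b w IH]; first by rewrite muln0.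
by rewrite /subst_word /= size_cat hlen -/(subst_word zeta w) IH mulnS.
Qed.

Lemma nth_subst_word w m j : (m < size w)%N -> (j < q)%N ->
  nth 0 (subst_word zeta w) (q * m + j) = nth 0 (zeta (nth 0 w m)) j.
Proof.
move=> + jq; elim: w m => // b w IH [|m] mw.
  by rewrite /subst_word /= nth_cat hlen muln0 jq.
rewrite /subst_word /= nth_cat hlen ifF; last by apply/negbTE; rewrite mulnS; lia.
rewrite -/(subst_word zeta w) -(IH m)//; congr nth; rewrite mulnS; lia.
Qed.

Lemma size_iter_subst n a : size (iter n (subst_word zeta) [:: a]) = (q ^ n)%N.
Proof. by elim: n => //= n IH; rewrite size_subst_word IH expnS. Qed.

Lemma letter_sign_iter_subst n a i : (i < q ^ n)%N ->
  sgn (nth 0 (iter n (subst_word zeta) [:: a]) i) = sgn a * v i.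
Proof.
have e0 : eps 0 = 1 by exact: digit_sign0.
elim: n i => [|n IH] i iq.
  by move: iq; rewrite expn0 ltnS leqn0 => /eqP -> /=; rewrite tm_seq0 mulr1.
have iqn : (i %/ q < q ^ n)%N by rewrite ltn_divLR// mulnC -expnS.
have ir : (i %% q < q)%N by rewrite ltn_mod.
rewrite (divn_eq i q) mulnC /= nth_subst_word ?size_iter_subst//.
rewrite (letter_sign_subst R hlen hbij)// IH// tm_seqM//.
by rewrite mulrA.
Qed.

(** A window occurs in some [zeta^n (a)], whose signs are those of the first [q^n]
  terms of the generalized Thue-Morse sequence, multiplied by the sign of [a]. *)
Lemma window_tm_seq (x : int -> 'I_2) (N : nat) : subst_shift_space zeta x ->
  exists (k : C) (s : nat), (k = 1 \/ k = -1) /\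
    forall i, (i < N)%N -> sgn (x i%:Z) = k * v (s + i).
Proof.
move=> /(_ 0 N) [n [a /infixP [w1 [w2 hw]]]].
exists (sgn a), (size w1); split; first exact: letter_sign_pm.
move=> i iN; rewrite -(@letter_sign_iter_subst n a); last first.
  by rewrite -(size_iter_subst n a) hw !size_cat size_map size_iota ltn_add2l ltn_addr.
rewrite hw nth_cat ifF; last by rewrite ltnNge leq_addr.
rewrite nth_cat size_map size_iota addKn iN (nth_map 0%N) ?size_iota//.
by rewrite nth_iota// add0n add0r.
Qed.

Lemma iter_shift A (x : int -> A) k n : iter k (@shift A) x n = x (n + k%:Z).
Proof.
elim: k n => [|k IH] n; first by rewrite addr0.
by rewrite /= /shift IH; congr x; lia.
Qed.

Lemma signF_letter_sign (x : int -> 'I_2) : signF R x = sgn (x 0).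
Proof.
rewrite /signF /cyl_indic /letter_sign.
by have [->|->] := ord2_cases (x 0); rewrite ?subr0 ?sub0r.
Qed.

Lemma modulus_twisted_correlation (x : int -> 'I_2) (a : seq nat) (N : nat) (y : R) :
  subst_shift_space zeta x -> exists s,
  modulus (twisted_correlation N a y x) =
  modulus (exp_sum (fun k => \prod_(i <- 0%N :: a) v (k + i)) s (s + N) y).
Proof.
(* The window contains all the indices [k + a_i] with [k < N]. *)
move=> xX; have [k [s [k1 hk]]] := @window_tm_seq x (N + sumn a).+1 xX.
exists s; have a_le i : i \in a -> (i <= sumn a)%N.
  elim: (a) => // b a' IH; rewrite inE => /orP[/eqP ->|/IH] /=; lia.
have -> : twisted_correlation N a y x =
    k ^+ (size a).+1 * \sum_(j < N) (\prod_(i <- 0%N :: a) v (s + j + i)) * e2pi (j%:R * y).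
  rewrite mulr_sumr; apply: eq_bigr => j _; have jN := ltn_ord j.
  rewrite signF_letter_sign iter_shift add0r hk; last lia.
  have -> : \prod_(i <- a) signF R (iter (j + i) (@shift _) x) =
      k ^+ size a * \prod_(i <- a) v (s + j + i).
    have -> : k ^+ size a = \prod_(i <- a) k by rewrite big_const_seq count_predT iter_mulr_1.
    rewrite -big_split big_seq [RHS]big_seq; apply: eq_bigr => i /a_le ia.
    rewrite signF_letter_sign iter_shift add0r hk ?addnA//; lia.
  by rewrite big_cons addn0 exprS; ring.
rewrite modulusM; have -> : modulus (k ^+ (size a).+1) = 1.
  have -> : k ^+ (size a).+1 = \prod_(i < (size a).+1) k by rewrite prodr_const card_ord.
  by rewrite modulus_prod big1// => i _; exact: modulus_pm.
have shift_sum (f : nat -> C) : exp_sum f s (s + N) y =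
    \sum_(i < N) f (i + s)%N * e2pi ((i + s)%:R * y).
  by rewrite /exp_sum -{1}[s]add0n big_addn addKn big_mkord.
rewrite mul1r shift_sum; set S := \sum_(i < N) _.
have -> : \sum_(i < N) (\prod_(i0 <- 0%N :: a) v (i + s + i0)) * e2pi ((i + s)%:R * y) =
   e2pi (s%:R * y) * S.
  rewrite /S mulr_sumr; apply: eq_bigr => i _.
  rewrite [(i + s)%N]addnC natrD mulrDl e2piD; ring.
by rewrite modulusM modulus_e2pi mul1r.
Qed.

End Windows.

(** * Twisted correlations in terms of products and small denominators *)

Section Assembly.
Variables (R : realType) (q : nat) (zeta : substitution 2).
Local Notation C := (complex R).
Local Notation mu := (@lebesgue_measure R).
Hypothesis q2 : (2 <= q)%N.
Hypothesis hlen : constant_length zeta q.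
Hypothesis hbij : bijective_subst zeta q.
Hypothesis hstart : ohead (zeta 0) = Some 0.
Variable chi : R.
Hypothesis hchi : is_top_lyapunov_exponent zeta chi.

Local Notation eps := (@digit_sign R zeta).
Local Notation v := (tm_seq q eps).
Local Notation stage_bound j := (Num.sqrt ((2 ^ j)%:R * ln (j + 4)%:R) : R).

Let q0 : (0 < q)%N. Proof. by lia. Qed.
Let eps_pm j : eps j = 1 \/ eps j = -1. Proof. exact: digit_sign_pm. Qed.
Let eps0 : eps 0 = 1. Proof. exact: digit_sign0. Qed.

Lemma ae_all_orbit_prod_le (s : seq (R * R)) (Q : nat) : (0 < Q)%N ->
  all (fun rt => 0 <= rt.1 <= 1) s ->
  {ae mu, forall x, 0 <= x <= 1 -> exists j0, forall rt, rt \in s ->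
    forall j n, (j0 <= j)%N -> (n < 2 ^ j)%N ->
    orbit_prod q rt.1 rt.2 Q n x <= expR (11 * tail_const R * stage_bound j)}.
Proof.
move=> Q0; elim: s => [_|rt s IH /= /andP[rt01 s01]].
  by apply: aeW => x _; exists 0%N.
have h := ae_and (ae_orbit_prod_le rt.2 q2 rt01 Q0) (IH s01).
apply: ae_mono h => x [h1 h2] x01.
have [j1 hj1] := h1 x01; have [j2 hj2] := h2 x01.
exists (maxn j1 j2) => rt'; rewrite inE => /orP[/eqP ->|rts] j n; rewrite geq_max => /andP[a1 a2] nj.
  exact: hj1.
exact: hj2.
Qed.

(** Each factor [c] costs at most [exp chi] by [mahler_measure_le], and each root
  obeys the law of the iterated logarithm. As [c >= 1], this also gives
  [0 <= chi]. *)
Lemma twist_prod_bounds : 0 <= chi /\ exists B0 : R, 0 <= B0 /\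
  forall Q, (0 < Q)%N -> {ae mu, forall x, 0 <= x <= 1 -> exists j0,
    forall j n, (j0 <= j)%N -> (n < 2 ^ j)%N ->
    modulus (twist_prod q eps n (Q%:R * x)) <=
      expR (n%:R * chi + B0 * stage_bound j)}.
Proof.
have [c [s [c1 s01 hs]]] := modulus_trig_factor q0 (modulus_pm (eps_pm q.-1)).
have fp n x : factor_prod q c s n x = modulus (twist_prod q eps n x).
  by rewrite /factor_prod /twist_prod modulus_prod; apply: eq_bigr => k _; rewrite /twist_poly hs.
have lc : ln c <= chi.
  apply: (mahler_measure_le q0 c1 s01) => e e0.
  apply: ae_mono hchi => x hx.
  have [n0 hn0] := lyapunov_twist_prod q2 hlen hbij hx e0.
  by exists n0 => n nn0; rewrite fp; exact: hn0.
have c0 : 0 < c := lt_le_trans ltr01 c1.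
split; first by apply: le_trans lc; exact: ln_ge0.
have T0 : 0 <= tail_const R by rewrite /tail_const exprn_ge0.
exists ((size s)%:R * (11 * tail_const R)); split; first by rewrite !mulr_ge0.
move=> Q Q0; apply: ae_mono (ae_all_orbit_prod_le Q0 s01) => x h x01.
have {h} [j0 hj0] := h x01; exists j0 => j n jj nj.
rewrite -fp /factor_prod.
have -> : \prod_(k < n) (c * \prod_(rt <- s) circle_dist rt.1 ((q ^ k)%:R * (Q%:R * x) - rt.2)) =
   c ^+ n * \prod_(rt <- s) orbit_prod q rt.1 rt.2 Q n x.
  rewrite big_split/= prodr_const card_ord; congr (_ * _); rewrite exchange_big/=.
  apply: eq_bigr => rt _; apply: eq_bigr => k _.
  by rewrite natrM; congr circle_dist; ring.
rewrite expRD; apply: ler_pM.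
- by rewrite exprn_ge0// ltW.
- by apply: prodr_ge0 => rt _; exact: orbit_prod_ge0.
- rewrite expRM_natl; apply: lerXn2r; rewrite ?nnegrE ?expR_ge0 ?(ltW c0)//.
  by rewrite -[leLHS]lnK ?posrE// ler_expR.
- have -> : (size s)%:R * (11 * tail_const R) * stage_bound j =
      \sum_(rt <- s) 11 * tail_const R * stage_bound j.
    by rewrite big_const_seq count_predT iter_addr_0 -mulrA mulr_natl.
  rewrite expR_sum big_seq [leRHS]big_seq; apply: ler_prod => rt rts.
  by rewrite orbit_prod_ge0 hj0.
Qed.

(** The number of digits of [N] in base [q]. *)
Definition depth (N : nat) : nat := (trunc_log q N).+1.

Lemma depth_gt N : (0 < N)%N -> (N < q ^ depth N)%N.
Proof. by move=> N0; have /andP[] := trunc_log_bounds q2 N0. Qed.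

Lemma depth_ln_le N : (0 < N)%N -> (depth N)%:R * ln q%:R <= ln N%:R + ln q%:R :> R.
Proof.
move=> N0; have /andP[h _] := trunc_log_bounds q2 N0.
have lq : 0 < q%:R :> R by rewrite ltr0n.
rewrite /depth -natr1 mulrDl mul1r lerD2r mulr_natl -lnXn//.
by rewrite ler_ln ?posrE ?exprn_gt0 ?ltr0n// -natrX ler_nat.
Qed.

Lemma lnq_ge_half : 2^-1 <= ln q%:R :> R.
Proof.
by apply: le_trans (ln2_ge_half R) _; rewrite ler_ln ?posrE ?ltr0n// ler_nat.
Qed.

Lemma depth_le N : (16 <= N)%N -> (depth N)%:R <= 3 * ln N%:R :> R.
Proof.
move=> N16; have l1 := ln_ge1 R N16; have N0 : (0 < N)%N by lia.
have := depth_ln_le N0; have := lnq_ge_half; rewrite /depth -[(trunc_log q N).+1%:R]natr1.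
set L := ln q%:R; set l := ln N%:R in l1 *; set n := (trunc_log q N)%:R.
have n0 : 0 <= n by exact: ler0n.
move=> L2; rewrite mulrDl mul1r lerD2r => h.
have := ler_wpM2l n0 L2; lra.
Qed.

(** With [n = depth N], of the order of [ln N], the stage [j] is the first one with
  [n < 2^j], so that [2^j] is also of the order of [ln N], and [j] of the order of
  [ln ln N]. The threshold for [N] gives [ln ln N >= 5], which allows to absorb the
  additive constants in [j + 4 <= (ln ln N)^2]. *)
Lemma stage_bound_depth_le (N : nat) : expR (expR 5) <= N%:R :> R ->
  stage_bound (trunc_log 2 (depth N)).+1 <= 4 * Num.sqrt (ln N%:R * ln (ln (ln N%:R))).
Proof.
move=> N5; have NR : 0 < N%:R :> R by apply: lt_le_trans N5; exact: expR_gt0.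
have le5 : expR 5 <= ln N%:R :> R by rewrite -ler_expR lnK ?posrE.
have l0 : 0 < ln N%:R :> R by apply: lt_le_trans le5; exact: expR_gt0.
have ll5 : 5 <= ln (ln N%:R) :> R by rewrite -ler_expR [leRHS]lnK ?posrE.
have N16 : (16 <= N)%N.
  have e1 : 2 <= expR 1 :> R by apply: le_trans (expR_ge1Dx _).
  have e5 : 2 ^+ 5 <= expR 5 :> R.
    by rewrite -[5]mulr1 expRM_natl; apply: lerXn2r; rewrite ?nnegrE ?expR_ge0.
  rewrite -(ler_nat R); apply: le_trans N5; apply: le_trans (expR_ge1Dx _).
  by apply: le_trans (lerD (lexx 1) e5); rewrite -natrX nat1r ler_nat.
set n := depth N; set d := trunc_log 2 n.
have n0 : (0 < n)%N by [].
have /andP[dn nd] := trunc_log_bounds (isT : (1 < 2)%N) n0; rewrite -/d in dn nd.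
have nl : n%:R <= 3 * ln N%:R :> R by exact: depth_le.
have P2 : (2 ^ d.+1)%:R <= 6 * ln N%:R :> R.
  by rewrite expnS natrM; have : (2 ^ d)%:R <= n%:R :> R by [rewrite ler_nat]; lra.
have d_le : d%:R <= 2 * (2 + ln (ln N%:R)) :> R.
  have h : d%:R * ln 2 <= ln (3 * ln N%:R) :> R.
    rewrite mulr_natl -lnXn// ler_ln ?posrE ?exprn_gt0 ?mulr_gt0// -natrX.
    by apply: le_trans nl; rewrite ler_nat.
  have l3 : ln 3 <= 2 :> R by have := @le_ln1Dx R 2 ltac:(lra); rewrite (_ : 1 + 2 = 3)//; ring.
  move: h; rewrite lnM ?posrE// => h.
  have d0 : 0 <= d%:R :> R by [].
  have := ler_wpM2l d0 (ln2_ge_half R); lra.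
set x := ln (ln N%:R) in ll5 d_le *.
have L_le : ln (d.+1 + 4)%:R <= 2 * ln x.
  have x0 : 0 < x by lra.
  have -> : 2 * ln x = ln (x ^+ 2) by rewrite lnXn// mulr_natl.
  rewrite ler_ln ?posrE ?exprn_gt0 ?ltr0n ?addn4// -addn4 natrD -[d.+1%:R]natr1.
  have : 0 <= (x - 5) * (x + 3) by apply: mulr_ge0; lra.
  lra.
have L0 : 0 <= ln (d.+1 + 4)%:R :> R by rewrite ln_ge0// ler1n addn4.
have -> : 4 * Num.sqrt (ln N%:R * ln x) = Num.sqrt (16 * (ln N%:R * ln x)).
  rewrite [in RHS]sqrtrM//; congr (_ * _).
  by rewrite (_ : 16 = 4 ^+ 2) ?sqrtr_sqr ?ger0_norm//; ring.
rewrite ler_wsqrtr//.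
have := ler_pM (ler0n _ _) L0 P2 L_le.
have : 0 <= ln N%:R * ln x.
  by rewrite mulr_ge0 ?(ltW l0)// ln_ge0//; lra.
lra.
Qed.

Lemma correlation_trivial (x : int -> 'I_2) (a : seq nat) (N : nat) (y : R) :
  subst_shift_space zeta x -> modulus (twisted_correlation N a y x) <= N%:R.
Proof.
move=> xX; have [s ->] := modulus_twisted_correlation q2 hlen hbij hstart a N y xX.
rewrite -[N in leRHS](addKn s); apply: modulus_exp_sum_le => k.
by rewrite modulus_prod big1// => i _; exact: modulus_tm_seq.
Qed.

Lemma block_length_le (r N : nat) : (0 < r)%N -> (16 <= N)%N ->
  (N %/ q ^ r + 1 <= q ^ depth N)%N.
Proof.
move=> r0 N16; apply: (@leq_trans N); last by apply/ltnW/depth_gt; lia.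
have : (N %/ q ^ r <= N %/ 2)%N.
  apply: leq_div2l => //; apply: leq_trans q2 _.
  by rewrite -{1}[q]expn1 leq_exp2l.
lia.
Qed.

(** Together with the sign at the shift [0], there is an odd number of factors, so
  that either [tm_seq m] or [tm_seq m.+1] survives alone on each residue class. *)
Lemma correlation_even_le (r : nat) (x : int -> 'I_2) (a : seq nat) (N : nat) (y : R) :
  (0 < r)%N -> all (fun i => i < q ^ r)%N a -> ~~ odd (size a) -> (16 <= N)%N ->
  subst_shift_space zeta x ->
  modulus (twisted_correlation N a y x) <= (q ^ r)%:R *
    (2 * q%:R * \sum_(k < (depth N).+1) modulus (twist_prod q eps k ((q ^ r)%:R * y))).
Proof.
move=> r0 ar odda N16 xX.
have [s ->] := modulus_twisted_correlation q2 hlen hbij hstart a N y xX.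
have Q0 : (0 < q ^ r)%N by rewrite expn_gt0 q0.
apply: modulus_correlation_le => //; first by rewrite /= Q0.
  exact: leq_addr.
move=> b0 b1 s' e'; rewrite addKn /= odda => b01 len.
have {}len : (e' - s' <= q ^ depth N)%N := leq_trans len (block_length_le r0 N16).
case: b0 b1 b01 => [] [] //= _.
  rewrite (_ : exp_sum _ _ _ _ = exp_sum v s' e' ((q ^ r)%:R * y)).
    exact: modulus_exp_sum_tm.
  by apply: eq_bigr => k _; rewrite /local_sign mulr1.
rewrite (_ : exp_sum _ _ _ _ = exp_sum (fun m => v m.+1) s' e' ((q ^ r)%:R * y)).
  by rewrite exp_sum_shift; apply: modulus_exp_sum_tm => //; rewrite subSS.
by apply: eq_bigr => k _; rewrite /local_sign mul1r.
Qed.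

(** Here the number of factors is even, and either both signs or none survive on
  each residue class. *)
Lemma correlation_odd_le (r : nat) (x : int -> 'I_2) (a : seq nat) (N : nat) (y : R) :
  (0 < r)%N -> all (fun i => i < q ^ r)%N a -> odd (size a) -> (16 <= N)%N ->
  subst_shift_space zeta x ->
  (forall k, e2pi ((q ^ r * q ^ k)%:R * y) != 1) ->
  modulus (twisted_correlation N a y x) <= (q ^ r)%:R *
    (3 + \sum_(k < (depth N).+1) 2 * q%:R / modulus (1 - e2pi ((q ^ r * q ^ k)%:R * y))).
Proof.
move=> r0 ar odda N16 xX ny.
have [s ->] := modulus_twisted_correlation q2 hlen hbij hstart a N y xX.
have Q0 : (0 < q ^ r)%N by rewrite expn_gt0 q0.
apply: modulus_correlation_le => //; first by rewrite /= Q0.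
  exact: leq_addr.
move=> b0 b1 s' e'; rewrite addKn /= odda => b01 len.
have {}len : (e' - s' <= q ^ depth N)%N := leq_trans len (block_length_le r0 N16).
pose t k := 2 * q%:R / modulus (1 - e2pi ((q ^ r * q ^ k)%:R * y)).
have t_ge0 k : 0 <= t k by rewrite divr_ge0 ?modulus_ge0 ?mulr_ge0.
have yk k : (q ^ k)%:R * ((q ^ r)%:R * y) = (q ^ r * q ^ k)%:R * y.
  by rewrite natrM; ring.
have -> : \sum_(k < (depth N).+1) 2 * q%:R / modulus (1 - e2pi ((q ^ r * q ^ k)%:R * y)) =
    t 0%N + \sum_(k < depth N) t k.+1 by rewrite big_ord_recl.
case: b0 b1 b01 => [] [] // _.
  rewrite (_ : exp_sum _ _ _ _ = exp_sum (pair_seq q eps) s' e' ((q ^ r)%:R * y)).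
    have ny' k : e2pi ((q ^ k)%:R * ((q ^ r)%:R * y)) != 1 by rewrite yk.
    have len' : (e' - s' <= q ^ depth N + 2)%N by apply: leq_trans len (leq_addr _ _).
    apply: le_trans (modulus_exp_sum_pair q2 eps_pm eps0 len' ny') _.
    rewrite lerD2l (eq_bigr (fun k : 'I_(depth N) => t k.+1)) ?lerDr//.
    by move=> k _; rewrite yk.
  by apply: eq_bigr => k _; rewrite /local_sign /pair_seq.
rewrite (_ : exp_sum _ _ _ _ = exp_sum (fun=> 1) s' e' ((q ^ r)%:R * y)); last first.
  by apply: eq_bigr => k _; rewrite /local_sign mulr1.
have y1 : e2pi ((q ^ r)%:R * y) != 1 by have := ny 0%N; rewrite expn0 muln1.
apply: le_trans (modulus_geometric_sum _ _ y1) _.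
have S0 : 0 <= \sum_(i < depth N) t i.+1 by apply: sumr_ge0 => k _; exact: t_ge0.
apply: (@le_trans _ _ (t 0%N)); last by rewrite addrCA lerDl addr_ge0.
rewrite /t expn0 muln1 ler_wpM2r ?invr_ge0 ?modulus_ge0//.
by rewrite ler_peMr// ler1n.
Qed.

End Assembly.

(** * Estimates at almost every frequency *)

Section Conclusion.
Variables (R : realType) (q : nat) (zeta : substitution 2).
Local Notation C := (complex R).
Local Notation mu := (@lebesgue_measure R).
Hypothesis q2 : (2 <= q)%N.
Hypothesis hlen : constant_length zeta q.
Hypothesis hbij : bijective_subst zeta q.
Hypothesis hstart : ohead (zeta 0) = Some 0.

Lemma all_ltn_exp_sumn (a : seq nat) : all (fun i => i < q ^ (sumn a).+1)%N a.
Proof.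
have h i : i \in a -> (i <= sumn a)%N.
  by elim: (a) => // b a' IH; rewrite inE => /orP[/eqP ->|/IH] /=; lia.
apply/allP => i /h ia; apply: (@leq_ltn_trans (sumn a)) => //.
by apply: leq_trans (ltn_expl _ q2) _; rewrite leq_exp2l.
Qed.

(** The bound on [|P_k|] holds from a stage [j0] on, which depends on the frequency.
  Below the corresponding length [N1], the trivial bound by the number of terms is
  absorbed into the constant. *)
Lemma ae_correlation_even (chi : R) : is_top_lyapunov_exponent zeta chi ->
  exists B : R, 0 < B /\ 0 <= chi /\ forall a : seq nat, ~~ odd (size a) ->
  {ae mu, forall y, 0 <= y < 1 -> exists c, 0 < c /\
    forall x, subst_shift_space zeta x -> forall N, (16 <= N)%N ->
    modulus (twisted_correlation N a y x) <=
      c * (N%:R `^ (chi / ln q%:R) * ln N%:R ^+ (size a).+1 *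
           expR (B * Num.sqrt (ln N%:R * ln (ln (ln N%:R)))))}.
Proof.
move=> hchi; have [chi0 [B0 [B00 hB]]] := twist_prod_bounds q2 hlen hbij hchi.
exists (4 * B0 + 1); split; first by rewrite ltr_wpDl ?mulr_ge0.
split => // a odda; set r := (sumn a).+1.
have Q0 : (0 < q ^ r)%N by rewrite expn_gt0; lia.
apply: ae_mono (hB _ Q0) => y h y01.
have {h} [j0 hj0] := h ltac:(case/andP: y01 => ? /ltW ?; exact/andP).
(* The first term gives [2^j0 <= depth N], and the second one the threshold of
   [stage_bound_depth_le]. *)
set N1 := maxn (q ^ (2 ^ j0)) (Num.truncn (expR (expR 5 : R))).+1.
set K : R := 8 * (q ^ r)%:R * q%:R * expR chi.
have K0 : 0 <= K by rewrite !mulr_ge0 ?expR_ge0.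
have N10 : 0 < N1%:R :> R by rewrite ltr0n leq_max orbT.
exists (N1%:R + K); split; first by rewrite ltr_pwDl.
move=> x xX N N16; have l1 := ln_ge1 R N16.
set l := ln N%:R in l1 *; set S := Num.sqrt _.
have lq := @lnq_ge_half R q q2; set L := ln q%:R in lq *.
have N0 : (0 < N)%N by exact: leq_trans N16.
have NR : 0 < N%:R :> R by rewrite ltr0n.
have S0 : 0 <= S by exact: sqrtr_ge0.
have powE : N%:R `^ (chi / L) = expR (chi / L * l) by rewrite /powR gt_eqF.
have pow1 : 1 <= N%:R `^ (chi / L).
  by rewrite powE -expR0 ler_expR mulr_ge0 ?divr_ge0//; lra.
have l_le : l <= l ^+ (size a).+1.
  by rewrite exprS ler_peMr ?exprn_ege1//; lra.
have eS : expR (4 * B0 * S) <= expR ((4 * B0 + 1) * S).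
  by rewrite ler_expR ler_wpM2r// lerDl.
set P := N%:R `^ _ in pow1 powE *; set E := expR ((4 * B0 + 1) * S) in eS *.
have E1 : 1 <= E.
  by rewrite /E -expR0 ler_expR mulr_ge0 ?addr_ge0 ?mulr_ge0.
have P0 : 0 <= P by lra.
have G1 : 1 <= P * l ^+ (size a).+1 * E.
  by rewrite mulr_ege1 ?mulr_ege1 ?exprn_ege1.
have [small|large] := ltnP N N1.
  apply: le_trans (correlation_trivial q2 hlen hbij hstart a N y xX) _.
  apply: (@le_trans _ _ (N1%:R * (P * l ^+ (size a).+1 * E))).
    by apply: (@le_trans _ _ N1%:R); [rewrite ler_nat ltnW | rewrite ler_peMr ?(ltW N10)].
  by rewrite ler_wpM2r//; [lra|rewrite lerDl].
have ar := all_ltn_exp_sumn a.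
apply: le_trans (correlation_even_le q2 hlen hbij hstart y (ltn0Sn _) ar odda N16 xX) _.
rewrite -/r; set n := depth q N.
move: large; rewrite geq_max => /andP[Nq N5].
have N5R : expR (expR 5) <= N%:R :> R.
  by apply: ltW; apply: lt_le_trans (truncnS_gt _) _; rewrite ler_nat.
have nj0 : (2 ^ j0 <= n)%N by rewrite /n /depth; apply: leqW; exact: trunc_log_max.
set j := (trunc_log 2 n).+1.
have jj0 : (j0 <= j)%N by apply: leqW; exact: trunc_log_max.
have nj : (n < 2 ^ j)%N by have /andP[] := trunc_log_bounds (isT : (1 < 2)%N) (ltn0Sn (trunc_log q N)).
have stage := stage_bound_depth_le q2 N5R; rewrite -/n -/j -/l -/S in stage.
have sum_le : \sum_(k < n.+1) modulus (twist_prod q (@digit_sign R zeta) k ((q ^ r)%:R * y)) <=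
    n.+1%:R * (expR chi * P * E).
  have -> : n.+1%:R * (expR chi * P * E) = \sum_(k < n.+1) expR chi * P * E.
    by rewrite sumr_const card_ord mulr_natl.
  apply: ler_sum => k _; have kn : (k <= n)%N by rewrite -ltnS.
  apply: le_trans (hj0 j k jj0 (leq_ltn_trans kn nj)) _.
  have e2 : expR (k%:R * chi) <= expR chi * P.
    rewrite powE -expRD ler_expR.
    apply: (@le_trans _ _ (n%:R * chi)); first by rewrite ler_wpM2r// ler_nat.
    have := depth_ln_le R q2 N0; rewrite -/n -/L -/l => h.
    have Lp : 0 < L by lra.
    have : n%:R <= l / L + 1.
      by rewrite -(ler_pM2r Lp) mulrDl divfK ?gt_eqF// mul1r.
    move=> /(ler_wpM2r chi0); rewrite mulrDl mul1r addrC.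
    by rewrite (_ : l / L * chi = chi / L * l)//; ring.
  have e3 : expR (B0 * Num.sqrt ((2 ^ j)%:R * ln (j + 4)%:R)) <= E.
    apply: le_trans eS; rewrite ler_expR [4 * B0]mulrC -mulrA ler_wpM2l//.
  rewrite expRD; apply: ler_pM => //; exact: expR_ge0.
have n4 : n.+1%:R <= 4 * l :> R.
  by have := depth_le R q2 N16; rewrite -/n -/l -[n.+1%:R]natr1; lra.
have X0 : 0 <= expR chi * P * E by rewrite !mulr_ge0 ?expR_ge0//; lra.
have c0 : 0 <= (q ^ r)%:R * (2 * q%:R) :> R by rewrite !mulr_ge0.
rewrite mulrA; apply: le_trans (ler_wpM2l c0 sum_le) _.
apply: (@le_trans _ _ ((q ^ r)%:R * (2 * q%:R) * (4 * l ^+ (size a).+1 * (expR chi * P * E)))).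
  by rewrite ler_wpM2l// ler_wpM2r//; lra.
have -> : (q ^ r)%:R * (2 * q%:R) * (4 * l ^+ (size a).+1 * (expR chi * P * E)) =
   K * (P * l ^+ (size a).+1 * E) by rewrite /K; ring.
by rewrite ler_wpM2r//; [lra|rewrite lerDr; lra].
Qed.

(** [depth N + 1 <= 4 ln N] terms, each of the order of [(depth N + 4)^2], hence
  [(ln N)^3]; the exponent is large enough because [size a >= 1]. *)
Lemma ae_correlation_odd (e : R) (a : seq nat) : 0 < e -> odd (size a) ->
  {ae mu, forall y, 0 <= y < 1 -> exists c, 0 < c /\
    forall x, subst_shift_space zeta x -> forall N, (16 <= N)%N ->
    modulus (twisted_correlation N a y x) <= c * ln N%:R `^ ((size a)%:R + 2 + e)}.
Proof.
move=> e0 odda; set r := (sumn a).+1.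
have q0 : (0 < q)%N by lia.
have Q0 : (0 < q ^ r)%N by rewrite expn_gt0 q0.
apply: ae_mono (ae_small_denominators R q0 Q0) => y h y01.
have [ny [D D0 hD]] := h ltac:(case/andP: y01 => ? /ltW ?; exact/andP).
have qD0 : 0 <= 2 * q%:R * D by rewrite !mulr_ge0.
exists ((q ^ r)%:R * (3 + 196 * (2 * q%:R * D))); split.
  by rewrite mulr_gt0 ?ltr0n// ltr_pwDl// mulr_ge0.
move=> x xX N N16; have l1 := ln_ge1 R N16; set l := ln N%:R in l1 *.
have ar := all_ltn_exp_sumn a.
apply: le_trans (correlation_odd_le q2 hlen hbij hstart (ltn0Sn _) ar odda N16 xX ny) _.
rewrite -/r -[leRHS]mulrA ler_wpM2l//; set n := depth q N.
have n3 : n%:R <= 3 * l by exact: (depth_le R q2 N16).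
have l3 : 1 <= l ^+ 3 by exact: exprn_ege1.
have sum_le : \sum_(k < n.+1) 2 * q%:R / modulus (1 - e2pi ((q ^ r * q ^ k)%:R * y)) <=
    196 * (2 * q%:R * D) * l ^+ 3.
  apply: (@le_trans _ _ (\sum_(k < n.+1) 2 * q%:R * D * (7 * l) ^+ 2)).
    apply: ler_sum => k _; rewrite -[leRHS]mulrA ler_wpM2l ?mulr_ge0//.
    apply: le_trans (hD k) _; rewrite ler_wpM2l//.
    have kn : k%:R <= n%:R :> R by rewrite ler_nat -ltnS.
    have k0 : 0 <= k%:R :> R by [].
    by apply: lerXn2r; rewrite ?nnegrE ?natrD; lra.
  rewrite sumr_const card_ord -[_ *+ n.+1]mulr_natl.
  have n4 : n.+1%:R <= 4 * l by rewrite -[n.+1%:R]natr1; lra.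
  have X0 : 0 <= 2 * q%:R * D * (7 * l) ^+ 2 by rewrite mulr_ge0 ?sqr_ge0.
  apply: le_trans (ler_wpM2r X0 n4) _.
  by rewrite le_eqVlt; apply/orP; left; apply/eqP; ring.
apply: (@le_trans _ _ ((3 + 196 * (2 * q%:R * D)) * l ^+ 3)); first lra.
rewrite ler_wpM2l ?addr_ge0 ?mulr_ge0//.
rewrite -powR_mulrn; last lra.
apply: ler_powR => //.
have : 1 <= (size a)%:R :> R by rewrite ler1n; case: (size a) odda.
by lra.
Qed.

Lemma path_ltn_le_last b s i : path ltn b s -> i \in b :: s -> (i <= last b s)%N.
Proof.
elim: s b i => [|c s IH] b i /=; first by rewrite inE => _ /eqP ->.
move=> /andP[bc cs]; rewrite inE => /orP[/eqP ->|]; last exact: IH.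
by apply: leq_trans (ltnW bc) (IH c c cs (mem_head _ _)).
Qed.

(** An increasing sequence of positive integers with last term [l] is a subset of
  [1, ..., l], that is, a mask of [iota 1 l]. The sum over all masks of suitable
  constants dominates each of them. *)
Lemma uniform_constant (good : seq nat -> R -> R -> Prop) :
  (forall a y c c', c <= c' -> good a y c -> good a y c') ->
  exists K : nat -> R -> R, (forall l y, 0 < K l y) /\
   forall a, increasing_positive a -> forall y, (exists c, 0 < c /\ good a y c) ->
     good a y (K (last 0%N a) y).
Proof.
move=> mono.
have ex (p : seq nat * R) : exists c : R, 0 <= c /\
    ((exists c, 0 < c /\ good p.1 p.2 c) -> good p.1 p.2 c).
  have [[c [c0 hc]]|nc] := pselect (exists c, 0 < c /\ good p.1 p.2 c).
    by exists c; split => //; exact: ltW.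
  by exists 0.
have [f hf] := choice ex.
have f0 p : 0 <= f p by have [] := hf p.
exists (fun l y => 1 + \sum_(m : l.-tuple bool) f (mask m (iota 1 l), y)); split.
  by move=> l y; rewrite ltr_pwDl// sumr_ge0.
move=> a /andP[srt pos] y hy.
set l := last 0%N a.
have a_le i : i \in a -> (i <= l)%N.
  by rewrite /l; case: (a) srt => // b s; exact: path_ltn_le_last.
have size_m : size [seq i \in a | i <- iota 1 l] == l by rewrite size_map size_iota.
have am : mask [seq i \in a | i <- iota 1 l] (iota 1 l) = a.
  rewrite -filter_mask; apply: (irr_sorted_eq ltn_trans ltnn) => //.
    by apply: sorted_filter; [exact: ltn_trans | exact: iota_ltn_sorted].
  move=> i; rewrite mem_filter mem_iota; case: (boolP (i \in a)) => //= ia.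
  have := allP pos _ ia; rewrite /= => ->.
  by rewrite add1n ltnS a_le.
have [_ /(_ hy)] := hf (a, y); apply: mono.
rewrite (bigD1 (Tuple size_m))//= am addrCA lerDl addr_ge0//.
by apply: sumr_ge0.
Qed.

End Conclusion.

Theorem corollary4p7 (R : realType) (q : nat) (zeta : substitution 2)
    (hq : (2 <= q)%N)
    (hprim : primitive_subst zeta)
    (haper : aperiodic_subst zeta)
    (hlen : constant_length zeta q)
    (hbij : bijective_subst zeta q)
    (hstart : ohead (zeta 0) = Some 0)
    (chi : R) (hchi : is_top_lyapunov_exponent zeta chi) :
  (exists B : R, 0 < B /\
   exists C : nat -> R -> R, (forall l omega, 0 < C l omega) /\
   forall (t : nat) (a : t.-tuple nat),
     ~~ odd t -> increasing_positive a ->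
     {ae (@lebesgue_measure R), forall omega : R, 0 <= omega < 1 ->
        forall x, subst_shift_space zeta x ->
        forall N : nat, (16 <= N)%N ->
          modulus (twisted_correlation N a omega x) <=
            C (last 0%N a) omega *
            (N%:R `^ (chi / ln q%:R) * ln N%:R ^+ t.+1 *
             expR (B * Num.sqrt (ln N%:R * ln (ln (ln N%:R)))))})
  /\
  (forall eps : R, 0 < eps ->
   exists C : nat -> R -> R, (forall l omega, 0 < C l omega) /\
   forall (t : nat) (a : t.-tuple nat),
     odd t -> increasing_positive a ->
     {ae (@lebesgue_measure R), forall omega : R, 0 <= omega < 1 ->
        forall x, subst_shift_space zeta x ->
        forall N : nat, (16 <= N)%N ->
          modulus (twisted_correlation N a omega x) <=
            C (last 0%N a) omega * ln N%:R `^ (t%:R + 2 + eps)}).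
Proof.
split.
  have [B [B0 [chi0 hB]]] := ae_correlation_even hq hlen hbij hstart hchi.
  exists B; split => //.
  have [|K [K0 hK]] := @uniform_constant R (fun a y c =>
    forall x, subst_shift_space zeta x -> forall N : nat, (16 <= N)%N ->
    modulus (twisted_correlation N a y x) <=
      c * (N%:R `^ (chi / ln q%:R) * ln N%:R ^+ (size a).+1 *
           expR (B * Num.sqrt (ln N%:R * ln (ln (ln N%:R)))))).
    move=> a y c c' cc' hc x xX N N16; apply: le_trans (hc x xX N N16) _.
    rewrite ler_wpM2r// !mulr_ge0 ?powR_ge0 ?expR_ge0// exprn_ge0//.
    by have := ln_ge1 R N16; lra.
  exists K; split => // t a ot ia.
  have sz : size a = t by rewrite size_tuple.
  have := hB a; rewrite sz => /(_ ot); apply: ae_mono => y hy y01.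
  by have := hK a ia y; rewrite sz; apply; exact: hy.
move=> e e0.
have [|K [K0 hK]] := @uniform_constant R (fun a y c =>
    forall x, subst_shift_space zeta x -> forall N : nat, (16 <= N)%N ->
    modulus (twisted_correlation N a y x) <= c * ln N%:R `^ ((size a)%:R + 2 + e)).
  move=> a y c c' cc' hc x xX N N16; apply: le_trans (hc x xX N N16) _.
  by rewrite ler_wpM2r// powR_ge0.
exists K; split => // t a ot ia.
have sz : size a = t by rewrite size_tuple.
have := @ae_correlation_odd R q zeta hq hlen hbij hstart e a e0; rewrite sz => /(_ ot).
apply: ae_mono => y hy y01.
by have := hK a ia y; rewrite sz; apply; exact: hy.
Qed.
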